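(* Assume that $\beta:\mathbb R\to[0,\infty)$ is Lipschitz continuous. For every admissible initial datum $u_0$ there exists a unique solution $u(x,t)$ of the sliding drop problem with initial datum $u_0$.
   Context: Fix constants $V_0>0$ (volume), $\kappa>0$ and $0<\alpha<\pi/2$. Functions in $H^1_0(a,b)$ are extended by $0$ to $\mathbb R$. Set $$\mathcal F(v)=\int_{\mathbb R}\frac12|v_x|^2+\frac{v^2}{2}\kappa\cos\alpha-v\,x\,\kappa\sin\alpha\,dx .$$ Admissible initial datum: a function $u_0$ for which there are $a_0<b_0$ with $\{u_0>0\}=(a_0,b_0)$ and $u_0=\mathrm{argmin}\{\mathcal F(v): v\in H^1_0(a_0,b_0),\ v\ge 0,\ \int v\,dx=V_0\}$. Solution of the sliding drop problem with initial datum $u_0$: a function $u(x,t)$, $t\ge0$, for which there exist Lipschitz functions $a(t),b(t)$ on $[0,\infty)$ with $a(0)=a_0$, $b(0)=b_0$ such that, for all $t\ge 0$, $\{x: u(x,t)>0\}=(a(t),b(t))$ and $$u(\cdot,t)=\mathrm{argmin}\Big\{\mathcal F(v): v\in H^1_0(a(t),b(t)),\ v\ge0,\ \int_{a(t)}^{b(t)} v\,dx=V_0\Big\},$$ and, for a.e. $t\ge0$, $$\min\{a'(t)+\tfrac12|u_x(a(t),t)|^2-\beta(a(t)),\ |u_x(a(t),t)|\}=0,$$ $$\min\{-b'(t)+\tfrac12|u_x(b(t),t)|^2-\beta(b(t)),\ |u_x(b(t),t)|\}=0,$$ where $u_x(a(t),t)$, $u_x(b(t),t)$ are one-sided derivatives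 taken from inside $(a(t),b(t))$. *)

(* Defs.v *)
From HB Require Import structures.
From mathcomp Require Import all_boot all_order all_algebra.
From mathcomp Require Import all_classical all_reals all_analysis.
Import Order.TTheory GRing.Theory Num.Theory.
Import numFieldNormedType.Exports.
Set Implicit Arguments.
Unset Strict Implicit.
Unset Printing Implicit Defensive.
Local Open Scope classical_set_scope.
Local Open Scope ring_scope.

(* Sobolev functions on the line are represented pointwise; membership in
   [H10 a b] selects the continuous representative, extended by 0 to the whole
   line, so that positivity sets and one-sided derivatives make sense. *)

Section Sobolev.
Context {R : realType}.
Local Notation mu := (@lebesgue_measure R).

Definition L2 (g : R -> R) : Prop := g \in Lfun mu 2%:E.

(* C^1 test functions with compact support in I, as in Brezis' treatment of
   W^{1,p}_0; smooth ones would yield the same weak derivatives and spaces. *)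
Definition C1c (I : set R) (phi : R -> R) : Prop :=
  [/\ forall x, derivable phi x 1, continuous (derive1 phi),
      compact (closure [set x | phi x != 0]) &
      closure [set x | phi x != 0] `<=` I].

Definition weak_derivative (v g : R -> R) : Prop :=
  forall phi, C1c setT phi ->
    (\int[mu]_x (v x * derive1 phi x) = - \int[mu]_x (g x * phi x))%R.

Definition H1 (v : R -> R) : Prop :=
  L2 v /\ exists g, L2 g /\ weak_derivative v g.

(* A choice of weak derivative; it is unique up to a null set. *)
Definition wderiv (v : R -> R) : R -> R :=
  xget (cst 0) [set g | L2 g /\ weak_derivative v g].

Definition H1norm (v : R -> R) : R :=
  Num.sqrt (\int[mu]_x (v x ^+ 2) + \int[mu]_x (wderiv v x ^+ 2)).

(* Closure of C1c `]a, b[ for the H^1 norm. *)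
Definition H10 (a b : R) (v : R -> R) : Prop :=
  [/\ continuous v, forall x, ~ `]a, b[%classic x -> v x = 0, H1 v &
      exists phi : nat -> R -> R,
        (forall n, C1c `]a, b[ (phi n)) /\
        (H1norm (fun x => phi n x - v x) @[n --> \oo] --> (0 : R))].

End Sobolev.

Section SlidingDrop.
Context {R : realType}.
Local Notation mu := (@lebesgue_measure R).
Variables V0 kappa alpha : R.

Definition energy (v : R -> R) : R :=
  \int[mu]_x (2^-1 * `|wderiv v x| ^+ 2 + v x ^+ 2 / 2 * (kappa * cos alpha)
              - v x * x * (kappa * sin alpha)).

Definition competitor (a b : R) (v : R -> R) : Prop :=
  [/\ H10 a b v, forall x, 0 <= v x & \int[mu]_(x in `]a, b[) v x = V0].

Definition is_argmin (a b : R) (u : R -> R) : Prop :=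
  competitor a b u /\ forall v, competitor a b v -> energy u <= energy v.

Definition initial_datum_on (a0 b0 : R) (u0 : R -> R) : Prop :=
  [/\ a0 < b0, [set x | 0 < u0 x] = `]a0, b0[%classic & is_argmin a0 b0 u0].

Definition admissible (u0 : R -> R) : Prop :=
  exists a0 b0, initial_datum_on a0 b0 u0.

Definition is_right_deriv (f : R -> R) (x p : R) : Prop :=
  h^-1 * (f (x + h) - f x) @[h --> (0 : R)^'+] --> p.

Definition is_left_deriv (f : R -> R) (x p : R) : Prop :=
  h^-1 * (f (x + h) - f x) @[h --> (0 : R)^'-] --> p.

Definition contact_line_law (beta : R -> R) (u : R -> R -> R) (a b : R -> R)
    (t : R) : Prop :=
  exists p q : R,
  [/\ is_right_deriv (u ^~ t) (a t) p, is_left_deriv (u ^~ t) (b t) q,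
      derivable a t 1 /\ derivable b t 1,
      Num.min (derive1 a t + 2^-1 * `|p| ^+ 2 - beta (a t)) `|p| = 0 &
      Num.min (- derive1 b t + 2^-1 * `|q| ^+ 2 - beta (b t)) `|q| = 0].

(* The spatial variable comes first: [u x t], relevant for [0 <= t] only. *)
Definition solution (beta : R -> R) (u0 : R -> R) (u : R -> R -> R) : Prop :=
  exists a0 b0, initial_datum_on a0 b0 u0 /\
  exists a b : R -> R,
  [/\ [lipschitz a t | t in `[0, +oo[] /\ [lipschitz b t | t in `[0, +oo[],
      a 0 = a0 /\ b 0 = b0,
      forall t, 0 <= t -> [set x | 0 < u x t] = `]a t, b t[%classic,
      forall t, 0 <= t -> is_argmin (a t) (b t) (u ^~ t) &
      {ae mu, forall t, 0 <= t -> contact_line_law beta u a b t}].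

End SlidingDrop.

(* Main.v *)
Require Import Defs.
From HB Require Import structures.
From mathcomp Require Import all_boot all_order all_algebra.
From mathcomp Require Import all_classical all_reals all_analysis measurable_realfun.
From mathcomp Require Import ring lra.
Import Order.TTheory GRing.Theory Num.Theory.
Import numFieldNormedType.Exports.
Set Implicit Arguments.
Unset Strict Implicit.
Unset Printing Implicit Defensive.
Local Open Scope classical_set_scope.
Local Open Scope ring_scope.

(** The problem is well posed because it reduces to a pair of ordinary
    differential equations with reflection.

    On a given interval the constrained minimizer is unique and explicit. The
    energy is strictly convex, so a function that solves the Euler-Lagrange
    equation with the right volume is the minimizer ([box_argmin]), and a
    minimizer that is positive inside the interval satisfies that equation and
    coincides with its solution ([argmin_unique]). The solution [profile] is a
    sum of hyperbolic functions. With E decreasing and O increasing functions of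
    the width w, its slopes are E(w) - O(w) at the left end and - (E(w) + O(w))
    at the right end, and it is positive inside exactly if O(w) <= E(w), that is
    up to a maximal width W ([profile_gt0], [profile_slope],
    [max_width_exists]). So a solution is determined by its two end points.

    The squares of the two slopes differ by a constant 2 gs. With
    G = E^2 + O^2 the contact line law therefore reads, for the front b and the
    width w = b - a,
      b' = (G(w) + gs) / 2 - beta(b),
      w' = G(w) - beta(b) - beta(b - w) - r,
    where r >= 0 vanishes unless w = W ([contact_law_motion],
    [motion_contact_law]): the rear end may run ahead of its equation only while
    its slope is zero. In the coordinates (w, b) this is normal reflection at
    the barrier w = W.

    Uniqueness ([reflected_solution_unique]): the reaction r is monotone, so the
    squared distance of two solutions satisfies a linear differential inequality
    almost everywhere, which suffices for Lipschitz functions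
    ([ae_nonincreasing]).

    Existence ([flow_exists]): Picard iteration with the running maximum as
    regulator solves the system for bounded Lipschitz coefficients
    ([reflected_flow]). The blow-up of G at 0 keeps the width positive, and an a
    priori bound on the drift ([drift_a_priori]), in which the monotonicity of G
    beats the growth of beta, gives Lipschitz constants valid for all times. At
    almost every time of contact w' = 0 ([ae_contact_derive]), so that there the
    reaction is the drift itself, which is nonnegative. *)

(** * Derivatives and monotonicity of Lipschitz functions *)

Section Calculus.
Context {R : realType}.
Implicit Types f g : R -> R.

Lemma is_deriveP f (t d : R) : is_derive t 1 f d <->
  forall e, 0 < e -> exists2 r, 0 < r & forall s, `|s - t| < r ->
    `|f s - f t - d * (s - t)| <= e * `|s - t|.
Proof.
split.
- move=> /is_derive1_caratheodory[g [gE gc gt]] e e0.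
  move/cvgrPdist_le : gc => /(_ e e0); rewrite near_nbhs => -[/= r r0 rg].
  exists r => // s st; rewrite gE -mulrBl normrM ler_wpM2r//.
  by rewrite distrC -gt; apply: rg; rewrite /ball_ /= distrC.
- move=> H; apply/is_derive1_caratheodory.
  exists (fun s => if s == t then d else (f s - f t) / (s - t)); split.
  + move=> z; case: eqP => [->|/eqP zt]; first by rewrite !subrr mulr0.
    by rewrite divfK// subr_eq0.
  + rewrite /prop_for /continuous_at eqxx; apply/cvgrPdist_le => e e0.
    have [r r0 rH] := H e e0; near=> s.
    case: eqP => [_|/eqP st]; first by rewrite subrr normr0 ltW.
    have st0 : 0 < `|s - t| by rewrite normr_gt0 subr_eq0.
    have -> : d - (f s - f t) / (s - t) = - ((f s - f t - d * (s - t)) / (s - t)).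
      by field; rewrite subr_eq0.
    rewrite normrN normrM normfV ler_pdivrMr//; apply: rH.
    by near: s; exists r => // x /=; rewrite distrC.
  + by rewrite eqxx.
Unshelve. all: by end_near. Qed.

Section DeriveRules.
Variables (t df dg : R) (f g : R -> R).
Hypotheses (hf : is_derive t 1 f df) (hg : is_derive t 1 g dg).

Lemma D_cst (c : R) : is_derive t 1 (fun=> c : R) 0. Proof. exact: is_derive_cst. Qed.
Lemma D_id : is_derive t 1 (fun x : R => x) 1. Proof. exact: is_derive_id. Qed.
Lemma D_add : is_derive t 1 (fun x => f x + g x) (df + dg). Proof. exact: is_deriveD. Qed.
Lemma D_sub : is_derive t 1 (fun x => f x - g x) (df - dg). Proof. exact: is_deriveB. Qed.
Lemma D_opp : is_derive t 1 (fun x => - f x) (- df). Proof. exact: is_deriveN. Qed.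
Lemma D_mul : is_derive t 1 (fun x => f x * g x) (df * g t + f t * dg).
Proof. by apply: is_derive_eq (is_deriveM hf hg) _; rewrite /GRing.scale/= addrC (mulrC df). Qed.
Lemma D_scale (c : R) : is_derive t 1 (fun x => c * f x) (c * df).
Proof. exact: is_deriveZ. Qed.
Lemma D_expR : is_derive t 1 (fun x => expR (f x)) (df * expR (f t)).
Proof. by rewrite mulrC; apply: is_derive1_comp. Qed.
Lemma D_inv : f t != 0 -> is_derive t 1 (fun x => (f x)^-1) (- df / f t ^+ 2).
Proof.
by move=> f0; apply: is_derive_eq (is_deriveV f0 hf) _; rewrite /GRing.scale/= mulNr mulNr mulrC.
Qed.
End DeriveRules.

Lemma D_ext f (t d d' : R) : is_derive t 1 f d -> d = d' -> is_derive t 1 f d'.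
Proof. by move=> h <-. Qed.

Lemma D_comp f g (t df dg : R) : is_derive (g t) 1 f df -> is_derive t 1 g dg ->
  is_derive t 1 (fun x => f (g x)) (df * dg).
Proof. exact: is_derive1_comp. Qed.

(** Local monotonicity to the right propagates by a supremum argument, and left
    lower semicontinuity carries the bound to the supremum itself. No derivative
    occurs, so that it applies to reflected paths and to the correction by a
    measure in [ae_nonincreasing]. *)
Lemma right_creep f (a b : R) : a <= b ->
  (forall t, a < t <= b -> forall e, 0 < e ->
     exists2 r, 0 < r & forall s, a <= s <= t -> t - r < s -> f t <= f s + e) ->
  (forall t, a <= t < b ->
     exists2 r, 0 < r & forall s, t < s < t + r -> s <= b -> f s <= f t) ->
  f b <= f a.
Proof.
move=> ab lsc loc.
pose S := [set t | a <= t <= b /\ forall s, a <= s <= t -> f s <= f a].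
have Sa : S a.
  by split=> [|s sa]; [rewrite lexx|rewrite (_ : s = a)//; apply/eqP; rewrite eq_le andbC].
have hS : has_sup S by split; [exists a|exists b => t [/andP[]]].
pose c := sup S.
have ac : a <= c by exact: ub_le_sup hS.2 _ Sa.
have cb : c <= b by apply: ge_sup => [|t [/andP[]]]//; exists a.
have below s : a <= s -> s < c -> f s <= f a.
  move=> as_ sc; have [t St st] := sup_gt hS.1 sc.
  by apply: St.2; rewrite as_ ltW.
have fc : f c <= f a.
  move: ac; rewrite le_eqVlt => /predU1P[<-//|ac].
  apply/ler_addgt0Pr => e e0; have [|r r0 rH] := lsc c _ e e0; first by rewrite ac.
  pose s := Num.max a (c - r / 2).
  have sc : s < c by rewrite /s gt_max ac/=; lra.
  have as_ : a <= s by rewrite /s le_max lexx.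
  have := rH s; rewrite as_ ltW//= => /(_ isT).
  have crs : c - r < s by rewrite /s lt_max; apply/orP; right; lra.
  by move=> /(_ crs) /le_trans; apply; rewrite lerD2r below.
move: cb; rewrite le_eqVlt => /predU1P[<-//|cb].
have [|r r0 rH] := loc c; first by rewrite ac cb.
pose s := Num.min b (c + r / 2).
have sb : s <= b by rewrite /s ge_min lexx.
have cs : c < s by rewrite /s lt_min cb/=; lra.
have : S s.
  split; first by rewrite (le_trans ac (ltW cs)).
  move=> x /andP[ax xs]; have [xc|] := leP x c.
    by move: xc; rewrite le_eqVlt => /predU1P[->//|]; exact: below.
  move=> cx; apply: le_trans fc; apply: rH; last exact: le_trans sb.
  rewrite cx (le_lt_trans xs)// /s gt_min; apply/orP; right; lra.
move=> /(ub_le_sup hS.2); rewrite -/c => /le_lt_trans /(_ cs).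
by rewrite ltxx.
Qed.

(** Below the barrier the maximum of [f] and [M] is constant, which reduces to
    [right_creep]. *)
Lemma right_barrier f (M a b : R) : a <= b -> continuous f -> f a <= M ->
  (forall t, a <= t < b -> M <= f t ->
     exists2 r, 0 < r & forall s, t < s < t + r -> s <= b -> f s <= f t) ->
  f b <= M.
Proof.
move=> ab cf faM loc.
have cfe t e : 0 < e -> exists2 r, 0 < r & forall s, `|t - s| < r -> `|f t - f s| <= e.
  move=> e0; have /cvgrPdist_le/(_ e e0) := cf t; rewrite near_nbhs => -[r /= r0 rH].
  by exists r.
suff : Num.max (f b) M <= Num.max (f a) M.
  by rewrite (max_idPr faM) ge_max => /andP[].
apply: (right_creep (f := fun t => Num.max (f t) M)) => //.
- move=> t _ e e0; have [r r0 rH] := cfe t e e0; exists r => // s /andP[_ st] ts.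
  have := rH s; rewrite ger0_norm ?subr_ge0// => /(_ _)/ler_normlP[]; first lra.
  move=> _ h; rewrite ge_max; apply/andP; split.
    by apply: (@le_trans _ _ (f s + e)); [lra|rewrite lerD2r le_max lexx].
  by apply: (@le_trans _ _ (M + e)); [lra|rewrite lerD2r le_max lexx orbT].
- move=> t tab; have [Mt|tM] := leP M (f t).
    have [r r0 rH] := loc t tab Mt; exists r => // s ts sb.
    by rewrite /= ge_max Mt rH.
  have [|r r0 rH] := cfe t (M - f t); first lra.
  exists r => // s /andP[ts str] sb.
  have := rH s; rewrite distrC ger0_norm ?subr_ge0 ?(ltW ts)// => /(_ _)/ler_normlP[]; first lra.
  move=> h _; rewrite /= ge_max lexx andbT; lra.
Qed.

Local Notation mu := (@lebesgue_measure R).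

(** The integral starts at -1 so that the derivative at 0 is two-sided. *)
Lemma antiderivative f : continuous f ->
  exists F : R -> R, F 0 = 0 /\ forall t : R, -1 < t -> is_derive t 1 F (f t).
Proof.
move=> cf; pose F x := (\int[mu]_(t in [set` `[-1, x]]) (f t))%R.
have dF (t : R) : -1 < t -> is_derive t 1 F (f t).
  move=> t1; have [||||dF eF] := @continuous_FTC1_closed R f (-1) t (t + 1).
  - by rewrite ltrDl.
  - apply: continuous_compact_integrable; first exact: segment_compact.
    exact: continuous_subspaceT.
  - exact: t1.
  - exact: cf.
  by rewrite -eF derive1E; exact: derivableP.
exists (fun x => F x - F 0); split=> [|t t1]; first by rewrite subrr.
rewrite -[f t]subr0; apply: is_deriveB; exact: dF.
Qed.

Lemma lipschitz_fun_continuous f (K : R) :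
  (forall s t, `|f s - f t| <= K * `|s - t|) -> continuous f.
Proof.
move=> lipf t; apply/cvgrPdist_le => e e0.
have K0 : 0 <= K by have := lipf 1 0; rewrite subr0 normr1 mulr1; exact: le_trans.
have K1 : 0 < K + 1 by lra.
near=> s.
apply: (le_trans (lipf t s)).
have : `|t - s| <= e / (K + 1).
  near: s; exists (e / (K + 1)); first by rewrite /= divr_gt0.
  by move=> x /ltW.
rewrite ler_pdivlMr// => h; have := normr_ge0 (t - s); nra.
Unshelve. all: by end_near. Qed.

Lemma ler_increment f g (df dg : R -> R) (a t : R) : a <= t ->
  (forall s : R, a <= s -> is_derive s 1 f (df s)) ->
  (forall s : R, a <= s -> is_derive s 1 g (dg s)) ->
  (forall s, a < s < t -> df s <= dg s) -> f t - f a <= g t - g a.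
Proof.
move=> t0 hf hg fg.
have d (s : R) : a <= s -> is_derive s 1 (g - f) (dg s - df s).
  by move=> s0; apply: is_deriveB; [exact: hg|exact: hf].
have := @ger0_derive1_ndecr R (g - f) a t.
move=> /(_ _ _ _ a t (lexx _) t0 (lexx _)).
have -> : ((g - f) a <= (g - f) t) = (f t - f a <= g t - g a).
  by rewrite -subr_ge0 -[RHS]subr_ge0; congr (0 <= _); rewrite !fctE; ring.
apply.
- by move=> x; rewrite in_itv/= => /andP[/ltW x0 _]; have [] := d x x0.
- move=> x; rewrite in_itv/= => /andP[x0 xt]; have [_] := d x (ltW x0).
  by rewrite derive1E => ->; rewrite subr_ge0 fg ?x0.
- apply: derivable_within_continuous => x; rewrite in_itv/= => /andP[x0 _].
  by have [] := d x x0.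
Qed.

(** The exceptional set is covered by an open set [U] of small measure. There
    [f] grows at most at rate [K], which is absorbed by subtracting [K] times the
    measure of the part of [U] to the left; elsewhere the derivative decides. *)
Lemma ae_nonincreasing f (K a b : R) (N : set R) : a <= b ->
  {in `[a, b] &, forall s t, `|f s - f t| <= K * `|s - t|} ->
  mu.-negligible N ->
  (forall t, a < t < b -> ~ N t -> exists2 d, d <= 0 & is_derive t 1 f d) ->
  f b <= f a.
Proof.
move=> ab lipf negN df.
have K0 : 0 <= K \/ a = b.
  move: ab; rewrite le_eqVlt => /predU1P[->|ab]; [by right|left].
  have := lipf a b; rewrite !in_itv/= !lexx (ltW ab) => /(_ isT isT).
  move=> /(le_trans (normr_ge0 _)); rewrite pmulr_lge0// normr_gt0 subr_eq0.
  by rewrite lt_eqF.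
case: K0 => [K0|->//].
apply/ler_addgt0Pr => e e0.
(* [e1] bounds both the measure of [U] and the slope allowed off [U]: the total
   error is [e1 * (b - a) + K * e1]. *)
pose e1 := e / (b - a + K + 1).
have D0 : 0 < b - a + K + 1 by rewrite -subr_ge0 in ab; lra.
have e10 : 0 < e1 by rewrite divr_gt0.
have [A [mA A0 NA]] : exists A : set R, [/\ measurable A, mu A = 0 & N `|` [set a] `<=` A].
  suff [A HA] : mu.-negligible (N `|` [set a]) by exists A.
  by apply: negligibleU => //; apply/negligibleP => //; exact: lebesgue_measure_set1.
have [|U [oU AU Ue]] := @lebesgue_regularity_outer R A e1 mA _ e10; first by rewrite [ltLHS]A0 ltry.
have mU : measurable U by exact: open_measurable.
have UE : (mu U < e1%:E)%E.
  rewrite (_ : U = (U `\` A) `|` A); last by rewrite setUC setDUK.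
  rewrite (le_lt_trans (measureU2 _ _ _))//; first exact: measurableD.
  by rewrite [X in (_ + X)%E]A0 adde0.
pose m t := fine (mu (U `&` `[a, t])).
have mfin t : mu (U `&` `[a, t]) \is a fin_num.
  rewrite ge0_fin_numE//; apply: le_lt_trans (lt_trans UE (ltry _)).
  by apply: le_measure; rewrite ?inE//; exact: measurableI.
have mE t : (m t)%:E = mu (U `&` `[a, t]) by rewrite fineK.
have me t : m t <= e1.
  rewrite -lee_fin mE (le_trans _ (ltW UE))//.
  by apply: le_measure; rewrite ?inE//; exact: measurableI.
have mnd s t : s <= t -> m s <= m t.
  move=> st; rewrite -lee_fin !mE; apply: le_measure; rewrite ?inE//; try exact: measurableI.
  by apply: setIS; apply: subset_itvl; rewrite bnd_simp.
have ma : m a = 0.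
  apply/eqP; rewrite -eqe mE; apply/eqP.
  apply: (@subset_measure0 _ _ _ mu _ [set a]) => //; first exact: measurableI.
    by move=> x [_]; rewrite set_itv1.
  exact: lebesgue_measure_set1.
have mU1 s t : a <= s -> s <= t -> `]s, t] `<=` U -> m t = m s + (t - s).
  move=> as_ st stU; apply/eqP; rewrite -eqe EFinD !mE.
  have I : mu `]s, t]%classic = (t - s)%:E.
    rewrite lebesgue_measure_itv/= lte_fin; case: ltP => [_|ts]; first by rewrite EFinB.
    have -> : t = s by apply/eqP; rewrite eq_le ts st.
    by rewrite subrr.
  have -> : U `&` `[a, t] = (U `&` `[a, s]) `|` `]s, t]%classic.
    apply/seteqP; split=> x /=; rewrite !in_itv/=.
    - by move=> [Ux /andP[ax xt]]; case: (leP x s) => xs; [left|right]; rewrite ?ax ?xs.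
    - move=> [[Ux /andP[ax xs]]|/andP[sx xt]]; split=> //.
      + by rewrite ax (le_trans xs st).
      + by apply: stU; rewrite /= in_itv/= sx.
      + by rewrite xt (le_trans as_ (ltW sx)).
  rewrite measureU//; last 2 first.
  - exact: measurableI.
  - by apply/seteqP; split=> // x [[_ /=]]; rewrite !in_itv/= => /andP[_ xs] /andP[/(le_lt_trans xs)]; rewrite ltxx.
  by apply/eqP; congr (_ + _)%E; exact: I.
pose g t := f t - e1 * (t - a) - K * m t.
have gbe : g b <= g a.
  apply: right_creep => //.
  - move=> t /andP[at_ tb] x x0; exists (x / (K + 1)); first by rewrite divr_gt0//; lra.
    move=> s /andP[as_ st] ts.
    have h1 : f t <= f s + K * (t - s).
      have := lipf t s; rewrite !in_itv/= as_ tb (ltW at_) (le_trans st tb) => /(_ isT isT).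
      by rewrite (ger0_norm (_ : 0 <= t - s)) ?subr_ge0// => /ler_normlP[_]; lra.
    have h2 : K * m s <= K * m t by rewrite ler_wpM2l ?mnd.
    have h3 : e1 * (s - a) <= e1 * (t - a) by rewrite ler_wpM2l ?(ltW e10)//; lra.
    have h4 : K * (t - s) <= x.
      have : (t - s) * (K + 1) <= x by rewrite -ler_pdivlMr; lra.
      by move: st; lra.
    by rewrite /g; lra.
  - move=> t /andP[at_ tb]; have [tA|tA] := pselect (U t).
      move: oU; rewrite openE => /(_ _ tA); rewrite /interior -nbhs_ballE => -[r /= r0 rU].
      exists r => // s /andP[ts str] sb.
      have ms : m s = m t + (s - t).
        apply: (mU1 t s at_ (ltW ts)) => x; rewrite /= in_itv/= => /andP[tx xs]; apply: rU.
        by rewrite /ball/= ltr0_norm; lra.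
      have := lipf s t; rewrite !in_itv/= sb at_ (ltW tb) (le_trans at_ (ltW ts)) => /(_ isT isT).
      rewrite (ger0_norm (_ : 0 <= s - t)) ?subr_ge0 ?(ltW ts)// => /ler_normlP[_] h.
      have h3 : e1 * (t - a) <= e1 * (s - a) by rewrite ler_wpM2l ?(ltW e10)//; lra.
      by rewrite /g ms mulrDr; lra.
    have tNa : ~ (N `|` [set a]) t by move=> /NA /AU.
    have at' : a < t by rewrite lt_neqAle at_ andbT; apply/eqP => ?; apply: tNa; right.
    have [|d d0 /is_deriveP dt] := df t _ (fun h => tNa (or_introl h)); first by rewrite at' tb.
    have [r r0 rH] := dt e1 e10.
    exists r => // s /andP[ts str] sb.
    have := rH s; rewrite (ger0_norm (_ : 0 <= s - t)) ?subr_ge0 ?(ltW ts)// => /(_ _)/ler_normlP[]; first lra.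
    move=> _ h.
    have h2 : K * m t <= K * m s by rewrite ler_wpM2l ?mnd ?(ltW ts).
    have h3 : d * (s - t) <= 0 by have := ts; nra.
    by rewrite /g; lra.
move: gbe; rewrite /g ma => gbe.
have h1 : K * m b <= K * e1 by rewrite ler_wpM2l.
have h2 : e1 * (b - a + K + 1) = e by rewrite /e1 divfK// gt_eqF.
by nra.
Qed.

(** At a density point of the contact set every nearby point is relatively
    close to a contact point, so that a Lipschitz function is stationary. *)
Lemma ae_contact_derive f (K c : R) :
  (forall s t, `|f s - f t| <= K * `|s - t|) ->
  {ae mu, forall t, f t = c -> is_derive t 1 f 0}.
Proof.
move=> lipf.
have K0 : 0 <= K by have := lipf 1 0; rewrite subr0 normr1 mulr1; exact: le_trans.
have cf : continuous f by exact: lipschitz_fun_continuous lipf.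
pose C := [set t | f t = c].
have cC : closed C by apply: (@preimage_closed _ _ f [set x | x = c]) => [x _|]; [exact: cf|exact: closed_eq].
have mC : measurable C by exact: closed_measurable.
have := lebesgue_density mC.
apply: filterS; first exact: (ae_filter_ringOfSetsType mu).
move=> t dens ftc; apply/is_deriveP => e e0.
rewrite indicE mem_set//= in dens.
have e10 : 0 < e / (K + 1) by rewrite divr_gt0//; lra.
set e1 := e / (K + 1) in e10.
(* A ball of radius [e1 * d] around [s] free of contact points would occupy the
   fraction [q] of the ball of radius [(1 + e1) * d] around [t]. *)
pose q := e1 / (1 + e1).
have q0 : 0 < q by rewrite divr_gt0//; lra.
have [r r0 rH] : exists2 r, 0 < r & forall h, 0 < h < r ->
    h *+ 2 * (1 - q) < fine (mu (C `&` ball t h)).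
  have [_ /cvgrPdist_lt/(_ q q0)] := (fine_cvgP _ _).1 dens.
  rewrite near_withinE near_nbhs => -[r /= r0 rH]; exists r => // h /andP[h0 hr].
  have := rH h; rewrite /= sub0r normrN gtr0_norm// => /(_ hr h0).
  have b0 : (0 < h *+ 2) by rewrite mulrn_wgt0.
  have cfin : mu (C `&` ball t h) \is a fin_num.
    rewrite ge0_fin_numE//; apply: (@le_lt_trans _ _ (mu (ball t h))).
      apply: le_measure; rewrite ?inE//; [apply: measurableI => //|]; exact: measurable_ball.
    by rewrite lebesgue_measure_ball ?ltW// ltry.
  rewrite lebesgue_measure_ball ?ltW// -(fineK cfin) inver gt_eqF//= => /ltr_normlP[_].
  rewrite ltrBlDr -ltrBlDl ltr_pdivlMr//.
  by rewrite mulrC.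
exists (r / (1 + e1)); first by rewrite divr_gt0//; lra.
move=> s st; rewrite mul0r subr0.
have [->|/eqP st0] := eqVneq s t; first by rewrite !subrr normr0 mulr0.
have d0 : 0 < `|s - t| by rewrite normr_gt0 subr_eq0; apply/eqP.
set d := `|s - t| in st d0 *.
have [p [pC ps]] : exists p, f p = c /\ `|s - p| <= e1 * d.
  apply: contrapT => nop.
  pose h := (1 + e1) * d.
  have h0 : 0 < h by rewrite mulr_gt0//; lra.
  have hr : h < r by move: st; rewrite ltr_pdivlMr; [rewrite mulrC|lra].
  have := rH h; rewrite h0 hr => /(_ isT); apply/negP; rewrite -leNgt.
  have ed0 : 0 < e1 * d by rewrite mulr_gt0.
  have mb x y : measurable (ball x y : set R) by exact: measurable_ball.
  have sub : ball s (e1 * d) `<=` ball t h.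
    move=> x; rewrite /ball/= => xs.
    have : `|t - x| <= `|t - s| + `|s - x| by exact: ler_distD.
    by rewrite (distrC t s) -/d /h; lra.
  have le : (mu (C `&` ball t h) + mu (ball s (e1 * d)) <= mu (ball t h))%E.
    have mCt : measurable (C `&` ball t h) by apply: measurableI => //; exact: measurable_ball.
    have ms : measurable (ball s (e1 * d) : set R) by exact: measurable_ball.
    have dis : (C `&` ball t h) `&` ball s (e1 * d) = set0.
      apply/seteqP; split=> // x [[Cx tx] sx]; apply: nop; exists x; split=> //.
      exact: ltW.
    rewrite -(measureU mu mCt ms dis); apply: le_measure; rewrite ?inE//.
    - exact: measurableU.
    - exact: measurable_ball.
    - by move=> x [[]//|]; exact: sub.
  move: le; rewrite !lebesgue_measure_ball ?(ltW h0) ?(ltW ed0)//.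
  case: (mu _) => [x| |]//=; last first.
    move=> _; rewrite mulr_ge0//; first by rewrite mulrn_wge0 ?ltW.
    by rewrite /q subr_ge0 ler_pdivrMr; lra.
  rewrite -EFinD lee_fin -lerBrDr => /le_trans; apply.
  have -> : h *+ 2 * (1 - q) = h *+ 2 - e1 * d *+ 2.
    by rewrite /h /q; field; lra.
  by [].
rewrite ftc -pC; apply: (le_trans (lipf s p)).
have -> : e * d = e1 * d * (K + 1) by rewrite mulrAC divfK//; lra.
rewrite mulrC; apply: ler_pM => //; lra.
Unshelve. all: by end_near. Qed.

End Calculus.

(** * Reflection at a barrier: the running excess *)

Section RunningExcess.
Context {R : realType}.
Variable W : R.
Implicit Types X Y : R -> R.

Definition lip0 (K : R) X := forall s t, 0 <= s -> 0 <= t -> `|X s - X t| <= K * `|s - t|.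

Let excess_set X t := [set y | y = 0 \/ exists2 s, 0 <= s <= t & y = X s - W].

(** The regulator of the Skorokhod problem: the least nonnegative
    nondecreasing process whose subtraction keeps the path below [W]. The element
    0 of the set accounts for the positive part. *)
Definition excess X t : R := sup (excess_set X t).

Lemma lip0_ge0 K X : lip0 K X -> 0 <= K.
Proof.
by move=> /(_ 1 0 ler01 (lexx 0)); rewrite subr0 normr1 mulr1; exact: le_trans.
Qed.

Lemma lip0_le K X s t : lip0 K X -> 0 <= s -> s <= t -> X t <= X s + K * (t - s).
Proof.
move=> lX s0 st; have := lX t s (le_trans s0 st) s0.
by rewrite (ger0_norm (_ : 0 <= t - s)) ?subr_ge0// => /ler_normlP[_]; lra.
Qed.

Let has_sup_excess K X t : lip0 K X -> has_sup (excess_set X t).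
Proof.
move=> lX; split; first by exists 0; left.
exists (Num.max 0 (X 0 - W + K * t)) => y [->|[s /andP[s0 st] ->]]; first by rewrite le_max lexx.
rewrite le_max; apply/orP; right.
have := lip0_le lX (lexx 0) s0; rewrite subr0.
have : K * s <= K * t by rewrite ler_wpM2l// (lip0_ge0 lX).
lra.
Qed.

Lemma excess_ge0 K X t : lip0 K X -> 0 <= excess X t.
Proof. by move=> lX; apply: (ub_le_sup (has_sup_excess t lX).2); left. Qed.

Lemma excess_ge K X s t : lip0 K X -> 0 <= s <= t -> X s - W <= excess X t.
Proof. by move=> lX st; apply: (ub_le_sup (has_sup_excess t lX).2); right; exists s. Qed.

Lemma excess_le X t c : 0 <= c -> (forall s, 0 <= s <= t -> X s - W <= c) -> excess X t <= c.
Proof.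
move=> c0 h; apply: ge_sup; first by exists 0; left.
by move=> y [->//|[s st ->]]; exact: h.
Qed.

Lemma excess0 K X : lip0 K X -> X 0 <= W -> excess X 0 = 0.
Proof.
move=> lX X0; apply/eqP; rewrite eq_le (excess_ge0 _ lX) andbT.
apply: excess_le => // s s0; have -> : s = 0 by apply/eqP; rewrite eq_le andbC.
by rewrite subr_le0.
Qed.

Lemma excess_ndecr K X s t : lip0 K X -> s <= t -> excess X s <= excess X t.
Proof.
move=> lX st; apply: excess_le; first exact: excess_ge0 lX.
by move=> r /andP[r0 rs]; apply: (excess_ge lX); rewrite r0 (le_trans rs).
Qed.

Lemma excess_flat K X s t : lip0 K X -> 0 <= s -> s <= t ->
  (forall r, s <= r <= t -> X r - W <= excess X s) -> excess X t = excess X s.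
Proof.
move=> lX s0 st h; apply/eqP; rewrite eq_le (excess_ndecr lX st) andbT.
apply: excess_le; first exact: excess_ge0 lX.
move=> r /andP[r0 rt]; have [rs|/ltW sr] := leP r s.
  by apply: (excess_ge lX); rewrite r0.
by apply: h; rewrite sr.
Qed.

Lemma excess_lip K X : lip0 K X -> lip0 K (excess X).
Proof.
move=> lX; suff h s t : 0 <= s -> s <= t -> `|excess X s - excess X t| <= K * `|s - t|.
  move=> s t s0 t0; have [st|/ltW ts] := leP s t; first exact: h.
  by rewrite distrC (distrC s); exact: h.
move=> s0 st; rewrite distrC ger0_norm ?subr_ge0 ?(excess_ndecr lX)//.
rewrite distrC ger0_norm ?subr_ge0// lerBlDl.
have K0 := lip0_ge0 lX.
have Kst : 0 <= K * (t - s) by rewrite mulr_ge0// subr_ge0.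
apply: excess_le; first by rewrite addr_ge0//; exact: excess_ge0 lX.
move=> r /andP[r0 rt]; have [rs|/ltW sr] := leP r s.
  have : X r - W <= excess X s by apply: (excess_ge lX); rewrite r0.
  lra.
have : X s - W <= excess X s by apply: (excess_ge lX); rewrite s0 lexx.
have := lip0_le lX s0 sr.
have : K * (r - s) <= K * (t - s) by rewrite ler_wpM2l//; lra.
lra.
Qed.

Lemma excess_dist K K' X Y t c : lip0 K X -> lip0 K' Y ->
  0 <= c -> (forall s, 0 <= s <= t -> `|X s - Y s| <= c) ->
  `|excess X t - excess Y t| <= c.
Proof.
move=> lX lY c0 h; apply/ler_normlP; split.
- rewrite opprB lerBlDr; apply: excess_le; first by rewrite addr_ge0//; exact: excess_ge0 lX.
  move=> s st; have := excess_ge lX st; have /ler_normlP[] := h s st; lra.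
- rewrite lerBlDr; apply: excess_le; first by rewrite addr_ge0//; exact: excess_ge0 lY.
  move=> s st; have := excess_ge lY st; have /ler_normlP[] := h s st; lra.
Qed.

End RunningExcess.

(** * Picard iteration for a reflected system *)

Section Geometric.
Context {R : realType}.

Lemma le_geometric (x y c : R) : (forall n, x <= y + c / 2 ^+ n) -> x <= y.
Proof.
move=> h; apply/ler_addgt0Pr => e e0.
have [c0|c0] := leP c 0.
  apply: le_trans (h 0) _; rewrite expr0 divr1; lra.
pose n := Num.truncn (c / e).
have nE : c / e < n.+1%:R by exact: truncnS_gt.
apply: le_trans (h n.+1) _; rewrite lerD2l ler_pdivrMr ?exprn_gt0//.
move: nE; rewrite ltr_pdivrMr// => /ltW /le_trans; apply.
by rewrite mulrC ler_wpM2l ?(ltW e0)// -natrX ler_nat ltnW// ltn_expl.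
Qed.

Lemma ler_dist3 (a b a' b' d e1 e2 : R) : `|a - a'| <= e1 -> `|b - b'| <= e2 ->
  `|a - b| <= d -> `|a' - b'| <= d + (e1 + e2).
Proof.
move=> /ler_normlP[h1 h1'] /ler_normlP[h2 h2'] /ler_normlP[h3 h3'].
by apply/ler_normlP; split; lra.
Qed.

Lemma geometric_limit (u : nat -> R) (C : R) : 0 <= C ->
  (forall n, `|u n.+1 - u n| <= C / 2 ^+ n) ->
  exists l, forall n, `|u n - l| <= C *+ 2 / 2 ^+ n.
Proof.
move=> C0 uC.
pose d n := C *+ 2 / 2 ^+ n.
have dS n : d n = C / 2 ^+ n + d n.+1.
  by rewrite /d exprS; field; rewrite expf_neq0.
have d0 n : 0 <= d n by rewrite divr_ge0 ?mulrn_wge0 ?exprn_ge0.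
have lo : {homo (fun n => u n - d n) : m n / (m <= n)%N >-> m <= n}.
  apply: homo_leq => [//|x y z|n]; first exact: le_trans.
  have /ler_normlP[] := uC n; have := dS n; lra.
have hi : {homo (fun n => - (u n + d n)) : m n / (m <= n)%N >-> m <= n}.
  apply: homo_leq => [//|x y z|n]; first exact: le_trans.
  have /ler_normlP[] := uC n; have := dS n; lra.
have lohi m n : u m - d m <= u n + d n.
  have := lo _ _ (leq_maxl m n); have := hi _ _ (leq_maxr m n).
  have := d0 (maxn m n); lra.
pose S := range (fun n => u n - d n).
have hS : has_sup S.
  by split; [exists (u 0 - d 0), 0%N|exists (u 0 + d 0) => _ [n _ <-]].
exists (sup S) => n; rewrite -/(d n).
have h1 : u n - d n <= sup S by apply: (ub_le_sup hS.2); exists n.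
have h2 : sup S <= u n + d n by apply: (ge_sup hS.1) => _ [m _ <-].
by apply/ler_normlP; split; lra.
Qed.

End Geometric.

Section LipschitzHalfLine.
Context {R : realType}.
Implicit Types X : R -> R.

Lemma lip0_derive X (d : R -> R) K : (forall t : R, 0 <= t -> is_derive t 1 X (d t)) ->
  (forall t, 0 <= t -> `|d t| <= K) -> lip0 K X.
Proof.
move=> dX dK.
suff le s t : 0 <= s -> s <= t -> `|X s - X t| <= K * `|s - t|.
  move=> s t s0 t0; have [st|/ltW ts] := leP s t; first exact: le.
  by rewrite distrC (distrC s); exact: le.
move=> s0 st; rewrite (distrC s) (ger0_norm (_ : 0 <= t - s)) ?subr_ge0//.
have lin (c r : R) : s <= r -> is_derive r 1 (fun x => c * x) c.
  by move=> _; apply: D_ext (D_scale (D_id r) c) _; rewrite mulr1.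
have dh (r : R) : s <= r -> is_derive r 1 X (d r).
  by move=> sr; apply: dX => //; exact: le_trans sr.
have r0 r : s < r < t -> 0 <= r by move=> /andP[sr _]; rewrite (le_trans s0)// ltW.
apply/ler_normlP; split.
- have h1 r : s < r < t -> d r <= K by move=> /r0/dK; exact: ler_normlW.
  have := ler_increment st dh (lin K) h1.
  by rewrite -mulrBr; lra.
- have h1 r : s < r < t -> - K <= d r by move=> /r0/dK/ler_normlP[]; lra.
  have := ler_increment st (lin (- K)) dh h1.
  by rewrite -mulrBr; lra.
Qed.

Lemma ler_dist_max (c s t : R) : `|Num.max s c - Num.max t c| <= `|s - t|.
Proof.
have := ler_norm (s - t); have := ler_norm (t - s); rewrite (distrC t) => h1 h2.
by case: (leP s c) => s0; case: (leP t c) => t0; apply/ler_normlP; split; lra.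
Qed.

Lemma ler_dist_min (c s t : R) : `|Num.min s c - Num.min t c| <= `|s - t|.
Proof.
have := ler_norm (s - t); have := ler_norm (t - s); rewrite (distrC t) => h1 h2.
by case: (leP s c) => s0; case: (leP t c) => t0; apply/ler_normlP; split; lra.
Qed.

Lemma lip0_clamp K X : lip0 K X ->
  forall s t, `|X (Num.max s 0) - X (Num.max t 0)| <= K * `|s - t|.
Proof.
move=> lX s t; apply: le_trans (lX _ _ _ _) _; rewrite ?le_max ?lexx ?orbT//.
rewrite ler_wpM2l ?(lip0_ge0 lX)//.
exact: ler_dist_max.
Qed.

Lemma lip0_barrier K X M : lip0 K X -> X 0 <= M ->
  (forall t, 0 <= t -> M <= X t ->
     exists2 r, 0 < r & forall s, t < s < t + r -> X s <= X t) ->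
  forall t, 0 <= t -> X t <= M.
Proof.
move=> lX X0 loc t t0.
have := @right_barrier R (fun s => X (Num.max s 0)) M 0 t t0
  (lipschitz_fun_continuous (lip0_clamp lX)).
rewrite !(max_idPl _)//; apply => // s /andP[s0 st].
rewrite (max_idPl s0) => /(loc s s0)[r r0 rH]; exists r => // x sx _.
rewrite (max_idPl _); first exact: rH.
by case/andP: sx => sx _; rewrite (le_trans s0)// ltW.
Qed.

End LipschitzHalfLine.

Section ReflectedFlow.
Context {R : realType}.
Variables (f g : R -> R -> R) (L M W w0 b0 : R).
Hypotheses (L0 : 0 < L) (w0W : w0 <= W).
Hypothesis fM : forall w b, `|f w b| <= M.
Hypothesis gM : forall w b, `|g w b| <= M.
Hypothesis fL : forall w b w' b', `|f w b - f w' b'| <= L * (`|w - w'| + `|b - b'|).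
Hypothesis gL : forall w b w' b', `|g w b - g w' b'| <= L * (`|w - w'| + `|b - b'|).

Let M0 : 0 <= M. Proof. exact: le_trans (normr_ge0 _) (fM 0 0). Qed.

(** A function rather than an existence statement, so that it can be iterated;
    the domain beyond -1 gives two-sided derivatives at the initial time. *)
Definition prim (h : R -> R) : R -> R :=
  xget (fun=> 0) [set F | F 0 = 0 /\ forall t : R, -1 < t -> is_derive t 1 F (h t)].

Lemma primP h : continuous h ->
  prim h 0 = 0 /\ forall t : R, -1 < t -> is_derive t 1 (prim h) (h t).
Proof.
move=> /antiderivative[F HF]; rewrite /prim.
by case: xgetP => [G _ //|/(_ F)].
Qed.

Let der0 h (t : R) : continuous h -> 0 <= t -> is_derive t 1 (prim h) (h t).
Proof. by move=> /primP[_ hd] t0; apply: hd; rewrite (lt_le_trans _ t0)// ltrN10. Qed.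

Lemma lip0_prim h K : continuous h -> (forall s, `|h s| <= K) -> lip0 K (prim h).
Proof. by move=> ch hK; apply: (lip0_derive (d := h)) => // t t0; exact: der0. Qed.

(** Paths are Lipschitz on the half-line only; freezing them at negative times
    makes the coefficients continuous on the whole line. *)
Definition along (q : R -> R -> R) (p : (R -> R) * (R -> R)) (s : R) : R :=
  q (p.1 (Num.max s 0)) (p.2 (Num.max s 0)).

Let adm (p : (R -> R) * (R -> R)) := lip0 (2 * M) p.1 /\ lip0 (2 * M) p.2.

Let along_cont q p : adm p ->
  (forall w b w' b', `|q w b - q w' b'| <= L * (`|w - w'| + `|b - b'|)) ->
  continuous (along q p).
Proof.
move=> [lw lb] qL; apply: (@lipschitz_fun_continuous _ _ (L * (4 * M))) => s t.
apply: le_trans (qL _ _ _ _) _; rewrite -mulrA ler_wpM2l ?(ltW L0)//.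
by have := lip0_clamp lw s t; have := lip0_clamp lb s t; lra.
Qed.

Let fpos p (t : R) : 0 <= t -> along f p t = f (p.1 t) (p.2 t).
Proof. by move=> t0; rewrite /along (max_idPl t0). Qed.

Let gpos p (t : R) : 0 <= t -> along g p t = g (p.1 t) (p.2 t).
Proof. by move=> t0; rewrite /along (max_idPl t0). Qed.

Let freeX p t := w0 + prim (along f p) t.
Let freeB p t := b0 + prim (along g p) t.

Let step p : (R -> R) * (R -> R) :=
  (fun t => freeX p t - excess W (freeX p) t, freeB p).

Let freeX_lip p : adm p -> lip0 M (freeX p).
Proof.
move=> ap s t s0 t0; rewrite /freeX opprD addrACA subrr add0r.
by apply: lip0_prim => //; [exact: along_cont|move=> r; exact: fM].
Qed.

Let freeB_lip p : adm p -> lip0 M (freeB p).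
Proof.
move=> ap s t s0 t0; rewrite /freeB opprD addrACA subrr add0r.
by apply: lip0_prim => //; [exact: along_cont|move=> r; exact: gM].
Qed.

Let step_adm p : adm p -> adm (step p).
Proof.
move=> ap; split=> s t s0 t0 /=.
- have := freeX_lip ap s0 t0; have := excess_lip W (freeX_lip ap) s0 t0.
  have := ler_normB (freeX p s - freeX p t) (excess W (freeX p) s - excess W (freeX p) t).
  have -> : freeX p s - freeX p t - (excess W (freeX p) s - excess W (freeX p) t) =
    freeX p s - excess W (freeX p) s - (freeX p t - excess W (freeX p) t) by ring.
  lra.
- have := freeB_lip ap s0 t0; have : 0 <= M * `|s - t| by rewrite mulr_ge0.
  lra.
Qed.

(* Both unknowns differ by [c * exp], so the coefficients differ by
   [2 * L * c * exp = c / 4 * lam * exp]; the free path and its excess then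
   contribute [c / 4] each, and the iteration contracts by 1/2. *)
Let lam := 8 * L.
Let lam0 : 0 < lam. Proof. by rewrite mulr_gt0. Qed.

Let dexp (c s : R) : is_derive s 1 (fun x => c * expR (lam * x)) (c * lam * expR (lam * s)).
Proof.
apply: D_ext (D_scale (D_expR (D_scale (D_id s) lam)) c) _.
by rewrite mulr1 mulrA.
Qed.

(** With the weight exp(lam t), integrating a Lipschitz right-hand side gains
    the factor L/lam, which beats the factor 2 lost to the running excess. *)
Let close (c : R) (p q : (R -> R) * (R -> R)) := forall t, 0 <= t ->
  `|p.1 t - q.1 t| <= c * expR (lam * t) /\ `|p.2 t - q.2 t| <= c * expR (lam * t).

Let prim_close (h k : R -> R) (c t : R) : continuous h -> continuous k -> 0 <= c -> 0 <= t ->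
  (forall s, 0 <= s -> `|h s - k s| <= c * lam * expR (lam * s)) ->
  `|prim h t - prim k t| <= c * expR (lam * t).
Proof.
move=> ch ck c0 t0 hk.
have [h0 _] := primP ch; have [k0 _] := primP ck.
have E0 : c * expR (lam * 0) = c by rewrite mulr0 expR0 mulr1.
have dB (F G : R -> R) (F' G' s : R) : is_derive s 1 F F' -> is_derive s 1 G G' ->
    is_derive s 1 (fun x => F x - G x) (F' - G').
  by move=> dF dG; exact: is_deriveB.
have one (a b : R -> R) : continuous a -> continuous b -> prim a 0 = 0 -> prim b 0 = 0 ->
    (forall s, 0 <= s -> `|a s - b s| <= c * lam * expR (lam * s)) ->
    prim a t - prim b t <= c * expR (lam * t).
  move=> ca cb a0 b0' ab.
  have := @ler_increment R (fun x => prim a x - prim b x) (fun x => c * expR (lam * x))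
    (fun s => a s - b s) (fun s => c * lam * expR (lam * s)) 0 t t0.
  rewrite a0 b0' subrr subr0 E0 => H.
  apply: (@le_trans _ _ (c * expR (lam * t) - c)); last lra.
  apply: H => [s s0|s s0|s /andP[/ltW s0 _]].
  - by apply: dB; exact: der0.
  - exact: dexp.
  - by apply: le_trans (ler_norm _) (ab s s0).
apply/ler_normlP; split; last exact: one.
by rewrite opprB; apply: one => // s s0; rewrite distrC; exact: hk.
Qed.

Let step_close c p q : 0 <= c -> adm p -> adm q -> close c p q -> close (c / 2) (step p) (step q).
Proof.
move=> c0 ap aq pq.
have E (s : R) : 0 <= s -> forall u, (forall w b w' b', `|u w b - u w' b'| <= L * (`|w - w'| + `|b - b'|)) ->
    `|along u p s - along u q s| <= c / 4 * lam * expR (lam * s).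
  move=> s0 u uL; rewrite /along (max_idPl s0); apply: le_trans (uL _ _ _ _) _.
  have [h1 h2] := pq s s0.
  have -> : c / 4 * lam * expR (lam * s) = L * (c * expR (lam * s) + c * expR (lam * s)).
    by rewrite /lam; field.
  by rewrite ler_wpM2l ?(ltW L0)// lerD.
have c40 : 0 <= c / 4 by rewrite divr_ge0.
have X (t : R) : 0 <= t -> `|freeX p t - freeX q t| <= c / 4 * expR (lam * t).
  move=> t0; rewrite /freeX opprD addrACA subrr add0r; apply: prim_close => //.
  - exact: along_cont.
  - exact: along_cont.
  - by move=> s s0; exact: E.
move=> t t0; split=> /=; last first.
  rewrite /freeB opprD addrACA subrr add0r.
  apply: (@le_trans _ _ (c / 4 * expR (lam * t))).
    apply: prim_close => //.
    - exact: along_cont.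
    - exact: along_cont.
    - by move=> s s0; exact: E.
  by rewrite ler_wpM2r ?expR_ge0//; lra.
have Ec : 0 <= c / 4 * expR (lam * t) by rewrite mulr_ge0 ?expR_ge0.
have h2 : `|excess W (freeX p) t - excess W (freeX q) t| <= c / 4 * expR (lam * t).
  apply: (excess_dist W (freeX_lip ap) (freeX_lip aq) Ec) => s /andP[s0 st].
  apply: le_trans (X s s0) _; rewrite ler_wpM2l// ler_expR ler_wpM2l// ltW//.
have h1 := X t t0.
have := ler_normB (freeX p t - freeX q t) (excess W (freeX p) t - excess W (freeX q) t).
have -> : freeX p t - freeX q t - (excess W (freeX p) t - excess W (freeX q) t) =
    freeX p t - excess W (freeX p) t - (freeX q t - excess W (freeX q) t) by ring.
lra.
Qed.

Let it n := iter n step (cst w0, cst b0).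

Let it_adm n : adm (it n).
Proof.
elim: n => [|n IH]; last exact: step_adm.
by split=> s t _ _; rewrite /= subrr normr0 !mulr_ge0.
Qed.

Let C := 2 * M / lam.
Let C0 : 0 <= C. Proof. by rewrite divr_ge0 ?mulr_ge0// ltW. Qed.

Let it_close n : close (C / 2 ^+ n) (it n) (it n.+1).
Proof.
elim: n => [|n IH]; last first.
  have -> : C / 2 ^+ n.+1 = C / 2 ^+ n / 2 by rewrite exprSr invfM mulrA.
  apply: step_close => //; first by rewrite divr_ge0 ?exprn_ge0.
  exact: (it_adm n.+1).
have [l1 l2] := it_adm 1.
have X0 : freeX (it 0) 0 = w0 by rewrite /freeX (primP (along_cont (it_adm 0) fL)).1 addr0.
have B0 : freeB (it 0) 0 = b0 by rewrite /freeB (primP (along_cont (it_adm 0) gL)).1 addr0.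
have e1 t : 0 <= t -> 2 * M * t <= C / 2 ^+ 0 * expR (lam * t).
  move=> t0; rewrite expr0 divr1.
  have -> : 2 * M * t = C * (lam * t) by rewrite /C; field; rewrite gt_eqF.
  rewrite ler_wpM2l//; have := expR_ge1Dx (lam * t); lra.
move=> t t0; split.
- have := l1 0 t (lexx _) t0; rewrite /it/= X0 (excess0 (freeX_lip (it_adm 0))) ?X0// subr0 sub0r normrN (ger0_norm t0).
  by move=> /le_trans; apply; exact: e1.
- have := l2 0 t (lexx _) t0; rewrite /it/= B0 sub0r normrN (ger0_norm t0).
  by move=> /le_trans; apply; exact: e1.
Qed.

(** [X] is the free path driven by [f] along the reflected one; the pair of the
    reflected path and [b] is the fixed point of [step]. *)
Lemma reflected_flow : exists w b X : R -> R,
  [/\ lip0 (2 * M) w, lip0 M b, lip0 M X, b 0 = b0 & X 0 = w0] /\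
  [/\ forall t, 0 <= t -> w t = X t - excess W X t,
      forall t : R, 0 <= t -> is_derive t 1 X (f (w t) (b t)) &
      forall t : R, 0 <= t -> is_derive t 1 b (g (w t) (b t))].
Proof.
have lim (t : R) : exists l : R * R, 0 <= t -> forall n,
   `|(it n).1 t - l.1| <= C * expR (lam * t) *+ 2 / 2 ^+ n /\
   `|(it n).2 t - l.2| <= C * expR (lam * t) *+ 2 / 2 ^+ n.
  have [t0|t0] := leP 0 t; last first.
    by exists (0, 0).
  have Ce0 : 0 <= C * expR (lam * t) by rewrite mulr_ge0 ?expR_ge0.
  have [l1 H1] := geometric_limit Ce0 (u := fun n => (it n).1 t) (fun n => let: conj h _ := it_close n t0 in
     ltac:(by rewrite distrC mulrAC in h)).
  have [l2 H2] := geometric_limit Ce0 (u := fun n => (it n).2 t) (fun n => let: conj _ h := it_close n t0 in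
     ltac:(by rewrite distrC mulrAC in h)).
  by exists (l1, l2).
have [l lP] := choice lim.
pose p : (R -> R) * (R -> R) := (fun t => (l t).1, fun t => (l t).2).
have clo n : close (2 * C / 2 ^+ n) (it n) p.
  move=> t t0; have [h1 h2] := lP t t0 n.
  have -> : 2 * C / 2 ^+ n * expR (lam * t) = C * expR (lam * t) *+ 2 / 2 ^+ n.
    by field; rewrite expf_neq0.
  by split.
have ap : adm p.
  split=> s t s0 t0 /=.
  - apply: (@le_geometric _ _ _ (2 * C * expR (lam * s) + 2 * C * expR (lam * t))) => n.
    have [h1 _] := clo n s s0; have [h2 _] := clo n t t0; have h3 := (it_adm n).1 s t s0 t0.
    apply: le_trans (ler_dist3 h1 h2 h3) _; rewrite le_eqVlt; apply/orP; left; apply/eqP.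
    by field; rewrite expf_neq0.
  - apply: (@le_geometric _ _ _ (2 * C * expR (lam * s) + 2 * C * expR (lam * t))) => n.
    have [_ h1] := clo n s s0; have [_ h2] := clo n t t0; have h3 := (it_adm n).2 s t s0 t0.
    apply: le_trans (ler_dist3 h1 h2 h3) _; rewrite le_eqVlt; apply/orP; left; apply/eqP.
    by field; rewrite expf_neq0.
have fix_ t : 0 <= t -> (step p).1 t = p.1 t /\ (step p).2 t = p.2 t.
  move=> t0.
  have near n : `|(step p).1 t - p.1 t| <= 0 + 2 * C * expR (lam * t) / 2 ^+ n /\
     `|(step p).2 t - p.2 t| <= 0 + 2 * C * expR (lam * t) / 2 ^+ n.
    have c0 : 0 <= 2 * C / 2 ^+ n by apply: divr_ge0; [exact: mulr_ge0|exact: exprn_ge0].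
    have [s1 s2] := step_close c0 (it_adm n) ap (clo n) t0.
    have [c1 c2] := clo n.+1 t t0.
    have E : 2 * C / 2 ^+ n / 2 * expR (lam * t) + 2 * C / 2 ^+ n.+1 * expR (lam * t) =
       2 * C * expR (lam * t) / 2 ^+ n.
      by rewrite exprSr; field; rewrite expf_neq0.
    split.
    - have := ler_distD ((it n.+1).1 t) ((step p).1 t) (p.1 t).
      rewrite (distrC ((step p).1 t) ((it n.+1).1 t)); move: s1 c1 E => /=; lra.
    - have := ler_distD ((it n.+1).2 t) ((step p).2 t) (p.2 t).
      rewrite (distrC ((step p).2 t) ((it n.+1).2 t)); move: s2 c2 E => /=; lra.
  split; apply/eqP; rewrite -subr_eq0 -normr_le0.
  - by apply: (le_geometric (c := 2 * C * expR (lam * t))) => n; have [] := near n.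
  - by apply: (le_geometric (c := 2 * C * expR (lam * t))) => n; have [] := near n.
have dp (u : R -> R -> R) (c t : R) : continuous (along u p) -> 0 <= t -> is_derive t 1 (fun s => c + prim (along u p) s) (along u p t).
  move=> cu t0; rewrite -[along u p t]add0r; apply: is_deriveD; last exact: der0.
exists p.1, (freeB p), (freeX p); split.
  split; [exact: ap.1|exact: freeB_lip|exact: freeX_lip| |].
  - by rewrite /freeB (primP (along_cont ap gL)).1 addr0.
  - by rewrite /freeX (primP (along_cont ap fL)).1 addr0.
split=> t t0.
- by have [<- _] := fix_ t t0.
- have [_ E] := fix_ t t0; rewrite -[freeB p t]/((step p).2 t) E -fpos//.
  by apply: dp => //; exact: along_cont.
- have [_ E] := fix_ t t0; rewrite -[X in g _ X]/((step p).2 t) E -gpos//.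
  by apply: dp => //; exact: along_cont.
Qed.

End ReflectedFlow.

Section ReflectedProperties.
Context {R : realType}.
Variables (W K : R) (X w : R -> R).
Hypothesis lX : lip0 K X.
Hypothesis wE : forall t, 0 <= t -> w t = X t - excess W X t.

Lemma reflected_le t : 0 <= t -> w t <= W.
Proof.
move=> t0; rewrite wE// lerBlDr -lerBlDl; apply: (excess_ge W lX).
by rewrite t0 lexx.
Qed.

Let flat_right t : 0 <= t -> w t < W ->
  exists2 r, 0 < r & forall s, t <= s < t + r -> excess W X s = excess W X t.
Proof.
move=> t0 wt; pose d := W - w t; have d0 : 0 < d by rewrite subr_gt0.
have K0 := lip0_ge0 lX; have K1 : 0 < K + 1 by lra.
exists (d / (K + 1)) => [|s /andP[ts sr]]; first by rewrite divr_gt0.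
apply: (excess_flat lX) => // r /andP[tr rs].
have h := lip0_le lX t0 tr.
have : (s - t) * (K + 1) < d by rewrite -ltr_pdivlMr; lra.
have : K * (r - t) <= K * (s - t) by rewrite ler_wpM2l//; lra.
have := wE t0; rewrite /d; lra.
Qed.

(** Off the barrier, or when the free path recedes from it, the excess stays
    constant for a while, and the reflected path moves like the free one. *)
Lemma reflected_right (t d : R) : 0 <= t -> is_derive t 1 X d -> w t < W \/ d < 0 ->
  forall e, 0 < e -> exists2 r, 0 < r & forall s, t < s < t + r ->
    `|w s - w t - d * (s - t)| <= e * (s - t).
Proof.
move=> t0 /is_deriveP dX cas e e0.
have [r1 r10 flat] : exists2 r, 0 < r & forall s, t <= s < t + r -> excess W X s = excess W X t.
  case: cas => [|d0]; first exact: flat_right.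
  have nd0 : 0 < - d by rewrite oppr_gt0.
  have [r r0 rH] := dX _ nd0; exists r => // s /andP[ts sr].
  apply: (excess_flat lX) => // x /andP[tx xs].
  have := rH x; rewrite (ger0_norm (_ : 0 <= x - t)) ?subr_ge0//.
  move=> /(_ _)/ler_normlP[]; first lra.
  move=> _ h; have : X t - W <= excess W X t by apply: (excess_ge W lX); rewrite t0 lexx.
  lra.
have [r2 r20 rH] := dX e e0.
exists (Num.min r1 r2) => [|s /andP[ts]]; first by rewrite lt_min r10.
rewrite -ltrBlDl lt_min => /andP[s1 s2].
have s0 : 0 <= s by rewrite (le_trans t0)// ltW.
rewrite !wE// flat; last by rewrite (ltW ts) -ltrBlDl.
have -> : X s - excess W X t - (X t - excess W X t) = X s - X t by ring.
have := rH s; rewrite (ger0_norm (_ : 0 <= s - t)) ?subr_ge0 ?(ltW ts)//.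
exact.
Qed.

Lemma reflected_derive (t d : R) : 0 < t -> is_derive t 1 X d -> w t < W ->
  is_derive t 1 w d.
Proof.
move=> t0 /is_deriveP dX wt; apply/is_deriveP => e e0.
have [r1 r10 flat] := flat_right (ltW t0) wt.
have [r2 r20 rH] := dX e e0.
pose g := W - w t; have g0 : 0 < g by rewrite subr_gt0.
have K0 := lip0_ge0 lX; have K1 : 0 < K + 1 by lra.
pose r3 := g / (K + 1) / 2; have r30 : 0 < r3 by rewrite !divr_gt0.
have flatl s : 0 <= s -> s <= t -> t - s < r3 -> excess W X t = excess W X s.
  move=> s0 st tr; apply: (excess_flat lX) => // x /andP[sx xt].
  have h1 := lip0_le (excess_lip W lX) s0 st.
  have : `|X x - X t| <= K * `|x - t| by apply: lX => //; [exact: le_trans sx|exact: ltW].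
  rewrite (distrC x) (ger0_norm (_ : 0 <= t - x)) ?subr_ge0// => /ler_normlP[_] h2.
  have h3 : (t - s) * (K + 1) < g / 2.
    by rewrite -ltr_pdivlMr//; move: tr; rewrite /r3 mulrAC.
  have : K * (t - x) <= K * (t - s) by rewrite ler_wpM2l//; lra.
  have := wE (ltW t0); rewrite /g in h3 *; lra.
exists (Num.min (Num.min r1 r2) (Num.min r3 t)); first by rewrite !lt_min r10 r20 r30.
move=> s; rewrite !lt_min => /andP[/andP[s1 s2] /andP[s3 s4]].
have s0 : 0 <= s by have := ler_norm (t - s); rewrite distrC; lra.
have -> : w s - w t - d * (s - t) = X s - X t - d * (s - t).
  rewrite !wE// ?(ltW t0)//; have [ts|/ltW st] := leP t s.
    rewrite (flat s); first by ring.
    by rewrite ts/=; have := ler_norm (s - t); lra.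
  rewrite (flatl s)//; first by ring.
  by apply: le_lt_trans s3; rewrite distrC; exact: ler_norm.
exact: rH.
Qed.

(** At the barrier the free path attains its running maximum, so it cannot have
    been decreasing. *)
Lemma reflected_drift_ge0 (t d : R) : 0 < t -> is_derive t 1 X d -> w t = W -> 0 <= d.
Proof.
move=> t0 /is_deriveP dX wt; rewrite leNgt; apply/negP => d0.
have [|r r0 rH] := dX (- d / 2); first by rewrite divr_gt0 ?oppr_gt0.
pose s := Num.max 0 (t - r / 2).
have s0 : 0 <= s by rewrite le_max lexx.
have st : s < t by rewrite gt_max t0/=; lra.
have tsr : t - s < r.
  have : t - r / 2 <= s by rewrite le_max lexx orbT.
  lra.
have := rH s; rewrite distrC gtr0_norm ?subr_gt0// => /(_ tsr) /ler_normlP[h _].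
have : X s - W <= excess W X t by apply: (excess_ge W lX); rewrite s0 ltW.
have := wE (ltW t0); have : 0 < (- d / 2) * (t - s) by rewrite mulr_gt0 ?divr_gt0 ?oppr_gt0 ?subr_gt0.
lra.
Qed.

End ReflectedProperties.

(** * The motion of width and front *)

Section DropFlow.
Context {R : realType}.
Local Notation mu := (@lebesgue_measure R).
Variables (W gs K : R) (G beta : R -> R).
Hypotheses (W0 : 0 < W) (gs0 : 0 <= gs) (K0 : 0 <= K).
Hypothesis G_anti : forall x y, 0 < x -> x <= y -> y <= W -> G y <= G x.
Hypothesis G_lip : forall d, 0 < d -> exists2 L, 0 <= L &
  forall x y, d <= x <= W -> d <= y <= W -> `|G x - G y| <= L * `|x - y|.
Hypothesis G_blowup : forall M, exists d, [/\ 0 < d, d < W & M < G d].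
Hypothesis GW : G W = gs.
Hypothesis beta0 : forall x, 0 <= beta x.
Hypothesis beta_lip : forall x y, `|beta x - beta y| <= K * `|x - y|.

Definition width_drift (w b : R) : R := G w - beta b - beta (b - w).
Definition front_speed (w b : R) : R := (G w + gs) / 2 - beta b.

(** Normal reflection at [W] in the coordinates (width, front position): the
    reaction [r] may only shrink the width, and only where it is maximal. *)
Definition reflected_solution (T : R) (w b : R -> R) : Prop :=
  [/\ exists K', {in `[0, T] &, forall s t, `|w s - w t| <= K' * `|s - t|} /\
        {in `[0, T] &, forall s t, `|b s - b t| <= K' * `|s - t|},
      {in `[0, T], forall t, 0 < w t <= W} &
      exists2 N, mu.-negligible N & forall t, 0 < t < T -> ~ N t ->
        is_derive t 1 b (front_speed (w t) (b t)) /\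
        exists r, [/\ 0 <= r, w t < W -> r = 0 &
          is_derive t 1 w (width_drift (w t) (b t) - r)] ].

Lemma itv_pos_min (f : R -> R) K' T : 0 <= T ->
  {in `[0, T] &, forall s t, `|f s - f t| <= K' * `|s - t|} ->
  {in `[0, T], forall t, 0 < f t} -> exists2 m, 0 < m & {in `[0, T], forall t, m <= f t}.
Proof.
move=> T0 lf f0.
have K'0 : 0 <= K' \/ T = 0.
  move: T0; rewrite le_eqVlt => /predU1P[<-|T0]; [by right|left].
  have := lf T 0; rewrite !in_itv/= !lexx (ltW T0) => /(_ isT isT).
  by move=> /(le_trans (normr_ge0 _)); rewrite pmulr_lge0// normr_gt0 subr_eq0 gt_eqF.
case: K'0 => [K'0|E]; last first.
  exists (f 0); first by apply: f0; rewrite in_itv/= E lexx.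
  by move=> t; rewrite in_itv/= E => /andP[? ?]; rewrite (_ : t = 0)//; apply/eqP; rewrite eq_le; apply/andP.
pose cl x := Num.max (Num.min x T) 0.
have cl0 x : cl x \in `[0, T].
  by rewrite in_itv/= /cl le_max lexx orbT/= ge_max T0 ge_min lexx orbT.
have clE x : x \in `[0, T] -> cl x = x.
  by rewrite in_itv/= /cl => /andP[x0 xT]; rewrite (min_idPl xT) (max_idPl x0).
have clB x y : `|cl x - cl y| <= `|x - y|.
  exact: le_trans (ler_dist_max _ _ _) (ler_dist_min _ _ _).
have cf : continuous (fun x => f (cl x)).
  apply: (@lipschitz_fun_continuous _ _ K') => s t.
  by apply: le_trans (lf _ _ (cl0 s) (cl0 t)) _; rewrite ler_wpM2l.
have [c cT cmin] := EVT_min T0 (continuous_subspaceT (A := `[0, T]) cf).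
exists (f c); first exact: f0.
by move=> t tT; have := cmin t tT; rewrite !clE.
Qed.

Lemma lip_mul (A : set R) (f g : R -> R) (F Gb Kf Kg : R) :
  0 <= F -> 0 <= Gb ->
  (forall s, A s -> `|f s| <= F) -> (forall s, A s -> `|g s| <= Gb) ->
  (forall s t, A s -> A t -> `|f s - f t| <= Kf * `|s - t|) ->
  (forall s t, A s -> A t -> `|g s - g t| <= Kg * `|s - t|) ->
  forall s t, A s -> A t -> `|f s * g s - f t * g t| <= (F * Kg + Gb * Kf) * `|s - t|.
Proof.
move=> F0 Gb0 hf hg lf lg s t As At.
have -> : f s * g s - f t * g t = f s * (g s - g t) + g t * (f s - f t) by ring.
apply: le_trans (ler_normD _ _) _; rewrite !normrM mulrDl -!mulrA lerD//.
- by apply: ler_pM => //; [exact: hf|exact: lg].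
- by apply: ler_pM => //; [exact: hg|exact: lf].
Qed.

(** The reactions only help: where one of them acts, that width is maximal,
    hence at least the other one, and the product with the difference of the
    widths has a sign. What remains is Lipschitz. *)
Lemma drift_dissipative (m LG w1 b1 r1 w2 b2 r2 : R) : 0 <= LG ->
  (forall x y, m <= x <= W -> m <= y <= W -> `|G x - G y| <= LG * `|x - y|) ->
  m <= w1 <= W -> m <= w2 <= W -> 0 <= r1 -> 0 <= r2 ->
  (w1 < W -> r1 = 0) -> (w2 < W -> r2 = 0) ->
  2 * ((w1 - w2) * (width_drift w1 b1 - r1 - (width_drift w2 b2 - r2))) +
  2 * ((b1 - b2) * (front_speed w1 b1 - front_speed w2 b2)) <=
  4 * (LG + 2 * K) * ((w1 - w2) * (w1 - w2) + (b1 - b2) * (b1 - b2)).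
Proof.
move=> LG0 hLG i1 i2 r10 r20 r1W r2W.
have mono : 0 <= (w1 - w2) * r1 - (w1 - w2) * r2.
  have q1 : 0 <= (w1 - w2) * r1.
    have [w1W|W1] := ltP w1 W; first by rewrite r1W// mulr0.
    by rewrite mulr_ge0// subr_ge0; case/andP: i2 => _ /le_trans; apply.
  have q2 : (w1 - w2) * r2 <= 0.
    have [w2W|W2] := ltP w2 W; first by rewrite r2W// mulr0.
    by rewrite mulr_le0_ge0// subr_le0; case/andP: i1 => _ /le_trans; apply.
  by rewrite subr_ge0 (le_trans q2).
have hG := hLG _ _ i1 i2; have hb := beta_lip b1 b2.
have ha : `|beta (b1 - w1) - beta (b2 - w2)| <= K * (`|b1 - b2| + `|w1 - w2|).
  apply: le_trans (beta_lip _ _) _; rewrite ler_wpM2l//.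
  have -> : b1 - w1 - (b2 - w2) = (b1 - b2) - (w1 - w2) by ring.
  exact: ler_normB.
pose L := LG + 2 * K; have L0 : 0 <= L by rewrite addr_ge0// mulr_ge0.
have [hF hg] : `|width_drift w1 b1 - width_drift w2 b2| <= L * (`|w1 - w2| + `|b1 - b2|) /\
  `|front_speed w1 b1 - front_speed w2 b2| <= L * (`|w1 - w2| + `|b1 - b2|).
  rewrite /width_drift /front_speed /L; clear r1W r2W mono r10 r20 L0 i1 i2.
  set x := `|w1 - w2| in hG ha *; set y := `|b1 - b2| in hb ha *.
  have h0 : 0 <= LG * y by rewrite mulr_ge0 ?normr_ge0.
  have h1 : 0 <= LG * x by rewrite mulr_ge0 ?normr_ge0.
  have h2 : 0 <= K * x by rewrite mulr_ge0 ?normr_ge0.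
  have h3 : 0 <= K * y by rewrite mulr_ge0 ?normr_ge0.
  move: (G w1) (G w2) (beta b1) (beta b2) (beta (b1 - w1)) (beta (b2 - w2)) hG hb ha.
  move=> p1 p2 p3 p4 p5 p6.
  move: (LG * y) (LG * x) (K * x) (K * y) h0 h1 h2 h3 (mulrDr K y x) (mulrDr (LG + 2 * K) x y)
    (mulrDl LG (2 * K) x) (mulrDl LG (2 * K) y) (mulrA 2 K x) (mulrA 2 K y).
  by move=> ? ? ? ? ? ? ? ? -> -> -> -> <- <- /ler_normlP[? ?] /ler_normlP[? ?] /ler_normlP[? ?];
    split; apply/ler_normlP; split; lra.
move: (width_drift w1 b1) (width_drift w2 b2) (front_speed w1 b1) (front_speed w2 b2) hF hg.
move=> F1 F2 g1 g2 hF hg.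
have hFw : (w1 - w2) * (F1 - F2) <= `|w1 - w2| * (L * (`|w1 - w2| + `|b1 - b2|)).
  by apply: le_trans (ler_norm _) _; rewrite normrM ler_wpM2l.
have hgb : (b1 - b2) * (g1 - g2) <= `|b1 - b2| * (L * (`|w1 - w2| + `|b1 - b2|)).
  by apply: le_trans (ler_norm _) _; rewrite normrM ler_wpM2l.
have sq : L * ((`|w1 - w2| + `|b1 - b2|) * (`|w1 - w2| + `|b1 - b2|)) <=
    L * (2 * ((w1 - w2) * (w1 - w2) + (b1 - b2) * (b1 - b2))).
  rewrite ler_wpM2l// -subr_ge0.
  have -> : (w1 - w2) * (w1 - w2) = `|w1 - w2| * `|w1 - w2| by rewrite -!expr2 real_normK ?num_real.
  have -> : (b1 - b2) * (b1 - b2) = `|b1 - b2| * `|b1 - b2| by rewrite -!expr2 real_normK ?num_real.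
  rewrite (_ : _ - _ = (`|w1 - w2| - `|b1 - b2|) ^+ 2); first exact: sqr_ge0.
  ring.
have -> : (w1 - w2) * (F1 - r1 - (F2 - r2)) = (w1 - w2) * (F1 - F2) - ((w1 - w2) * r1 - (w1 - w2) * r2) by ring.
rewrite -/L; clearbody L.
have E : `|w1 - w2| * (L * (`|w1 - w2| + `|b1 - b2|)) + `|b1 - b2| * (L * (`|w1 - w2| + `|b1 - b2|)) =
  L * ((`|w1 - w2| + `|b1 - b2|) * (`|w1 - w2| + `|b1 - b2|)) by ring.
have E2 : 4 * L * ((w1 - w2) * (w1 - w2) + (b1 - b2) * (b1 - b2)) =
  2 * (L * (2 * ((w1 - w2) * (w1 - w2) + (b1 - b2) * (b1 - b2)))) by ring.
rewrite E2.
have fin (a b c d e p q : R) : 0 <= c -> a <= p -> b <= q -> e <= d -> p + q = e ->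
    2 * (a - c) + 2 * b <= 2 * d by move=> *; lra.
exact: fin mono hFw hgb sq E.
Qed.

(** The reaction is monotone, so the squared distance of two solutions obeys a
    linear differential inequality almost everywhere. *)
Lemma reflected_solution_unique (T : R) w1 b1 w2 b2 : 0 <= T ->
  reflected_solution T w1 b1 -> reflected_solution T w2 b2 ->
  w1 0 = w2 0 -> b1 0 = b2 0 -> w1 T = w2 T /\ b1 T = b2 T.
Proof.
move=> T0 [[K1 [lw1 lb1]] p1 [N1 nN1 d1]] [[K2 [lw2 lb2]] p2 [N2 nN2 d2]] ew eb.
have [m1 m10 hm1] := itv_pos_min T0 lw1 (fun t h => proj1 (andP (p1 t h))).
have [m2 m20 hm2] := itv_pos_min T0 lw2 (fun t h => proj1 (andP (p2 t h))).
pose m := Num.min m1 m2.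
have [|LG LG0 hLG] := G_lip (d := m); first by rewrite lt_min m10.
pose L := LG + 2 * K; have L0 : 0 <= L by rewrite addr_ge0// mulr_ge0.
have im1 t : t \in `[0, T] -> m <= w1 t <= W.
  by move=> h; have /andP[_ ->] := p1 t h; rewrite andbT ge_min hm1.
have im2 t : t \in `[0, T] -> m <= w2 t <= W.
  by move=> h; have /andP[_ ->] := p2 t h; rewrite andbT ge_min hm2 ?orbT.
pose dw t := w1 t - w2 t; pose db t := b1 t - b2 t.
pose E t := dw t * dw t + db t * db t.
pose f t := expR (- (4 * L) * t) * E t.
pose A := `[0, T]%classic.
have K12 (u1 u2 : R -> R) : {in `[0, T] &, forall s t, `|u1 s - u1 t| <= K1 * `|s - t|} ->
    {in `[0, T] &, forall s t, `|u2 s - u2 t| <= K2 * `|s - t|} ->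
    forall s t, A s -> A t -> `|(u1 s - u2 s) - (u1 t - u2 t)| <= (K1 + K2) * `|s - t|.
  move=> h1 h2 s t As At.
  have -> : u1 s - u2 s - (u1 t - u2 t) = (u1 s - u1 t) - (u2 s - u2 t) by ring.
  by apply: le_trans (ler_normB _ _) _; rewrite mulrDl lerD// ?h1 ?h2.
have ldw : forall s t, A s -> A t -> `|dw s - dw t| <= (K1 + K2) * `|s - t| by exact: K12.
have ldb : forall s t, A s -> A t -> `|db s - db t| <= (K1 + K2) * `|s - t| by exact: K12.
have A0 : A 0 by rewrite /A/= in_itv/= lexx.
have dw0 : dw 0 = 0 by rewrite /dw ew subrr.
have db0 : db 0 = 0 by rewrite /db eb subrr.
pose B := `|K1 + K2| * T; have B0 : 0 <= B by rewrite mulr_ge0.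
have bnd (u : R -> R) : u 0 = 0 -> (forall s t, A s -> A t -> `|u s - u t| <= (K1 + K2) * `|s - t|) ->
    forall s, A s -> `|u s| <= B.
  move=> u0 lu s As; have := lu s 0 As A0; rewrite u0 !subr0 => /le_trans; apply.
  move: As; rewrite /A/= in_itv/= => /andP[s0 sT].
  rewrite (ger0_norm s0); apply: (@le_trans _ _ (`|K1 + K2| * s)).
    by rewrite ler_wpM2r// ler_norm.
  by rewrite ler_wpM2l.
have bdw := bnd _ dw0 ldw; have bdb := bnd _ db0 ldb.
have lE s t : A s -> A t -> `|E s - E t| <= 4 * (B * (K1 + K2)) * `|s - t|.
  move=> As At.
  have h1 := lip_mul B0 B0 bdw bdw ldw ldw As At.
  have h2 := lip_mul B0 B0 bdb bdb ldb ldb As At.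
  have -> : E s - E t = (dw s * dw s - dw t * dw t) + (db s * db s - db t * db t).
    by rewrite /E; ring.
  apply: le_trans (ler_normD _ _) _; lra.
have bE s : A s -> `|E s| <= 2 * (B * B).
  move=> As; apply: le_trans (ler_normD _ _) _; rewrite !normrM.
  have h1 : `|dw s| * `|dw s| <= B * B by apply: ler_pM => //; exact: bdw.
  have h2 : `|db s| * `|db s| <= B * B by apply: ler_pM => //; exact: bdb.
  lra.
have be s : A s -> `|expR (- (4 * L) * s)| <= 1.
  rewrite /A/= in_itv/= => /andP[s0 _]; rewrite ger0_norm ?expR_ge0//.
  by rewrite -[leRHS]expR0 ler_expR mulNr oppr_le0 !mulr_ge0.
have le s t : A s -> A t -> `|expR (- (4 * L) * s) - expR (- (4 * L) * t)| <= 4 * L * `|s - t|.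
  wlog st : s t / s <= t.
    move=> h As At; have [st|/ltW ts] := leP s t; first exact: h.
    by rewrite distrC (distrC s); exact: h.
  move=> As At.
  have -> : expR (- (4 * L) * s) - expR (- (4 * L) * t) =
      expR (- (4 * L) * s) * (1 - expR (- (4 * L) * (t - s))).
    rewrite mulrBr mulr1 -expRD; congr (_ - expR _); ring.
  rewrite normrM -[leRHS]mul1r; apply: ler_pM => //; first exact: be.
  rewrite (distrC s) (ger0_norm (_ : 0 <= t - s)) ?subr_ge0// ger0_norm.
    have := expR_ge1Dx (- (4 * L) * (t - s)); lra.
  by rewrite subr_ge0 -[leRHS]expR0 ler_expR mulNr oppr_le0 !mulr_ge0// subr_ge0.
have lf := lip_mul ler01 (mulr_ge0 (ler0n _ 2) (mulr_ge0 B0 B0)) be bE le lE.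
have : f T <= f 0.
  apply: (ae_nonincreasing (K := 1 * (4 * (B * (K1 + K2))) + 2 * (B * B) * (4 * L))
    (N := N1 `|` N2) T0) => [s t As At||t tT nN].
  - exact: lf.
  - exact: negligibleU.
  have [db1 [r1 [r10 r1W dw1]]] := d1 t tT (fun h => nN (or_introl h)).
  have [db2 [r2 [r20 r2W dw2]]] := d2 t tT (fun h => nN (or_intror h)).
  have tA : t \in `[0, T] by case/andP: tT => t0 tT; rewrite in_itv/= !ltW.
  set F1 := width_drift _ _ in dw1; set F2 := width_drift _ _ in dw2.
  set g1 := front_speed _ _ in db1; set g2 := front_speed _ _ in db2.
  have ddw := D_sub dw1 dw2; have ddb := D_sub db1 db2.
  have dE := D_add (D_mul ddw ddw) (D_mul ddb ddb).
  have df := D_mul (D_expR (D_scale (D_id t) (- (4 * L)))) dE.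
  eexists; last exact: df.
  have key := @drift_dissipative m LG (w1 t) (b1 t) r1 (w2 t) (b2 t) r2 LG0 hLG
    (im1 t tA) (im2 t tA) r10 r20 r1W r2W.
  rewrite -/F1 -/F2 -/g1 -/g2 -/L -/(dw t) -/(db t) -/(E t) in key.
  set e := expR _; have e0 : 0 <= e by rewrite expR_ge0.
  rewrite -/(dw t) -/(db t) -/(E t).
  set D := (X in _ + e * X <= 0).
  have -> : D = 2 * (dw t * (F1 - r1 - (F2 - r2))) + 2 * (db t * (g1 - g2)).
    by rewrite /D /dw /db; ring.
  rewrite (_ : _ + _ = e * (2 * (dw t * (F1 - r1 - (F2 - r2))) + 2 * (db t * (g1 - g2)) - 4 * L * E t)).
    by rewrite mulr_ge0_le0// subr_le0.
  ring.
rewrite /f mulr0 expR0 /E dw0 db0 !mulr0 addr0 => h.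
have : E T <= 0 by rewrite -(pmulr_rle0 _ (expR_gt0 (- (4 * L) * T))) (le_trans h)// mulr0.
rewrite /E -!expr2 => h'.
have s1 := sqr_ge0 (dw T); have s2 := sqr_ge0 (db T).
have /eqP : dw T ^+ 2 = 0 by apply/eqP; rewrite eq_le s1 andbT; lra.
have /eqP : db T ^+ 2 = 0 by apply/eqP; rewrite eq_le s2 andbT; lra.
by rewrite !sqrf_eq0 => /eqP/subr0_eq-> /eqP/subr0_eq->.
Qed.

(** The drift [y] is the speed of the width and contains the decreasing function
    [G] of the width, so it tends to return to 0. Adding [- lam * w] makes this
    dissipation dominate the variation of the friction along the two fronts, and
    the drift stays bounded, independently of the constants [d], [Kw], [Kb], [Kx]
    of the truncated problem. *)
Section APriori.
Variables (H bet : R -> R) (d T : R) (w b X : R -> R) (Kw Kb Kx : R).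
Hypotheses (d0 : 0 < d).
Hypothesis bet0 : forall x, 0 <= bet x.
Hypothesis bet_lip : forall x y, `|bet x - bet y| <= K * `|x - y|.
Let y t := G (w t) - bet (b t) - bet (b t - w t).
Let g t := (G (w t) + gs) / 2 - bet (b t).
Hypotheses (lw : lip0 Kw w) (lb : lip0 Kb b) (lX : lip0 Kx X).
Hypothesis wE : forall t, 0 <= t -> w t = X t - excess W X t.
Hypothesis dX : forall t : R, 0 <= t -> is_derive t 1 X (y t).
Hypothesis db : forall t : R, 0 <= t -> is_derive t 1 b (g t).
Hypothesis wd : forall t, 0 <= t -> d <= w t.

Let lam := 2 * K + 1.
Let C := K * (gs + K * W).
Let z t := y t - lam * w t.

Let wW t : 0 <= t -> w t <= W. Proof. exact: (reflected_le lX wE). Qed.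
Let wpos t : 0 <= t -> 0 < w t. Proof. by move=> t0; exact: lt_le_trans d0 (wd t0). Qed.

Let betab t : 0 <= t -> `|bet (b t - w t) - bet (b t)| <= K * W.
Proof.
move=> t0; apply: le_trans (bet_lip _ _) _; rewrite ler_wpM2l//.
have -> : b t - w t - b t = - w t by ring.
by rewrite normrN gtr0_norm ?wpos// wW.
Qed.

Let gE t : 2 * g t = y t + gs + (bet (b t - w t) - bet (b t)).
Proof. by rewrite /g /y; field. Qed.

Let betvar s t : `|(bet (b s) + bet (b s - w s)) - (bet (b t) + bet (b t - w t))| <=
  K * (2 * `|b s - b t| + `|w s - w t|).
Proof.
have h1 := bet_lip (b s) (b t).
have h2 := bet_lip (b s - w s) (b t - w t).
have h3 : K * `|b s - w s - (b t - w t)| <= K * (`|b s - b t| + `|w s - w t|).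
  rewrite ler_wpM2l//.
  have -> : b s - w s - (b t - w t) = (b s - b t) - (w s - w t) by ring.
  exact: ler_normB.
have -> : K * (2 * `|b s - b t| + `|w s - w t|) =
  K * `|b s - b t| + K * (`|b s - b t| + `|w s - w t|) by ring.
have -> : bet (b s) + bet (b s - w s) - (bet (b t) + bet (b t - w t)) =
  (bet (b s) - bet (b t)) + (bet (b s - w s) - bet (b t - w t)) by ring.
by apply: le_trans (ler_normD _ _) _; apply: lerD => //; exact: le_trans h3.
Qed.

Let local t e : 0 <= t -> w t < W \/ y t < 0 -> 0 < e ->
  exists2 r, 0 < r & forall s, t < s < t + r ->
   `|w s - w t - y t * (s - t)| <= e * (s - t) /\
   2 * `|b s - b t| <= (`|y t| + gs + K * W + 2 * e) * (s - t).
Proof.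
move=> t0 cas e0.
have [r1 r10 h1] := reflected_right lX wE t0 (dX t0) cas e0.
have [r2 r20 h2] := (is_deriveP _ _ _).1 (db t0) e e0.
exists (Num.min r1 r2) => [|s /andP[ts]]; first by rewrite lt_min r10.
rewrite -ltrBlDl lt_min => /andP[s1 s2].
split; first by apply: h1; rewrite ts -ltrBlDl.
have st0 : 0 <= s - t by rewrite subr_ge0 ltW.
have := h2 s; rewrite (ger0_norm st0) => /(_ s2) h.
have gb : 2 * `|g t| <= `|y t| + gs + K * W.
  have -> : 2 * `|g t| = `|2 * g t| by rewrite normrM ger0_norm.
  rewrite gE; apply: le_trans (ler_normD _ _) _; apply: lerD; last exact: betab.
  by apply: le_trans (ler_normD _ _) _; rewrite (ger0_norm gs0).
have gt : `|g t * (s - t)| = `|g t| * (s - t) by rewrite normrM (ger0_norm st0).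
have : `|b s - b t| <= `|b s - b t - g t * (s - t)| + `|g t * (s - t)|.
  by apply: le_trans (ler_normD _ _); rewrite subrK.
have : 2 * `|g t| * (s - t) <= (`|y t| + gs + K * W) * (s - t) by rewrite ler_wpM2r.
rewrite gt; move: (`|g t|) (`|b s - b t|) (`|_ - _ - _|) h => p q x; lra.
Qed.

Let lam0 : 0 < lam. Proof. by have := K0; rewrite /lam; lra. Qed.
Let C0 : 0 <= C. Proof. by rewrite mulr_ge0// addr_ge0// mulr_ge0// ltW. Qed.

Let ly : exists Ky, lip0 Ky z.
Proof.
have [LG LG0 hLG] := G_lip d0.
exists (LG * Kw + K * (2 * Kb + Kw) + lam * Kw) => s t s0 t0.
have i s' : 0 <= s' -> d <= w s' <= W by move=> s'0; rewrite wd// wW.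
have h1 := hLG _ _ (i s s0) (i t t0).
have h2 := betvar s t; have h3 := lw s0 t0; have h4 := lb s0 t0.
have -> : z s - z t = (G (w s) - G (w t)) -
  (bet (b s) + bet (b s - w s) - (bet (b t) + bet (b t - w t))) - lam * (w s - w t).
  by rewrite /z /y; ring.
have -> : (LG * Kw + K * (2 * Kb + Kw) + lam * Kw) * `|s - t| =
  LG * (Kw * `|s - t|) + K * (2 * (Kb * `|s - t|) + Kw * `|s - t|) + lam * (Kw * `|s - t|) by ring.
apply: le_trans (ler_normB _ _) _; apply: lerD.
  apply: le_trans (ler_normB _ _) _; apply: lerD.
    by apply: le_trans h1 _; rewrite ler_wpM2l.
  by apply: le_trans h2 _; rewrite ler_wpM2l// lerD// ler_wpM2l.
by rewrite normrM (gtr0_norm lam0) ler_wpM2l// ltW.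
Qed.

(* The error admitted in the linear approximation of the motion, such that its
   total contribution [eps * (lam + 3 * K)] is the 1 in the threshold [C + 1]. *)
Let eps := (lam + 3 * K)^-1.
Let eps1 : eps <= 1.
Proof. by rewrite invf_le1; have := K0; rewrite /lam; lra. Qed.
Let eps0 : 0 < eps. Proof. by rewrite invr_gt0; have := lam0; have := K0; lra. Qed.

(* Both barrier arguments, for [z] and for [- z], come down to this estimate for
   the increments of [G], of the friction and of [w] over a short time [s]. *)
Let dissip (p D dw dB2 s dG dbt : R) : 0 < s -> C + 1 <= p ->
  `|dw - p * s| <= eps * s -> dB2 <= (p + gs + K * W + 2 * eps) * s ->
  dG <= 0 -> `|dbt| <= K * (dB2 + `|dw|) -> dG - dbt - lam * dw <= 0.
Proof.
move=> s0 pC /ler_normlP[hw hw'] hB hG hbt.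
have dw0 : 0 <= dw.
  have : 0 <= (p - eps) * s.
    rewrite mulr_ge0 ?(ltW s0)// subr_ge0; apply: le_trans pC.
    have := eps1; have := C0; have := gs0; lra.
  lra.
rewrite (ger0_norm dw0) in hbt.
have h1 : - dbt <= K * (dB2 + dw) by apply: le_trans hbt; rewrite -normrN ler_norm.
have h2 : K * (dB2 + dw) <= K * ((p + gs + K * W + 2 * eps) * s + (p + eps) * s).
  by rewrite ler_wpM2l//; lra.
have h3 : lam * ((p - eps) * s) <= lam * dw by rewrite ler_wpM2l ?(ltW lam0)//; lra.
have E : K * ((p + gs + K * W + 2 * eps) * s + (p + eps) * s) - lam * ((p - eps) * s) =
  (C + eps * (lam + 3 * K) - p) * s by rewrite /lam /C; ring.
have E1 : eps * (lam + 3 * K) = 1 by rewrite mulVf// gt_eqF//; have := lam0; have := K0; lra.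
have : (C + eps * (lam + 3 * K) - p) * s <= 0 by rewrite E1 pmulr_lle0//; lra.
lra.
Qed.

Let zupper t : 0 <= t -> z t <= Num.max (z 0) (C + gs + 1).
Proof.
have [Ky lz] := ly.
apply: (lip0_barrier lz); first by rewrite le_max lexx.
move=> {}t t0; rewrite ge_max => /andP[_ zt].
have yt : C + gs + 1 <= y t.
  by apply: le_trans zt _; rewrite /z gerBl mulr_ge0 ?(ltW lam0)// ltW// wpos.
have wlt : w t < W.
  rewrite lt_neqAle wW// andbT; apply/eqP => E.
  have : y t <= gs by rewrite /y E GW; have := bet0 (b t); have := bet0 (b t - W); lra.
  have := C0; have := gs0; lra.
have y0 : 0 < y t by have := C0; have := gs0; lra.
have [r r0 rH] := local t0 (or_introl wlt) eps0.
exists r => // s ts; have [h1 h2] := rH s ts; case/andP: ts => ts _.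
rewrite (gtr0_norm y0) in h2.
have s0 : 0 <= s by rewrite (le_trans t0)// ltW.
have st0 : 0 < s - t by rewrite subr_gt0.
have wst : w t <= w s.
  have : 0 <= (y t - eps) * (s - t).
    rewrite mulr_ge0 ?(ltW st0)// subr_ge0.
    have := eps1; have := C0; have := gs0; lra.
  move: h1 => /ler_normlP[]; lra.
rewrite -subr_le0.
have -> : z s - z t = (G (w s) - G (w t)) -
  (bet (b s) + bet (b s - w s) - (bet (b t) + bet (b t - w t))) - lam * (w s - w t).
  by rewrite /z /y; ring.
apply: (dissip 0 st0 _ h1 h2 _ (betvar s t)); first by have := gs0; lra.
by rewrite subr_le0; apply: G_anti => //; [exact: wpos|exact: wW].
Qed.

Let zlower t : 0 <= t -> - z t <= Num.max (- z 0) (C + 1 + lam * W).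
Proof.
have [Ky lz] := ly.
have lz' : lip0 Ky (fun t => - z t).
  by move=> p q p0 q0; rewrite -opprD normrN; exact: lz.
apply: (lip0_barrier lz'); first by rewrite le_max lexx.
move=> {}t t0; rewrite ge_max => /andP[_ zt].
have yt : C + 1 <= - y t.
  have : lam * w t <= lam * W by rewrite ler_wpM2l ?(ltW lam0)// wW.
  by move: zt; rewrite /z; lra.
have y0 : y t < 0 by have := C0; lra.
have [r r0 rH] := local t0 (or_intror y0) eps0.
exists r => // s ts; have [h1 h2] := rH s ts; case/andP: ts => ts _.
rewrite (ltr0_norm y0) in h2.
have s0 : 0 <= s by rewrite (le_trans t0)// ltW.
have st0 : 0 < s - t by rewrite subr_gt0.
have wst : w s <= w t.
  have : 0 <= (- y t - eps) * (s - t).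
    rewrite mulr_ge0 ?(ltW st0)// subr_ge0.
    have := eps1; have := C0; have := gs0; lra.
  move: h1 => /ler_normlP[]; lra.
rewrite -subr_le0.
have -> : - z s - - z t = (G (w t) - G (w s)) -
  (bet (b t) + bet (b t - w t) - (bet (b s) + bet (b s - w s))) - lam * (w t - w s).
  by rewrite /z /y; ring.
have h3 := betvar t s; rewrite (distrC (b t)) in h3.
apply: (dissip 0 st0 yt _ h2 _ h3).
  rewrite (_ : _ - _ = - (w s - w t - y t * (s - t))) ?normrN//; ring.
by rewrite subr_le0; apply: G_anti => //; [exact: wpos|exact: wW].
Qed.

Definition drift_bound (z0 : R) : R := z0 + C + gs + 1 + 2 * (lam * W).

Lemma drift_a_priori z0 t : `|z 0| <= z0 -> 0 <= t ->
  `|y t| <= drift_bound z0 /\ `|g t| <= drift_bound z0 + gs + K * W.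
Proof.
move=> hz0 t0.
have lW : lam * w t <= lam * W by rewrite ler_wpM2l ?(ltW lam0)// wW.
have lw0 : 0 <= lam * w t by rewrite mulr_ge0 ?(ltW lam0)// ltW// wpos.
have z00 : 0 <= z0 by exact: le_trans hz0.
have yb : `|y t| <= drift_bound z0.
  have := zupper t0; have := zlower t0; rewrite !le_max /drift_bound.
  move: hz0 => /ler_normlP[h h']; have c0 := C0; have g0 := gs0.
  have zE : z t = y t - lam * w t by [].
  by move=> /orP[?|?] /orP[?|?]; apply/ler_normlP; split; lra.
split=> //.
have : `|2 * g t| <= drift_bound z0 + gs + K * W.
  rewrite gE; apply: le_trans (ler_normD _ _) _; apply: lerD; last exact: betab.
  by apply: le_trans (ler_normD _ _) _; rewrite (ger0_norm gs0) lerD2r.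
rewrite normrM ger0_norm//; have := normr_ge0 (g t); lra.
Qed.

End APriori.

Section Existence.
Variables (w0 b0 : R).
Hypotheses (w00 : 0 < w0) (w0W : w0 <= W).

Let lam := 2 * K + 1.
Let z0 := G w0 + lam * w0 + (beta b0 + beta (b0 - w0)).

Definition speed_bound : R := 2 * (drift_bound z0 + gs + K * W).

(** The truncation used in [flow_until_exists] depends on [T], so the equations
    hold up to [T]; the Lipschitz constant does not, which gives global Lipschitz
    bounds after gluing. *)
Definition flow_until (T : R) (w b : R -> R) : Prop :=
  [/\ lip0 speed_bound w /\ lip0 speed_bound b, w 0 = w0 /\ b 0 = b0,
      forall t, 0 <= t -> 0 < w t <= W,
      forall t : R, 0 < t < T -> is_derive t 1 b (front_speed (w t) (b t)) &
      {ae mu, forall t : R, 0 < t < T ->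
        (w t < W /\ is_derive t 1 w (width_drift (w t) (b t))) \/
        [/\ w t = W, is_derive t 1 w 0 & 0 <= width_drift (w t) (b t)]}].

Lemma G_ge0 x : 0 < x -> x <= W -> 0 <= G x.
Proof. by move=> x0 xW; rewrite (le_trans gs0)// -GW G_anti. Qed.

(** The reflected system is solved for coefficients made bounded and Lipschitz:
    [G] is frozen below a width [d], the friction is capped at [Mb]. The width
    never gets below [d], where [G] exceeds twice the cap, and by the a priori
    bound the fronts move too slowly to reach the cap before [T]. At almost every
    time of contact the width is stationary. *)
Lemma flow_until_exists T : 0 <= T -> exists w b, flow_until T w b.
Proof.
move=> T0.
have k0 := K0; have g0 := gs0.
have lam0 : 0 < lam by rewrite /lam; lra.
have z00 : 0 <= z0.
  by rewrite !addr_ge0 ?beta0 ?G_ge0// mulr_ge0 ?(ltW lam0) ?(ltW w00).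
pose Y := drift_bound z0.
have KW0 : 0 <= K * W by rewrite mulr_ge0// ltW.
have C0 : 0 <= K * (gs + K * W) by rewrite mulr_ge0 ?addr_ge0.
have Y0 : 0 <= Y.
  have lW : 0 <= lam * W by rewrite mulr_ge0 ?(ltW lam0) ?(ltW W0).
  by rewrite /Y /drift_bound -/lam; lra.
pose Yb := Y + gs + K * W.
have Yb0 : 0 <= Yb by rewrite /Yb; lra.
(* By time [T] both fronts are within [Yb * T + W] of [b0]. *)
pose Mb := beta b0 + K * (Yb * T + W).
have Mb0 : 0 <= Mb by rewrite addr_ge0 ?beta0// mulr_ge0 ?addr_ge0 ?mulr_ge0// ltW.
have [d' [d'0 d'W Gd']] := G_blowup (2 * Mb).
pose d := Num.min d' w0.
have d0 : 0 < d by rewrite lt_min d'0.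
have dW : d < W by rewrite gt_min d'W.
have Gd : 2 * Mb < G d.
  by apply: lt_le_trans Gd' _; apply: G_anti => //; [rewrite ge_min lexx|exact: ltW].
have [LG LG0 hLG] := G_lip d0.
pose cl x := Num.max (Num.min x W) d.
have cli x : d <= cl x <= W by rewrite /cl le_max lexx orbT/= ge_max (ltW dW) ge_min lexx orbT.
have clE x : d <= x -> x <= W -> cl x = x by move=> dx xW; rewrite /cl (min_idPl xW) (max_idPl dx).
have clB x x' : `|cl x - cl x'| <= `|x - x'|.
  exact: le_trans (ler_dist_max _ _ _) (ler_dist_min _ _ _).
pose bM x := Num.min (beta x) Mb.
have bM0 x : 0 <= bM x by rewrite le_min beta0.
have bMM x : bM x <= Mb by rewrite ge_min lexx orbT.
have bML x x' : `|bM x - bM x'| <= K * `|x - x'|.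
  exact: le_trans (ler_dist_min _ _ _) (beta_lip _ _).
have GC x : 0 <= G (cl x) <= G d.
  have /andP[h1 h2] := cli x; rewrite G_ge0//; last exact: lt_le_trans d0 _.
  exact: G_anti.
have GL x x' : `|G (cl x) - G (cl x')| <= LG * `|x - x'|.
  by apply: le_trans (hLG _ _ (cli x) (cli x')) _; rewrite ler_wpM2l.
pose f x v := G (cl x) - bM v - bM (v - x).
pose g x v := (G (cl x) + gs) / 2 - bM v.
have fM x v : `|f x v| <= G d + gs + 2 * Mb.
  rewrite /f; have := GC x; have := bM0 v; have := bM0 (v - x); have := bMM v; have := bMM (v - x).
  by move=> ? ? ? ? /andP[? ?]; apply/ler_normlP; split; lra.
have gM x v : `|g x v| <= G d + gs + 2 * Mb.
  rewrite /g; have := GC x; have := bM0 v; have := bMM v.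
  by move=> ? ? /andP[? ?]; apply/ler_normlP; split; lra.
pose L := LG + 2 * K + 1.
have L0 : 0 < L by rewrite /L; lra.
have fL x v x' v' : `|f x v - f x' v'| <= L * (`|x - x'| + `|v - v'|).
  have -> : f x v - f x' v' = (G (cl x) - G (cl x')) - (bM v - bM v') - (bM (v - x) - bM (v' - x')).
    by rewrite /f; ring.
  have h1 := GL x x'; have h2 := bML v v'.
  have h3 : `|bM (v - x) - bM (v' - x')| <= K * (`|v - v'| + `|x - x'|).
    apply: le_trans (bML _ _) _; rewrite ler_wpM2l//.
    have -> : v - x - (v' - x') = (v - v') - (x - x') by ring.
    exact: ler_normB.
  apply: le_trans (ler_normB _ _) _.
  apply: (@le_trans _ _ (LG * `|x - x'| + K * `|v - v'| + K * (`|v - v'| + `|x - x'|))).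
    by apply: lerD => //; apply: le_trans (ler_normB _ _) _; exact: lerD.
  rewrite -subr_ge0 (_ : _ - _ = LG * `|v - v'| + K * `|x - x'| + (`|x - x'| + `|v - v'|)).
    by rewrite !addr_ge0 ?mulr_ge0.
  rewrite /L; ring.
have gL x v x' v' : `|g x v - g x' v'| <= L * (`|x - x'| + `|v - v'|).
  have -> : g x v - g x' v' = (G (cl x) - G (cl x')) / 2 - (bM v - bM v').
    by rewrite /g; field.
  have h1 := GL x x'; have h2 := bML v v'.
  apply: le_trans (ler_normB _ _) _.
  apply: (@le_trans _ _ (LG * `|x - x'| + K * `|v - v'|)).
    apply: lerD => //; rewrite normrM (ger0_norm (_ : 0 <= 2^-1))//.
    by apply: le_trans h1; rewrite ler_piMr// invf_le1//; lra.
  rewrite -subr_ge0 (_ : _ - _ = LG * `|v - v'| + 2 * K * `|x - x'| + K * `|v - v'| + (`|x - x'| + `|v - v'|)).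
    by rewrite !addr_ge0 ?mulr_ge0.
  rewrite /L; ring.
have [w [b [X [[lw lb lX eb eX] [wE dX db]]]]] := reflected_flow b0 L0 w0W fM gM fL gL.
have w0E : w 0 = w0 by rewrite wE// (excess0 lX) ?eX// subr0.
have wW t : 0 <= t -> w t <= W by exact: (reflected_le lX wE).
have wd t : 0 <= t -> d <= w t.
  move=> t0; rewrite -lerN2.
  have lw' : lip0 (2 * (G d + gs + 2 * Mb)) (fun t => - w t).
    by move=> p q p0 q0; rewrite -opprD normrN; exact: lw.
  apply: (lip0_barrier lw') => // [|{}t {}t0 wt].
    by rewrite w0E lerN2 ge_min lexx orbT.
  have wtd : w t <= d by rewrite -lerN2.
  have y0 : 0 < f (w t) (b t).
    have -> : cl (w t) = d -> f (w t) (b t) = G d - bM (b t) - bM (b t - w t) by rewrite /f => ->.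
      have := bMM (b t); have := bMM (b t - w t); lra.
    rewrite /cl (min_idPl _) ?(max_idPr wtd)//; exact: le_trans (ltW dW).
  have wltW : w t < W by exact: le_lt_trans dW.
  have [r r0 rH] := reflected_right lX wE t0 (dX t t0) (or_introl wltW) y0.
  exists r => // s ts; have := rH s ts => /ler_normlP[]; rewrite lerN2; lra.
have wp t : 0 <= t -> 0 < w t by move=> t0; exact: lt_le_trans d0 (wd t t0).
have wC t : 0 <= t -> cl (w t) = w t by move=> t0; rewrite clE ?wd ?wW.
have dX' (t : R) : 0 <= t -> is_derive t 1 X (G (w t) - bM (b t) - bM (b t - w t)).
  by move=> t0; have := dX t t0; rewrite /f wC.
have db' (t : R) : 0 <= t -> is_derive t 1 b ((G (w t) + gs) / 2 - bM (b t)).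
  by move=> t0; have := db t t0; rewrite /g wC.
have bMb x : bM x <= beta x by rewrite ge_min lexx.
have hz0 : `|G (w 0) - bM (b 0) - bM (b 0 - w 0) - lam * w 0| <= z0.
  rewrite w0E eb /z0; have Gw0 := G_ge0 w00 w0W.
  have h1 : 0 <= lam * w0 by rewrite mulr_ge0 ?(ltW lam0) ?(ltW w00).
  have := bM0 b0; have := bM0 (b0 - w0); have := bMb b0; have := bMb (b0 - w0).
  by move=> ? ? ? ?; apply/ler_normlP; split; lra.
have ap t (t0 : 0 <= t) := drift_a_priori d0 bM0 bML lw lb lX wE dX' db' wd hz0 t0.
have lX' : lip0 Y X by apply: (lip0_derive dX') => t t0; have [] := ap t t0.
have lb' : lip0 Yb b by apply: (lip0_derive db') => t t0; have [] := ap t t0.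
have bT t : 0 <= t <= T -> beta (b t) <= Mb /\ beta (b t - w t) <= Mb.
  move=> /andP[t0 tT].
  have hb : `|b t - b0| <= Yb * T.
    rewrite -eb; apply: le_trans (lb' t 0 t0 (lexx _)) _.
    by rewrite subr0 ger0_norm// ler_wpM2l.
  have W1 := W0.
  split.
  - have h1 : `|beta (b t) - beta b0| <= K * (Yb * T + W).
      apply: le_trans (beta_lip _ _) _; rewrite ler_wpM2l//; lra.
    by move: h1 => /ler_normlP[_]; rewrite /Mb; lra.
  - have h1 : `|beta (b t - w t) - beta b0| <= K * (Yb * T + W).
      apply: le_trans (beta_lip _ _) _; rewrite ler_wpM2l//.
      have -> : b t - w t - b0 = (b t - b0) - w t by ring.
      apply: le_trans (ler_normB _ _) _; apply: lerD => //.
      by rewrite gtr0_norm ?wp// wW.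
    by move: h1 => /ler_normlP[_]; rewrite /Mb; lra.
have bME t : 0 <= t <= T -> bM (b t) = beta (b t) /\ bM (b t - w t) = beta (b t - w t).
  by move=> tT; have [h1 h2] := bT t tT; rewrite /bM (min_idPl h1) (min_idPl h2).
have i t : 0 < t < T -> 0 <= t /\ 0 <= t <= T.
  by move=> /andP[/ltW t0 /ltW tT]; rewrite t0 tT.
have yE t : 0 < t < T -> G (w t) - bM (b t) - bM (b t - w t) = width_drift (w t) (b t).
  by move=> /i[_ /bME[-> ->]].
exists w, b; split.
- split.
  + move=> s t s0 t0; rewrite !wE//.
    have -> : X s - excess W X s - (X t - excess W X t) = (X s - X t) - (excess W X s - excess W X t) by ring.
    apply: le_trans (ler_normB _ _) _; rewrite /speed_bound -/Y.
    apply: (@le_trans _ _ (Y * `|s - t| + Y * `|s - t|)).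
      by apply: lerD; [exact: lX'|exact: (excess_lip W lX')].
    rewrite -mulrDl ler_wpM2r//; lra.
  + move=> s t s0 t0; apply: le_trans (lb' s t s0 t0) _; rewrite ler_wpM2r// /speed_bound -/Y.
    exact: ler_peMl Yb0 (ler1n _ 2).
- by [].
- by move=> t t0; rewrite wp// wW.
- move=> t tT; have [t0 /bME[e1 _]] := i t tT; rewrite /front_speed -e1; exact: db'.
- have := @ae_contact_derive R (fun t => w (Num.max t 0)) (2 * (G d + gs + 2 * Mb)) W (lip0_clamp lw).
  apply: filterS; first exact: (ae_filter_ringOfSetsType mu).
  move=> t ct tT; have [t0 _] := i t tT; have /andP[tp _] := tT.
  have := wW t t0; rewrite le_eqVlt => /predU1P[wt|wt]; [right|left].
  + split=> //; last by rewrite -yE//; apply: (reflected_drift_ge0 lX wE tp (dX' t t0) wt).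
    have := ct; rewrite (max_idPl t0) => /(_ wt) /is_deriveP h; apply/is_deriveP => e e0.
    have [r r0 rH] := h e e0; exists (Num.min r t) => [|s]; first by rewrite lt_min r0.
    rewrite lt_min => /andP[sr st]; have := rH s sr.
    rewrite (max_idPl t0) (max_idPl _)//.
    by have := le_lt_trans (ler_norm (t - s)) (_ : `|t - s| < t); rewrite gtrDl oppr_lt0 distrC => /(_ st)/ltW.
  + by split=> //; rewrite -yE//; apply: (reflected_derive lX wE tp (dX' t t0) wt).
Qed.

Lemma flow_until_reflected T w b : flow_until T w b -> reflected_solution T w b.
Proof.
move=> [[lw lb] [_ _] wW db [N [mN N0 hN]]]; split.
- exists speed_bound; split=> s t; rewrite !in_itv/= => /andP[s0 _] /andP[t0 _];
  [exact: lw|exact: lb].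
- by move=> t; rewrite in_itv/= => /andP[t0 _]; exact: wW.
- exists N; first by exists N; split.
  move=> t tT nN; split; first exact: db.
  have [[wt dw]|[wt dw F0]] := contrapT (fun h => nN (hN t h)) tT.
  + by exists 0; split; rewrite ?subr0.
  + exists (width_drift (w t) (b t)); split=> //; first by rewrite wt ltxx.
    by rewrite subrr.
Qed.

Lemma reflected_solution_le T T' w b : T' <= T ->
  reflected_solution T w b -> reflected_solution T' w b.
Proof.
move=> TT [[K' [lw lb]] wW [N N0 hN]].
have i t : t \in `[0, T'] -> t \in `[0, T].
  by rewrite !in_itv/= => /andP[-> /le_trans]; exact.
split.
- by exists K'; split=> s t s0 t0; [apply: lw; exact: i|apply: lb; exact: i].
- by move=> t /i; exact: wW.
- by exists N => // t /andP[t0 tT]; apply: hN; rewrite t0 (lt_le_trans tT).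
Qed.

(** Uniqueness makes the solutions up to integer times coherent, so they glue. *)
Theorem flow_exists : exists w b, forall T, flow_until T w b.
Proof.
have ex (n : nat) : exists p : (R -> R) * (R -> R), flow_until n.+1%:R p.1 p.2.
  by have [|w [b h]] := @flow_until_exists n.+1%:R; [exact: ler0n|exists (w, b)].
have [W_ hW] := choice ex.
have coh m n (t : R) : (m <= n)%N -> 0 <= t <= m.+1%:R ->
    (W_ m).1 t = (W_ n).1 t /\ (W_ m).2 t = (W_ n).2 t.
  move=> mn /andP[t0 tm].
  have [_ [ew eb] _ _ _] := hW m; have [_ [ew' eb'] _ _ _] := hW n.
  apply: (reflected_solution_unique t0); rewrite ?ew ?eb//.
  - exact: reflected_solution_le (flow_until_reflected (hW m)).
  - apply: reflected_solution_le (flow_until_reflected (hW n)).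
    by rewrite (le_trans tm)// ler_nat.
pose w t := (W_ (Num.truncn t)).1 t; pose b t := (W_ (Num.truncn t)).2 t.
have eqn n (t : R) : 0 <= t <= n.+1%:R -> w t = (W_ n).1 t /\ b t = (W_ n).2 t.
  move=> /andP[t0 tn].
  have tt : t <= (Num.truncn t).+1%:R by rewrite ltW// truncnS_gt.
  have [h|/ltnW h] := leqP (Num.truncn t) n; first by apply: coh; rewrite ?t0.
  have tn' : 0 <= t <= n.+1%:R by rewrite t0.
  by have [e1 e2] := coh _ _ _ h tn'; rewrite /w /b e1 e2.
have big (T : R) : exists n : nat, T < n.+1%:R by exists (Num.truncn T); rewrite truncnS_gt.
have loc (n : nat) (t : R) : 0 < t < n.+1%:R -> exists2 r, 0 < r & forall s, `|s - t| < r -> 0 <= s <= n.+1%:R.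
  move=> /andP[t0 tn]; exists (Num.min t (n.+1%:R - t)); first by rewrite lt_min t0 subr_gt0.
  move=> s; rewrite lt_min => /andP[h1 h2]; have := ler_norm (s - t); have := ler_norm (t - s).
  by rewrite (distrC t) => ? ?; apply/andP; split; lra.
have der (n : nat) (t : R) (u v : R -> R) (d : R) : 0 < t < n.+1%:R ->
    (forall s, 0 <= s <= n.+1%:R -> u s = v s) -> is_derive t 1 v d -> is_derive t 1 u d.
  move=> tn uv /is_deriveP dv; apply/is_deriveP => e e0.
  have [r r0 rH] := dv e e0; have [r' r'0 rH'] := loc n t tn.
  exists (Num.min r r'); first by rewrite lt_min r0.
  move=> s; rewrite lt_min => /andP[h1 h2]; rewrite !uv; [exact: rH| |exact: rH'].
  by apply: rH'; rewrite subrr normr0.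
exists w, b => T; split.
- split=> s t s0 t0.
  + have [n nE] := big (Num.max s t); have [lw _] := (let: And5 h _ _ _ _ := hW n in h).
    have [|es _] := eqn n s; first by rewrite s0/= ltW// (le_lt_trans _ nE)// le_max lexx.
    have [|et _] := eqn n t; first by rewrite t0/= ltW// (le_lt_trans _ nE)// le_max lexx orbT.
    by rewrite es et; exact: lw.
  + have [n nE] := big (Num.max s t); have [_ lb] := (let: And5 h _ _ _ _ := hW n in h).
    have [|_ es] := eqn n s; first by rewrite s0/= ltW// (le_lt_trans _ nE)// le_max lexx.
    have [|_ et] := eqn n t; first by rewrite t0/= ltW// (le_lt_trans _ nE)// le_max lexx orbT.
    by rewrite es et; exact: lb.
- by have [_ h _ _ _] := hW 0%N; have [|-> ->] := eqn 0%N 0; first by rewrite lexx ler0n.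
- move=> t t0; have [n nE] := big t; have [|-> _] := eqn n t; first by rewrite t0 ltW.
  by have [_ _ h _ _] := hW n; exact: h.
- move=> t /andP[t0 tT]; have [n nE] := big t.
  have tn : 0 < t < n.+1%:R by rewrite t0.
  have [|ew eb] := eqn n t; first by rewrite !ltW.
  have [_ _ _ h _] := hW n; rewrite ew eb; apply: (der n) tn _ (h t tn).
  by move=> s /eqn[].
- have H : {ae mu, forall t : R, forall n : nat, 0 < t < n.+1%:R ->
        ((W_ n).1 t < W /\ is_derive t 1 (W_ n).1 (width_drift ((W_ n).1 t) ((W_ n).2 t))) \/
        [/\ (W_ n).1 t = W, is_derive t 1 (W_ n).1 0 & 0 <= width_drift ((W_ n).1 t) ((W_ n).2 t)]}.
    by apply/ae_foralln => n; have [_ _ _ _ h] := hW n.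
  move: H; apply: filterS; first exact: (ae_filter_ringOfSetsType mu).
  move=> t H /andP[t0 _]; have [n nE] := big t.
  have tn : 0 < t < n.+1%:R by rewrite t0.
  have [|ew eb] := eqn n t; first by rewrite !ltW.
  have uv s : 0 <= s <= n.+1%:R -> w s = (W_ n).1 s by move=> /eqn[].
  by rewrite ew eb; case: (H n tn) => [[h1 h2]|[h1 h2 h3]]; [left|right]; split=> //; apply: (der n) tn uv _.
Qed.

End Existence.

End DropFlow.

(** * The scalar product of square integrable functions *)

Section SquareIntegrable.
Context {R : realType}.
Local Notation mu := (@lebesgue_measure R).
Implicit Types f g h : R -> R.

Definition ip f g : R := (\int[mu]_x (f x * g x))%R.

Lemma L2_measurable f : L2 f -> measurable_fun setT f.
Proof. by rewrite /L2 inE => /andP[]; rewrite inE. Qed.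

Lemma L2_mul_integrable f g : L2 f -> L2 g ->
  mu.-integrable setT (EFin \o (fun x => f x * g x)).
Proof. by move=> hf hg; apply/Lfun1_integrable; exact: Lfun2_mul_Lfun1. Qed.

Lemma ae_neq (c : R) : {ae mu, forall x : R, x != c}.
Proof.
apply: (@negligibleS _ _ _ mu [set c]); last by apply/negligibleP => //; exact: lebesgue_measure_set1.
by move=> x /= /negP; rewrite negbK => /eqP.
Qed.

Lemma continuous_ae_eq0 f : continuous f -> {ae mu, forall x, f x = 0} -> forall x, f x = 0.
Proof.
move=> cf [N [mN N0 sub]] x; apply: contrapT => /eqP fx.
have e0 : 0 < `|f x| by rewrite normr_gt0.
have /cvgrPdist_lt/(_ _ e0) := cf x; rewrite near_nbhs => -[r /= r0 rH].
have bN : ball x r `<=` N.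
  move=> y /rH /= h; apply: sub => /= fy; move: h; rewrite fy subr0 ltxx; exact: not_false_is_true.
have : (mu (ball x r) <= mu N)%E.
  by apply: le_measure; rewrite ?inE//; exact: measurable_ball.
rewrite [leRHS]N0 lebesgue_measure_ball ?(ltW r0)// lee_fin.
by rewrite leNgt mulrn_wgt0.
Qed.

Lemma L2_of_sqr f : measurable_fun setT f ->
  mu.-integrable setT (EFin \o (fun x => f x * f x)) -> L2 f.
Proof.
move=> mf /integrableP[_ foo]; rewrite /L2 inE; apply/andP; split; rewrite inE//=.
rewrite /finite_norm unlock poweR_lty//; apply: le_lt_trans foo.
rewrite le_eqVlt; apply/orP; left; apply/eqP; apply: eq_integral => x _ /=.
by rewrite powR_mulrn ?normr_ge0// expr2 normrM.
Qed.

Lemma L2D f g : L2 f -> L2 g -> L2 (fun x => f x + g x).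
Proof.
have p1 : (1 <= (2%:E : \bar R))%E by rewrite lee_fin ler1n.
by move=> hf hg; exact: (Lfun_addr_closed mu p1).2.
Qed.

Lemma L2Z (c : R) f : L2 f -> L2 (fun x => c * f x).
Proof.
move=> hf; have := @Lfun_scale _ _ _ mu f c 2 (ler1n _ 2) hf.
by rewrite /L2 (_ : (fun x => _) = c \o* f)//; apply/funext => x /=; rewrite mulrC.
Qed.

Lemma L2B f g : L2 f -> L2 g -> L2 (fun x => f x - g x).
Proof.
move=> hf hg; rewrite (_ : (fun x => _) = (fun x => f x + (-1) * g x)).
  by apply: L2D => //; exact: L2Z.
by apply/funext => x; rewrite mulN1r.
Qed.

Lemma ipC f g : ip f g = ip g f.
Proof. by apply: eq_Rintegral => x _; rewrite mulrC. Qed.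

Lemma ipDl f g h : L2 f -> L2 g -> L2 h -> ip (fun x => f x + g x) h = ip f h + ip g h.
Proof.
move=> hf hg hh; rewrite /ip -RintegralD//; [|exact: L2_mul_integrable..].
by apply: eq_Rintegral => x _; rewrite mulrDl.
Qed.

Lemma ipZl (c : R) f h : L2 f -> L2 h -> ip (fun x => c * f x) h = c * ip f h.
Proof.
move=> hf hh; rewrite /ip -RintegralZl//; last exact: L2_mul_integrable.
by apply: eq_Rintegral => x _; rewrite mulrA.
Qed.

Lemma ipBl f g h : L2 f -> L2 g -> L2 h -> ip (fun x => f x - g x) h = ip f h - ip g h.
Proof.
move=> hf hg hh; rewrite /ip -RintegralB//; [|exact: L2_mul_integrable..].
by apply: eq_Rintegral => x _; rewrite mulrBl.
Qed.

Lemma ipDr f g h : L2 f -> L2 g -> L2 h -> ip h (fun x => f x + g x) = ip h f + ip h g.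
Proof. by move=> *; rewrite ipC ipDl// !(ipC _ h). Qed.

Lemma ipZr (c : R) f h : L2 f -> L2 h -> ip h (fun x => c * f x) = c * ip h f.
Proof. by move=> *; rewrite ipC ipZl// !(ipC _ h). Qed.

Lemma ipBr f g h : L2 f -> L2 g -> L2 h -> ip h (fun x => f x - g x) = ip h f - ip h g.
Proof. by move=> *; rewrite ipC ipBl// !(ipC _ h). Qed.

Lemma ip_ge0 f : 0 <= ip f f.
Proof. by apply: Rintegral_ge0 => x _; rewrite -expr2 sqr_ge0. Qed.

Lemma ip_ae f g h : L2 f -> L2 g -> L2 h -> {ae mu, forall x, f x = g x} -> ip f h = ip g h.
Proof.
move=> hf hg hh fg; rewrite /ip /Rintegral; congr fine.
apply: ae_eq_integral => //.
- by apply/measurable_EFinP/measurable_funM; exact: L2_measurable.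
- by apply/measurable_EFinP/measurable_funM; exact: L2_measurable.
- move: fg; apply: filterS; first exact: (ae_filter_ringOfSetsType mu).
  by move=> x /= -> _.
Qed.

Lemma ip_eq0 f : L2 f -> ip f f = 0 -> {ae mu, forall x, f x = 0}.
Proof.
move=> hf f0.
have int := L2_mul_integrable hf hf.
have mf : measurable_fun setT (EFin \o (fun x => f x * f x)) by case/integrableP: int.
have : (\int[mu]_x `|(f x * f x)%:E| = 0)%E.
  rewrite (_ : 0%E = (ip f f)%:E); last by rewrite f0.
  rewrite /ip /Rintegral fineK; last exact: integrable_fin_num int.
  by apply: eq_integral => x _ /=; rewrite ger0_norm// -expr2 sqr_ge0.
move/(ae_eq_integral_abs mu measurableT mf).
case=> N [mN N0 sub]; exists N; split=> //; apply: subset_trans sub => x /= nf H.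
by apply: nf; have [/eqP] := H I; rewrite mulf_eq0 orbb => /eqP.
Qed.

Lemma ip_young (e : R) f g : 0 < e -> L2 f -> L2 g -> `|2 * ip f g| <= e * ip f f + e^-1 * ip g g.
Proof.
move=> e0 hf hg; pose r := Num.sqrt e.
have r0 : 0 < r by rewrite sqrtr_gt0.
have rE : e = r * r by rewrite -expr2 sqr_sqrtr// ltW.
have one c : c * c = 1 -> 0 <= e * ip f f + e^-1 * ip g g + 2 * c * ip f g.
  move=> c1; have hu : L2 (fun x => r * f x) by exact: L2Z.
  have hv : L2 (fun x => c / r * g x) by exact: L2Z.
  have := ip_ge0 (fun x => r * f x + c / r * g x).
  rewrite ipDl ?ipDr// ?ipZl ?ipZr//; [|exact: L2D..].
  rewrite (ipC g f).
  have -> : r * (r * ip f f) + r * (c / r * ip f g) + (c / r * (r * ip f g) + c / r * (c / r * ip g g)) =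
     e * ip f f + (c * c) * e^-1 * ip g g + 2 * c * ip f g.
    by rewrite rE; field; rewrite gt_eqF.
  by rewrite c1 mul1r.
have h1 := one 1 (mulr1 1); have h2 := one (-1) (ltac:(by rewrite mulrNN mulr1)).
by apply/ler_normlP; split; lra.
Qed.

Lemma ip_cvg0 f (h : nat -> R -> R) : L2 f -> (forall n, L2 (h n)) ->
  ip (h n) (h n) @[n --> \oo] --> (0 : R) -> ip f (h n) @[n --> \oo] --> (0 : R).
Proof.
move=> hf hh /cvgrPdist_le H; apply/cvgrPdist_le => e e0.
pose d := e / (ip f f + 1).
have F0 := ip_ge0 f.
have F1 : 0 < ip f f + 1 by lra.
have d0 : 0 < d by rewrite divr_gt0.
have dF : d * (ip f f + 1) = e by rewrite divfK// gt_eqF.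
have ed0 : 0 < e * d by rewrite mulr_gt0.
near=> n.
have hn : ip (h n) (h n) <= e * d.
  have : `|0 - ip (h n) (h n)| <= e * d by near: n; exact: H.
  by rewrite sub0r normrN ger0_norm// ip_ge0.
have := ip_young d0 hf (hh n); rewrite normrM ger0_norm//.
have : d^-1 * ip (h n) (h n) <= e.
  by rewrite mulrC ler_pdivrMr.
rewrite sub0r normrN; lra.
Unshelve. all: by end_near. Qed.

Lemma box_integrable (c a b : R) :
  mu.-integrable setT (EFin \o (fun x => c * \1_(`[a, b]%classic) x)).
Proof.
apply: (@eq_integrable _ _ _ mu setT measurableT (fun x => (c%:E * (\1_(`[a, b]%classic) x)%:E)%E)).
  by move=> x _ /=; rewrite EFinM.
by apply: integrableZl => //; exact: (integrable_indic_itv a b true false).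
Qed.

Lemma L2_bounded (M a b : R) f : measurable_fun setT f -> (forall x, `|f x| <= M) ->
  (forall x, ~ (a <= x <= b) -> f x = 0) -> L2 f.
Proof.
move=> mf fM f0; apply: L2_of_sqr => //.
have M0 : 0 <= M by exact: le_trans (normr_ge0 _) (fM 0).
have hI := box_integrable (M * M) a b.
apply: le_integrable hI => //.
- by apply/measurable_EFinP; exact: measurable_funM.
move=> x _ /=; rewrite lee_fin !normrM !(ger0_norm M0).
have [xab|xab] := pselect (a <= x <= b).
  rewrite indicE mem_set//= ?in_itv//= normr1 mulr1.
  by apply: ler_pM.
by rewrite f0// normr0 !mul0r mulr_ge0 ?mulr_ge0.
Qed.

Lemma ip_dominated (f : nat -> R -> R) (M a b : R) :
  (forall n, measurable_fun setT (f n)) -> (forall n x, `|f n x| <= M) ->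
  (forall n x, ~ (a <= x <= b) -> f n x = 0) ->
  {ae mu, forall x, f n x @[n --> \oo] --> (0 : R)} ->
  ip (f n) (f n) @[n --> \oo] --> (0 : R).
Proof.
move=> mf fM f0 fc.
have M0 : 0 <= M by exact: le_trans (normr_ge0 _) (fM 0%N 0).
have hI := box_integrable (M * M) a b.
have [|||||_ _ D] := @dominated_convergence _ _ _ mu setT measurableT
  (fun n x => (f n x * f n x)%:E) (cst 0%E) (EFin \o (fun x => M * M * \1_(`[a, b]%classic) x)).
- by move=> n; apply/measurable_EFinP; exact: (measurable_funM (mf n) (mf n)).
- exact: measurable_cst.
- move: fc; apply: filterS; first exact: (ae_filter_ringOfSetsType mu).
  move=> x fx _; rewrite (_ : cst 0%E x = (0 * 0)%:E); last by rewrite mul0r.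
  by apply: cvg_EFin; [exact: nearW|exact: cvgM].
- exact: hI.
- apply: aeW => x n _ /=; rewrite lee_fin normrM.
  have [xab|xab] := pselect (a <= x <= b).
    rewrite indicE mem_set//= ?in_itv//= mulr1.
    by apply: ler_pM.
  by rewrite f0// normr0 !mul0r mulr_ge0 ?mulr_ge0.
move: D; rewrite integral0 => /fine_cvgP[_].
by apply: cvg_trans.
Qed.

Lemma FTC_itv (F f : R -> R) (a b : R) : a < b -> continuous f ->
  (forall x : R, is_derive x 1 F (f x)) -> (\int[mu]_(x in `[a, b]) f x)%R = F b - F a.
Proof.
move=> ab cf dF.
have cF : continuous F by move=> x; apply: differentiable_continuous; apply/derivable1_diffP; have [] := dF x.
rewrite /Rintegral (@continuous_FTC2 _ f F)//=.
- exact: continuous_subspaceT.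
- split.
  + by move=> x _; have [] := dF x.
  + exact: cvg_at_right_filter (cF a).
  + exact: cvg_at_left_filter (cF b).
- by move=> x _; have [_ <-] := dF x; rewrite derive1E.
Qed.

(** Lebesgue differentiation reduces the vanishing of a square integrable
    function to that of its integrals over intervals. *)
Lemma ae_eq0_itv g : L2 g -> (forall c d, c < d -> (\int[mu]_(x in `[c, d]) g x)%R = 0) ->
  {ae mu, forall x, g x = 0}.
Proof.
move=> hg g0.
suff H (n : nat) : {ae mu, forall x : R, - n%:R < x < n%:R -> g x = 0}.
  have : {ae mu, forall x : R, forall n : nat, - n%:R < x < n%:R -> g x = 0}.
    by apply/ae_foralln.
  apply: filterS; first exact: (ae_filter_ringOfSetsType mu).
  move=> x; apply.
  have := truncnS_gt `|x|; set n := _.+1 => h; apply: (_ : - n%:R < x < n%:R).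
  by rewrite -ltr_norml.
pose A := `[- n%:R, n%:R : R]%classic.
have mA : measurable A by exact: measurable_itv.
have h1 : L2 (\1_A : R -> R).
  apply: (@L2_bounded 1 (- n%:R) n%:R).
  - exact: measurable_indic.
  - by move=> x; rewrite indicE; case: (_ \in _); rewrite ?normr1 ?normr0.
  - by move=> x xA; rewrite indicE memNset// /A/= in_itv.
have h := L2_mul_integrable hg h1.
have intA : mu.-integrable A (EFin \o g).
  have hA : mu.-integrable A (EFin \o (fun x => g x * \1_A x)) by exact: integrableS h.
  apply: eq_integrable hA => // x xA /=; rewrite indicE.
  by rewrite xA mulr1.
pose gA := g \_ A.
have intgA : mu.-integrable setT (EFin \o gA).
  apply: (@eq_integrable _ _ _ mu setT measurableT _ _ _ h) => x _ /=.
  by rewrite /gA patchE indicE; case: (_ \in _); rewrite ?mulr1 ?mulr0.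
have lgA : locally_integrable setT gA by exact: integrable_locally.
have int y : mu.-integrable [set` Interval (BLeft (- n%:R : R)) (BRight y)] (EFin \o gA).
  exact: integrableS intgA.
move: (FTC1 int lgA); apply: filterS; first exact: (ae_filter_ringOfSetsType mu).
move=> x Hx /andP[nx xn].
have [|dF] := Hx; first by rewrite lte_fin.
set F := (X in X^`()%classic x = _) => eF.
have F0 y : F y = 0.
  rewrite /F; have [yn|yn] := leP y (- n%:R).
    move: yn; rewrite le_eqVlt => /predU1P[->|yn].
      by rewrite set_itv1 Rintegral_set1.
    by rewrite set_itv_ge ?Rintegral_set0// bnd_simp -ltNge.
  rewrite /gA -Rintegral_mkcondr.
  rewrite (_ : _ `&` _ = `[- n%:R, Num.min y n%:R]%classic); last first.
    apply/seteqP; split=> z; rewrite /A/= !in_itv/= le_min.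
    - by move=> [/andP[-> ->] /andP[_ ->]].
    - by move=> /andP[-> /andP[-> ->]].
  by apply: g0; rewrite lt_min yn (lt_trans nx).
have -> : g x = gA x by rewrite /gA patchE mem_set// /A/= in_itv/= !ltW.
rewrite -eF (_ : F = cst 0); last by apply/funext.
by rewrite derive1_cst.
Qed.

End SquareIntegrable.

(** * Test functions and integration by parts *)

Section TestFunctions.
Context {R : realType}.
Local Notation mu := (@lebesgue_measure R).
Implicit Types f g h phi psi : R -> R.

Lemma continuous_bounded_itv f (a b : R) : continuous f ->
  exists2 M, 0 <= M & forall x, a <= x <= b -> `|f x| <= M.
Proof.
move=> cf; have [ab|ba] := leP a b; last first.
  by exists 0 => // x /andP[ax xb]; have := lt_le_trans ba (le_trans ax xb); rewrite ltxx.
have cn : continuous (fun x => `|f x|) by move=> x; apply: cvg_norm; exact: cf.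
have [c _ cM] := EVT_max ab (continuous_subspaceT (A := `[a, b]) cn).
by exists `|f c| => // x xab; apply: cM; rewrite in_itv.
Qed.

Lemma L2_continuous f (a b : R) : continuous f -> (forall x, ~ (a <= x <= b) -> f x = 0) -> L2 f.
Proof.
move=> cf f0; have [M M0 fM] := continuous_bounded_itv a b cf.
apply: (@L2_bounded _ M a b) => //; first exact: continuous_measurable_fun.
by move=> x; have [/fM//|/f0->] := pselect (a <= x <= b); rewrite normr0.
Qed.

Lemma L2_continuous_box f (a b : R) : continuous f -> L2 (fun x => f x * \1_(`[a, b]%classic) x).
Proof.
move=> cf; have [M M0 fM] := continuous_bounded_itv a b cf.
apply: (@L2_bounded _ M a b).
- apply: measurable_funM; first exact: continuous_measurable_fun.
  exact: measurable_indic.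
- move=> x; have [xab|xab] := pselect (a <= x <= b).
    by rewrite indicE mem_set//= ?in_itv// mulr1 fM.
  by rewrite indicE memNset ?mulr0 ?normr0//= in_itv.
- by move=> x xab; rewrite indicE memNset ?mulr0//= in_itv.
Qed.

Lemma Rintegral_box f (a b : R) : (forall x, ~ (a <= x <= b) -> f x = 0) ->
  (\int[mu]_x f x)%R = (\int[mu]_(x in `[a, b]) f x)%R.
Proof.
move=> f0; rewrite [RHS]Rintegral_mkcond; apply: eq_Rintegral => x _.
rewrite patchE; case: ifPn => // /negP xab; apply: f0 => h; apply: xab.
by rewrite mem_set//= in_itv.
Qed.

Lemma C1c_intro (I : set R) phi dphi (c d : R) :
  (forall x : R, is_derive x 1 phi (dphi x)) -> continuous dphi ->
  (forall x, ~ (c <= x <= d) -> phi x = 0) -> `[c, d] `<=` I -> C1c I phi.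
Proof.
move=> dp cdp p0 cdI.
have sub : closure [set x | phi x != 0] `<=` `[c, d].
  have cl : closed (`[c, d]%classic : set R) by exact: itv_closed.
  rewrite [X in _ `<=` X](_ : _ = closure `[c, d]%classic); last exact: (closure_id _).1 cl.
  apply: closureS => x /= /eqP px.
  by rewrite in_itv/=; apply: contrapT => h; apply: px; exact: p0.
split.
- by move=> x; have [] := dp x.
- rewrite (_ : derive1 phi = dphi)//; apply/funext => x; rewrite derive1E.
  by have [_] := dp x.
- by apply: subclosed_compact sub; [exact: closed_closure|exact: segment_compact].
- exact: subset_trans cdI.
Qed.

Lemma C1c_derive (I : set R) phi (x : R) : C1c I phi -> is_derive x 1 phi (derive1 phi x).
Proof. by move=> [dp _ _ _]; rewrite derive1E; exact: derivableP. Qed.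

Lemma C1c_out (I : set R) phi x : C1c I phi -> ~ I x -> phi x = 0.
Proof.
move=> [_ _ _ sub] nI; apply: contrapT => /eqP px; apply: nI; apply: sub.
exact: subset_closure.
Qed.

Lemma C1c_subset (I J : set R) phi : I `<=` J -> C1c I phi -> C1c J phi.
Proof. by move=> IJ [h1 h2 h3 h4]; split=> //; exact: subset_trans IJ. Qed.

Lemma C1c_support (I : set R) phi : C1c I phi ->
  exists2 N, 0 < N & forall x, ~ (- N <= x <= N) -> phi x = 0 /\ derive1 phi x = 0.
Proof.
move=> H; have [_ _ cpt _] := H.
have [N0 [_ HN]] := compact_bounded cpt.
pose N := Num.max N0 0 + 1.
have NN : N0 < N by have h : N0 <= Num.max N0 0; [rewrite le_max lexx|rewrite /N; lra].
have Np : 0 < N by rewrite ltr_wpDl// le_max lexx orbT.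
exists N => // x xN.
have nS : ~ closure [set x | phi x != 0] x.
  by move=> /(HN N NN); rewrite /= ler_norml => h; exact: xN.
split; first by apply: contrapT => /eqP px; apply: nS; exact: subset_closure.
have oS : open (~` closure [set x | phi x != 0]) by rewrite openC; exact: closed_closure.
move: oS; rewrite openE => /(_ _ nS); rewrite /interior -nbhs_ballE => -[r /= r0 rS].
have z s : `|s - x| < r -> phi s = 0.
  move=> sr; apply: contrapT => /eqP px; apply: (rS s); last exact: subset_closure.
  by rewrite /ball/= distrC.
rewrite derive1E; suff [] : is_derive x 1 phi 0 by [].
apply/is_deriveP => e e0; exists r => // s sr.
by rewrite z// z ?subrr ?normr0// mul0r subr0 normr0 mulr_ge0// ltW.
Qed.

Lemma C1c_continuous (I : set R) phi : C1c I phi -> continuous phi.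
Proof.
move=> [dp _ _ _] x; apply: differentiable_continuous; exact/derivable1_diffP.
Qed.

Lemma C1c_L2 (I : set R) phi : C1c I phi -> L2 phi /\ L2 (derive1 phi).
Proof.
move=> H; have [N _ HN] := C1c_support H; have [_ cd _ _] := H; split.
- by apply: (@L2_continuous _ (- N) N); [exact: C1c_continuous H|move=> x /HN[]].
- by apply: (@L2_continuous _ (- N) N) => // x /HN[].
Qed.

Lemma parts_box F f psi (a b : R) : a < b -> continuous f ->
  (forall x : R, is_derive x 1 F (f x)) -> C1c setT psi ->
  F a * psi a = 0 -> F b * psi b = 0 ->
  ip (fun x => F x * \1_(`[a, b]%classic) x) (derive1 psi) =
  - ip (fun x => f x * \1_(`[a, b]%classic) x) psi.
Proof.
move=> ab cf dF Hp ea eb.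
have [_ cdp _ _] := Hp; have cp := C1c_continuous Hp.
have cF : continuous F by move=> x; apply: differentiable_continuous; apply/derivable1_diffP; have [] := dF x.
have [lp ldp] := C1c_L2 Hp.
apply/eqP; rewrite -addr_eq0; apply/eqP.
rewrite /ip -RintegralD//; last 2 first.
- by apply: L2_mul_integrable => //; exact: L2_continuous_box.
- by apply: L2_mul_integrable => //; exact: L2_continuous_box.
rewrite (@Rintegral_box _ a b); last first.
  by move=> x xab; rewrite indicE memNset ?mulr0 ?mul0r ?addr0//= in_itv.
rewrite (_ : Rintegral _ _ _ = (\int[mu]_(x in `[a, b]) (f x * psi x + F x * derive1 psi x))%R); last first.
  by apply: eq_Rintegral => x xab; rewrite indicE xab !mulr1 addrC.
have c' : continuous (fun x => f x * psi x + F x * derive1 psi x).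
  by move=> x; apply: cvgD; apply: cvgM; [exact: cf|exact: cp|exact: cF|exact: cdp].
have d' (x : R) : is_derive x 1 (fun x => F x * psi x) (f x * psi x + F x * derive1 psi x).
  by apply: D_mul => //; exact: C1c_derive Hp.
by rewrite (FTC_itv ab c' d') ea eb subrr.
Qed.

(** Integration by parts on a segment that contains the support in its interior. *)
Lemma C1c_weak (I : set R) phi : C1c I phi -> weak_derivative phi (derive1 phi).
Proof.
move=> H psi Hpsi; have [N N0 HN] := C1c_support H; have [_ cd _ _] := H.
have box (f : R -> R) : (forall x, ~ (- N <= x <= N) -> f x = 0) ->
    f = (fun x => f x * \1_(`[- N - 1, N + 1]%classic) x).
  move=> f0; apply/funext => x; rewrite indicE.
  have [xN|xN] := pselect (- N <= x <= N); last by rewrite f0// mul0r.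
  by rewrite mem_set ?mulr1//= in_itv/=; case/andP: xN => ? ?; apply/andP; split; lra.
have h1 : ~ (- N <= - N - 1 <= N) by move=> /andP[? _]; lra.
have h2 : ~ (- N <= N + 1 <= N) by move=> /andP[_ ?]; lra.
rewrite -/(ip phi (derive1 psi)) -/(ip (derive1 phi) psi).
have e1 : phi = (fun x => phi x * \1_(`[- N - 1, N + 1]%classic) x).
  by apply: (box phi) => x /HN[].
have e2 : derive1 phi = (fun x => derive1 phi x * \1_(`[- N - 1, N + 1]%classic) x).
  by apply: (box (derive1 phi)) => x /HN[].
rewrite [in LHS]e1 [in RHS]e2.
apply: parts_box => //; first lra.
- by move=> x; exact: C1c_derive H.
- by have [-> _] := HN _ h1; rewrite mul0r.
- by have [-> _] := HN _ h2; rewrite mul0r.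
Qed.

End TestFunctions.

(** * Cutoff functions of an interval *)

Section Cutoff.
Context {R : realType}.
Local Notation mu := (@lebesgue_measure R).
Variables (a b : R).
Hypothesis ab : a < b.

Let p (x : R) := (x - a) * (b - x).
Let m (e x : R) := Num.max (p x - e) 0.

(** A C^1 function of the distance product (x-a)(b-x), vanishing where the
    product is at most [e] and tending to the indicator of the interval. *)
Definition cutoff (e x : R) : R := m e x ^+ 2 / (m e x ^+ 2 + e ^+ 2).
Definition cutoff' (e x : R) : R :=
  2 * m e x * (a + b - 2 * x) * e ^+ 2 / (m e x ^+ 2 + e ^+ 2) ^+ 2.

Lemma cutoff'E e x : cutoff' e x =
  (a + b - 2 * x) * (2 * m e x * e ^+ 2 / (m e x ^+ 2 + e ^+ 2) ^+ 2).
Proof. rewrite /cutoff' !mulrA; congr (_ * _ / _); ring. Qed.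

Lemma bump_ge0 (q e : R) : 0 <= q -> 0 < e -> 0 <= 2 * q * e ^+ 2 / (q ^+ 2 + e ^+ 2) ^+ 2.
Proof. by move=> q0 e0; rewrite divr_ge0 ?sqr_ge0// mulr_ge0 ?sqr_ge0// mulr_ge0. Qed.

Lemma bump_small (q r e : R) : 0 < e -> e <= 1 -> 0 < r -> r <= q ->
  2 * q * e ^+ 2 / (q ^+ 2 + e ^+ 2) ^+ 2 <= 2 / r ^+ 3 * e.
Proof.
move=> e0 e1 r0 rq; have q0 : 0 < q by exact: lt_le_trans rq.
have D0 : 0 < q ^+ 2 + e ^+ 2 by rewrite addr_gt0// exprn_gt0.
rewrite ler_pdivrMr ?exprn_gt0//.
have h1 : q * e ^+ 2 <= q * e by rewrite ler_wpM2l ?(ltW q0)// expr2 ler_piMl// ltW.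
have h2 : q * r ^+ 3 <= (q ^+ 2 + e ^+ 2) ^+ 2.
  apply: (@le_trans _ _ (q * q ^+ 3)).
    by rewrite ler_wpM2l ?(ltW q0)// lerXn2r// nnegrE ltW.
  have -> : q * q ^+ 3 = (q ^+ 2) ^+ 2 by ring.
  by rewrite lerXn2r ?nnegrE ?sqr_ge0// ?(ltW D0)// lerDl sqr_ge0.
have -> : 2 / r ^+ 3 * e * (q ^+ 2 + e ^+ 2) ^+ 2 = (q ^+ 2 + e ^+ 2) ^+ 2 * (2 * e / r ^+ 3).
  by field; rewrite gt_eqF.
apply: (@le_trans _ _ (q * r ^+ 3 * (2 * e / r ^+ 3))).
  have -> : q * r ^+ 3 * (2 * e / r ^+ 3) = 2 * (q * e) by field; rewrite gt_eqF.
  by rewrite -mulrA ler_wpM2l.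
by rewrite ler_wpM2r// divr_ge0 ?exprn_ge0 ?mulr_ge0// ltW.
Qed.

Lemma bump_bounded (q e : R) : 0 <= q -> 0 < e ->
  (q + e) * (2 * q * e ^+ 2 / (q ^+ 2 + e ^+ 2) ^+ 2) <= 2.
Proof.
move=> q0 e0; have D0 : 0 < q ^+ 2 + e ^+ 2 by rewrite ltr_wpDl ?sqr_ge0// exprn_gt0.
rewrite mulrA ler_pdivrMr ?exprn_gt0// -subr_ge0.
have -> : 2 * (q ^+ 2 + e ^+ 2) ^+ 2 - (q + e) * (2 * q * e ^+ 2) =
  2 * (q ^+ 2) ^+ 2 + q ^+ 2 * e ^+ 2 + (q - e) ^+ 2 * e ^+ 2 + (e ^+ 2) ^+ 2 by ring.
apply: addr_ge0; last exact: sqr_ge0.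
apply: addr_ge0; last by apply: mulr_ge0; exact: sqr_ge0.
by apply: addr_ge0; apply: mulr_ge0 => //; exact: sqr_ge0.
Qed.

(** Squaring smooths the corner of the positive part. *)
Lemma D_sqr_pos (s : R) : is_derive s 1 (fun x => Num.max x 0 ^+ 2) (2 * Num.max s 0).
Proof.
apply/is_deriveP => e e0; exists e => // t te.
apply: (@le_trans _ _ (`|t - s| * `|t - s|)); last by rewrite ler_wpM2r// ltW.
rewrite -normrM; apply/ler_normlP.
have q0 : 0 <= (t - s) * (t - s) by rewrite -expr2 sqr_ge0.
rewrite (ger0_norm q0) !expr2.
by case: (leP t 0) => t0; case: (leP s 0) => s0; split; nra.
Qed.

Let m0 e x : 0 <= m e x. Proof. by rewrite le_max lexx orbT. Qed.

Let den e x : 0 < e -> 0 < m e x ^+ 2 + e ^+ 2.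
Proof. by move=> e0; rewrite ltr_wpDl ?sqr_ge0// exprn_gt0. Qed.

Lemma D_cutoff (e x : R) : 0 < e -> is_derive x 1 (cutoff e) (cutoff' e x).
Proof.
move=> e0.
have dp : is_derive x 1 (fun y => p y - e) (a + b - 2 * x).
  apply: D_ext (D_sub (D_mul (D_sub (D_id x) (D_cst x a)) (D_sub (D_cst x b) (D_id x))) (D_cst x e)) _.
  ring.
have dm := @D_comp R (fun y => Num.max y 0 ^+ 2) (fun y => p y - e) x _ _ (D_sqr_pos (p x - e)) dp.
have nz : m e x ^+ 2 + e ^+ 2 != 0 by rewrite gt_eqF ?den.
have dq := D_mul dm (D_inv (D_add dm (D_cst x (e ^+ 2))) nz).
apply: D_ext dq _; rewrite /cutoff' -/(m e x); field; exact: nz.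
Qed.

Let cm (e : R) : continuous (m e).
Proof.
move=> x; apply: (@continuous_comp _ _ _ (fun y => p y - e) (fun y => Num.max y 0)); last first.
  by apply: (@lipschitz_fun_continuous _ _ 1) => s t; rewrite mul1r; exact: ler_dist_max.
apply: cvgB; last exact: cvg_cst.
by apply: cvgM; apply: cvgB; (exact: cvg_id || exact: cvg_cst).
Qed.

Lemma cutoff'_continuous e : 0 < e -> continuous (cutoff' e).
Proof.
move=> e0 x; have cx : m e y @[y --> x] --> m e x by exact: cm.
have c2 : m e y ^+ 2 + e ^+ 2 @[y --> x] --> m e x ^+ 2 + e ^+ 2.
  by apply: cvgD; [rewrite expr2; under eq_fun do rewrite expr2; exact: cvgM|exact: cvg_cst].
apply: cvgM.
  apply: cvgM; last exact: cvg_cst.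
  apply: cvgM; first by apply: cvgM => //; exact: cvg_cst.
  by apply: cvgB; [exact: cvg_cst|apply: cvgM; [exact: cvg_cst|exact: cvg_id]].
apply: cvgV; first by rewrite expf_neq0// gt_eqF ?den.
by rewrite expr2; under eq_fun do rewrite expr2; exact: cvgM.
Qed.

Lemma cutoff_ge0 e x : 0 < e -> 0 <= cutoff e x.
Proof. by move=> e0; rewrite divr_ge0 ?sqr_ge0// ltW ?den. Qed.

Lemma cutoff_le1 e x : 0 < e -> cutoff e x <= 1.
Proof. by move=> e0; rewrite ler_pdivrMr ?den// mul1r lerDl sqr_ge0. Qed.

Let p_le e x : p x <= e -> m e x = 0.
Proof. by move=> pe; apply/max_idPr; rewrite subr_le0. Qed.

Let p_out x : ~ (a < x < b) -> p x <= 0.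
Proof.
rewrite /p => h; have [ax|ax] := leP x a; last first.
  have [xb|xb] := ltP x b; first by case: h; rewrite ax.
  by rewrite mulr_ge0_le0; lra.
by rewrite mulr_le0_ge0; have := ab; lra.
Qed.

Lemma cutoff_out e x : 0 < e -> ~ (a < x < b) -> cutoff e x = 0 /\ cutoff' e x = 0.
Proof.
move=> e0 /p_out h; have mz : m e x = 0 by apply: p_le; exact: le_trans h (ltW e0).
by rewrite /cutoff /cutoff' mz expr0n/= !mul0r mulr0 !mul0r.
Qed.

Let margin e := e / (b - a).

Lemma cutoff_margin e x : 0 < e -> ~ (a + margin e <= x <= b - margin e) -> cutoff e x = 0.
Proof.
move=> e0 h; rewrite /cutoff p_le ?expr0n/= ?mul0r//.
have [axb|/p_out/le_trans] := pselect (a < x < b); last by apply; exact: ltW.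
have ba : 0 < b - a by rewrite subr_gt0.
rewrite leNgt; apply/negP => pe; apply: h.
case/andP: axb => ax xb; rewrite /p in pe.
have h1 : margin e <= x - a.
  rewrite ler_pdivrMr//; apply: le_trans (ltW pe) _; rewrite ler_wpM2l//; lra.
have h2 : margin e <= b - x.
  by rewrite ler_pdivrMr//; apply: le_trans (ltW pe) _; rewrite mulrC ler_wpM2l//; lra.
apply/andP; split; lra.
Qed.

Lemma C1c_cutoff (e : R) (Y Y1 : R -> R) : 0 < e -> (forall x : R, is_derive x 1 Y (Y1 x)) ->
  continuous Y1 -> C1c `]a, b[ (fun x => Y x * cutoff e x) /\
  derive1 (fun x => Y x * cutoff e x) = (fun x => Y1 x * cutoff e x + Y x * cutoff' e x).
Proof.
move=> e0 dY cY1.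
have d (x : R) : is_derive x 1 (fun x => Y x * cutoff e x) (Y1 x * cutoff e x + Y x * cutoff' e x).
  by apply: D_mul => //; exact: D_cutoff.
have cont (F f : R -> R) : (forall x : R, is_derive x 1 F (f x)) -> continuous F.
  by move=> dF x; apply: differentiable_continuous; apply/derivable1_diffP; have [] := dF x.
split; last by apply/funext => x; rewrite derive1E; have [_] := d x.
have mp : 0 < margin e by rewrite divr_gt0// subr_gt0.
apply: (C1c_intro (c := a + margin e) (d := b - margin e) d).
- move=> x; apply: cvgD; apply: cvgM.
  + exact: cY1.
  + by apply: (cont _ (cutoff' e)) => y; exact: D_cutoff.
  + exact: cont dY x.
  + exact: cutoff'_continuous.
- by move=> x h; rewrite cutoff_margin// mulr0.
- move=> x; rewrite /= !in_itv/= => /andP[? ?]; apply/andP; split; lra.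
Qed.

Let p_in x : a < x < b -> 0 < p x.
Proof. by move=> /andP[ax xb]; rewrite mulr_gt0// subr_gt0. Qed.

Let m_lower e x : e <= p x / 2 -> p x / 2 <= m e x.
Proof. by move=> h; rewrite le_max; apply/orP; left; lra. Qed.

Lemma cutoff_near1 e x : 0 < e -> a < x < b -> e <= p x / 2 -> e <= 1 ->
  `|cutoff e x - 1| <= 4 / p x ^+ 2 * e.
Proof.
move=> e0 /p_in px ep e1; have ml := m_lower ep.
have D0 := den x e0.
have -> : cutoff e x - 1 = - (e ^+ 2 / (m e x ^+ 2 + e ^+ 2)).
  by rewrite /cutoff; field; rewrite gt_eqF.
rewrite normrN ger0_norm ?divr_ge0 ?sqr_ge0 ?(ltW D0)//.
rewrite ler_pdivrMr//.
have h1 : (p x / 2) ^+ 2 <= m e x ^+ 2 + e ^+ 2.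
  apply: (@le_trans _ _ (m e x ^+ 2)); last by rewrite lerDl sqr_ge0.
  by rewrite lerXn2r// nnegrE ?m0// divr_ge0// ltW.
apply: (@le_trans _ _ (4 / p x ^+ 2 * e * (p x / 2) ^+ 2)); last first.
  by rewrite ler_wpM2l// mulr_ge0 ?divr_ge0 ?sqr_ge0// ltW.
have -> : 4 / p x ^+ 2 * e * (p x / 2) ^+ 2 = e by field; rewrite gt_eqF.
by rewrite expr2 ler_piMl// ltW.
Qed.

Lemma cutoff'_near0 e x : 0 < e -> a < x < b -> e <= p x / 2 -> e <= 1 ->
  `|cutoff' e x| <= 16 * `|a + b - 2 * x| / p x ^+ 3 * e.
Proof.
move=> e0 /p_in px ep e1; have ml := m_lower ep.
have mp : 0 < m e x by apply: lt_le_trans ml; rewrite divr_gt0.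
have D0 := den x e0.
rewrite cutoff'E normrM.
have h := bump_small e0 e1 (_ : 0 < p x / 2) ml; rewrite (ger0_norm (bump_ge0 (m0 e x) e0)).
apply: (@le_trans _ _ (`|a + b - 2 * x| * (2 / (p x / 2) ^+ 3 * e))).
  by rewrite ler_wpM2l// h// divr_gt0.
by rewrite le_eqVlt; apply/orP; left; apply/eqP; field; rewrite gt_eqF.
Qed.

(** Near the ends the derivative of the cutoff is at most of the order of the
    inverse distance, uniformly in [e]; a factor vanishing at the ends therefore
    makes it dominated. *)
Lemma cutoff'_bounded e x : 0 < e -> a < x < b -> `|p x * cutoff' e x| <= 2 * `|a + b - 2 * x|.
Proof.
move=> e0 /p_in px; rewrite cutoff'E mulrCA normrM mulrC ler_wpM2r//.
have B0 : 0 <= 2 * m e x * e ^+ 2 / (m e x ^+ 2 + e ^+ 2) ^+ 2 by exact: bump_ge0.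
rewrite ger0_norm; last by rewrite mulr_ge0// ltW.
have [pe|pe] := leP (p x) e; first by rewrite p_le// mulr0 !mul0r mulr0.
have pE : p x = m e x + e by rewrite /m (max_idPl _) ?subrK// subr_ge0 ltW.
rewrite pE; apply: bump_bounded => //; exact: m0.
Qed.

End Cutoff.

(** * Weak derivatives and density of test functions *)

Section Sobolev.
Context {R : realType}.
Local Notation mu := (@lebesgue_measure R).
Implicit Types f g h v phi psi : R -> R.

Lemma cvg_of_rate (u : nat -> R) (l C r : R) : 0 < r ->
  (forall n : nat, n.+1%:R^-1 <= r -> `|u n - l| <= C * n.+1%:R^-1) -> u n @[n --> \oo] --> l.
Proof.
move=> r0 H; apply/cvgrPdist_le => e e0.
have C1 : 0 < `|C| + 1 by rewrite ltr_wpDl.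
have s0 : 0 < Num.min r (e / (`|C| + 1)) by rewrite lt_min r0 divr_gt0.
near=> n.
have : n.+1%:R^-1 < Num.min r (e / (`|C| + 1)).
  by near: n; exact: (near_infty_natSinv_lt (PosNum s0)).
rewrite lt_min => /andP[/ltW nr ne]; rewrite distrC; apply: le_trans (H n nr) _.
have n0 : (0 : R) <= n.+1%:R^-1 by rewrite invr_ge0.
apply: (@le_trans _ _ ((`|C| + 1) * n.+1%:R^-1)).
  by rewrite ler_wpM2r//; have := ler_norm C; lra.
by rewrite mulrC -ler_pdivlMr// ltW.
Unshelve. all: by end_near. Qed.

Lemma cvg_cst_eq0 (c : R) : (fun=> c) @ \oo --> (0 : R) -> c = 0.
Proof. by move=> h; rewrite -(cvg_lim (@Rhausdorff R) h) lim_cst. Qed.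

Let en (n : nat) : R := n.+1%:R^-1.
Let en0 n : 0 < en n. Proof. by rewrite invr_gt0. Qed.
Let en1 n : en n <= 1. Proof. by rewrite invf_le1// ler1n. Qed.

Lemma cutoff_cvg1 (a b x : R) : a < x < b -> cutoff a b (en n) x @[n --> \oo] --> (1 : R).
Proof.
move=> xab; pose p := (x - a) * (b - x).
have p0 : 0 < p by case/andP: xab => ? ?; rewrite mulr_gt0// subr_gt0.
have ab : a < b by have /andP[h1 h2] := xab; exact: lt_trans h1 h2.
apply: (@cvg_of_rate _ _ (4 / p ^+ 2) (p / 2)) => [|n np]; first by rewrite divr_gt0.
by apply: cutoff_near1 => //; exact: en1.
Qed.

Lemma cutoff'_cvg0 (a b x : R) : a < x < b -> cutoff' a b (en n) x @[n --> \oo] --> (0 : R).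
Proof.
move=> xab; pose p := (x - a) * (b - x).
have p0 : 0 < p by case/andP: xab => ? ?; rewrite mulr_gt0// subr_gt0.
apply: (@cvg_of_rate _ _ (16 * `|a + b - 2 * x| / p ^+ 3) (p / 2)) => [|n np]; first by rewrite divr_gt0.
by rewrite subr0; apply: cutoff'_near0 => //; exact: en1.
Qed.

Lemma cutoff_C1c (a b e : R) : a < b -> 0 < e -> C1c `]a, b[ (cutoff a b e).
Proof.
move=> ab e0; have [] := @C1c_cutoff R a b ab e (fun=> 1) (fun=> 0) e0.
- by move=> x; exact: cvg_cst.
by move=> + _; rewrite (_ : (fun x => 1 * _) = cutoff a b e)//; apply/funext => x; rewrite mul1r.
Qed.

(** The cutoffs of an interval are test functions that tend to its indicator, so
    the integrals over intervals vanish. *)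
Lemma ae_eq0_test g : L2 g -> (forall phi, C1c setT phi -> ip g phi = 0) ->
  {ae mu, forall x, g x = 0}.
Proof.
move=> hg g0; apply: ae_eq0_itv => // c d cd.
pose ci := \1_(`]c, d[%classic) : R -> R.
have hci : L2 ci.
  apply: (@L2_bounded _ 1 c d).
  - exact: measurable_indic.
  - by move=> x; rewrite /ci indicE; case: (_ \in _); rewrite ?normr1 ?normr0.
  - move=> x xA; rewrite /ci indicE memNset//= in_itv/= => /andP[? ?]; apply: xA.
    by rewrite !ltW.
have hcut n : C1c `]c, d[ (cutoff c d (en n)) by exact: cutoff_C1c.
have hc n := (C1c_L2 (hcut n)).1.
have lim0 : ip g (fun x => ci x - cutoff c d (en n) x) @[n --> \oo] --> (0 : R).
  apply: ip_cvg0 => //; first by move=> n; exact: L2B.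
  apply: (@ip_dominated _ _ 1 c d).
  - by move=> n; apply: L2_measurable; exact: L2B.
  - move=> n x; have := cutoff_ge0 c d x (en0 n); have := cutoff_le1 c d x (en0 n).
    rewrite /ci indicE; case: (_ \in _) => /= ? ?; apply/ler_normlP; split; lra.
  - move=> n x xA; have nA : ~ (c < x < d) by move=> /andP[? ?]; apply: xA; rewrite !ltW.
    by have [-> _] := cutoff_out cd (en0 n) nA; rewrite /ci indicE memNset ?subrr//= in_itv.
  - apply: aeW => x; have [xA|xA] := pselect (c < x < d).
      rewrite /ci indicE mem_set/=; last by rewrite in_itv.
      by rewrite -[X in _ --> X](subrr (1 : R)); apply: cvgB; [exact: cvg_cst|exact: cutoff_cvg1].
    rewrite (_ : (fun _ => _) = (fun=> 0)); first exact: cvg_cst.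
    apply/funext => n; have [-> _] := cutoff_out cd (en0 n) xA.
    by rewrite /ci indicE memNset ?subrr//= in_itv.
have : ip g ci @[n --> \oo] --> (0 : R).
  move: lim0; apply: cvg_trans; rewrite (_ : (fun _ => _) = (fun=> ip g ci)) //.
  apply/funext => n; rewrite ipBr// [X in _ - X](_ : _ = 0) ?subr0//.
  by apply: g0; exact: C1c_subset (hcut n).
move=> /cvg_cst_eq0 E.
pose cc := \1_(`[c, d]%classic) : R -> R.
have hcc : L2 cc.
  have c1 : continuous ((fun=> 1) : R -> R) by move=> x; exact: cvg_cst.
  have := L2_continuous_box c d c1.
  by rewrite (_ : (fun x => 1 * _) = cc)//; apply/funext => x; rewrite mul1r.
have E2 : ip cc g = ip ci g.
  apply: ip_ae => //; apply: (@negligibleS _ _ _ mu ([set c] `|` [set d])).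
    move=> x /= nE; apply: contrapT => nx; apply: nE.
    rewrite /cc /ci !indicE; congr (_ : bool)%:R.
    apply/idP/idP; rewrite !inE/= !in_itv/= => /andP[h1 h2]; last by rewrite !ltW.
    rewrite !lt_neqAle h1 h2 !andbT; apply/andP; split; apply/eqP => e; apply: nx; [left|right].
    - by rewrite e.
    - by rewrite e.
  by apply: negligibleU; apply/negligibleP => //; exact: lebesgue_measure_set1.
rewrite -E ipC -E2 ipC /ip Rintegral_mkcond; apply: eq_Rintegral => x _.
by rewrite patchE /cc indicE; case: (_ \in _); rewrite ?mulr1 ?mulr0.
Qed.

Lemma wderiv_spec v : H1 v -> L2 (wderiv v) /\ weak_derivative v (wderiv v).
Proof.
move=> [_ [g gP]]; rewrite /wderiv.
by case: xgetP => [h -> //|/(_ g)].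
Qed.

Lemma weak_derivative_unique v g h : L2 g -> L2 h -> weak_derivative v g ->
  weak_derivative v h -> {ae mu, forall x, g x = h x}.
Proof.
move=> hg hh wg wh.
have : {ae mu, forall x, g x - h x = 0}.
  apply: ae_eq0_test; first exact: L2B.
  move=> phi Hp; rewrite ipBl//; last exact: (C1c_L2 Hp).1.
  have := wg phi Hp; rewrite (wh phi Hp) => /oppr_inj.
  by rewrite -/(ip h phi) -/(ip g phi) => ->; rewrite subrr.
apply: filterS; first exact: (ae_filter_ringOfSetsType mu).
by move=> x /subr0_eq.
Qed.

Lemma wderiv_ae v g : L2 v -> L2 g -> weak_derivative v g ->
  [/\ H1 v, L2 (wderiv v) & {ae mu, forall x, wderiv v x = g x}].
Proof.
move=> hv hg wg; have H : H1 v by split=> //; exists g.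
have [h1 h2] := wderiv_spec H; split=> //.
exact: (weak_derivative_unique h1 hg h2 wg).
Qed.

Lemma weak_derivativeB v g f h : L2 v -> L2 g -> L2 f -> L2 h ->
  weak_derivative v g -> weak_derivative f h ->
  weak_derivative (fun x => v x - f x) (fun x => g x - h x).
Proof.
move=> hv hg hf hh wv wf phi Hp; have [lp ldp] := C1c_L2 Hp.
rewrite -/(ip (fun x => v x - f x) (derive1 phi)) -/(ip (fun x => g x - h x) phi).
rewrite !ipBl// /ip (wv phi Hp) (wf phi Hp); ring.
Qed.

Lemma weak_derivativeD v g f h : L2 v -> L2 g -> L2 f -> L2 h ->
  weak_derivative v g -> weak_derivative f h ->
  weak_derivative (fun x => v x + f x) (fun x => g x + h x).
Proof.
move=> hv hg hf hh wv wf phi Hp; have [lp ldp] := C1c_L2 Hp.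
rewrite -/(ip (fun x => v x + f x) (derive1 phi)) -/(ip (fun x => g x + h x) phi).
rewrite !ipDl// /ip (wv phi Hp) (wf phi Hp); ring.
Qed.

Lemma weak_derivativeZ (c : R) v g : L2 v -> L2 g ->
  weak_derivative v g -> weak_derivative (fun x => c * v x) (fun x => c * g x).
Proof.
move=> hv hg wv phi Hp; have [lp ldp] := C1c_L2 Hp.
rewrite -/(ip (fun x => c * v x) (derive1 phi)) -/(ip (fun x => c * g x) phi).
rewrite !ipZl// /ip (wv phi Hp); ring.
Qed.

Lemma H1norm_sqr v g : L2 v -> L2 g -> weak_derivative v g ->
  H1norm v = Num.sqrt (ip v v + ip g g).
Proof.
move=> hv hg wg; have [_ hw wE] := wderiv_ae hv hg wg.
rewrite /H1norm; congr (Num.sqrt (_ + _)).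
rewrite -(ip_ae hw hg hg wE) ipC -(ip_ae hw hg hw wE).
by apply: eq_Rintegral => x _; rewrite expr2.
Qed.

Lemma cvg0_sqr (u w : nat -> R) : (forall n, 0 <= u n) -> (forall n, 0 <= w n) ->
  (Num.sqrt (u n + w n) @[n --> \oo] --> (0 : R)) <->
  (u n @[n --> \oo] --> (0 : R) /\ w n @[n --> \oo] --> (0 : R)).
Proof.
move=> u0 w0; split.
- move=> H; have H2 : u n + w n @[n --> \oo] --> (0 : R).
    rewrite (_ : (fun n => u n + w n) = (fun n => Num.sqrt (u n + w n) * Num.sqrt (u n + w n))).
      by rewrite -(mul0r 0); exact: (cvgM H H).
    by apply/funext => n; rewrite -expr2 sqr_sqrtr// addr_ge0.
  split; apply: (squeeze_cvgr _ (cvg_cst 0) H2); apply: nearW => n.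
  + by rewrite u0 lerDl w0.
  + by rewrite w0 lerDr u0.
- move=> [hu hw].
  have H : u n + w n @[n --> \oo] --> (0 : R) by rewrite -(addr0 0); apply: cvgD.
  have S : Num.sqrt x @[x --> (0 : R)] --> Num.sqrt (0 : R) by exact: sqrt_continuous.
  by rewrite sqrtr0 in S; exact: (cvg_comp _ _ H S).
Qed.

Lemma H10_approx (a b : R) v : H10 a b v -> exists phi : nat -> R -> R,
  [/\ forall n, C1c `]a, b[ (phi n),
      ip (fun x => phi n x - v x) (fun x => phi n x - v x) @[n --> \oo] --> (0 : R) &
      ip (fun x => derive1 (phi n) x - wderiv v x)
         (fun x => derive1 (phi n) x - wderiv v x) @[n --> \oo] --> (0 : R)].
Proof.
move=> [cv v0 H [phi [Hp lim]]]; exists phi.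
have [hw ww] := wderiv_spec H; have hv := H.1.
suff [] : ip (fun x => phi n x - v x) (fun x => phi n x - v x) @[n --> \oo] --> (0 : R) /\
      ip (fun x => derive1 (phi n) x - wderiv v x)
         (fun x => derive1 (phi n) x - wderiv v x) @[n --> \oo] --> (0 : R) by [].
apply/cvg0_sqr => [n|n|]; [exact: ip_ge0|exact: ip_ge0|].
move: lim; apply: cvg_trans; rewrite (_ : (fun _ => _) = (fun n => H1norm (fun x => phi n x - v x)))//.
apply/funext => n; have [lp ldp] := C1c_L2 (Hp n).
by rewrite (@H1norm_sqr _ (fun x => derive1 (phi n) x - wderiv v x))//; [exact: L2B|exact: L2B|apply: weak_derivativeB => //; exact: C1c_weak (Hp n)].
Qed.

(** The chosen weak derivative agrees almost everywhere with any other one, so a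
    convenient one may be used in the norm. *)
Lemma H10_intro (a b : R) v g (phi : nat -> R -> R) : continuous v ->
  (forall x, ~ `]a, b[%classic x -> v x = 0) -> L2 v -> L2 g -> weak_derivative v g ->
  (forall n, C1c `]a, b[ (phi n)) ->
  ip (fun x => phi n x - v x) (fun x => phi n x - v x) @[n --> \oo] --> (0 : R) ->
  ip (fun x => derive1 (phi n) x - g x) (fun x => derive1 (phi n) x - g x) @[n --> \oo] --> (0 : R) ->
  H10 a b v.
Proof.
move=> cv v0 hv hg wg Hp l1 l2; split=> //; first by split=> //; exists g.
exists phi; split=> //.
have : Num.sqrt (ip (fun x => phi n x - v x) (fun x => phi n x - v x) +
    ip (fun x => derive1 (phi n) x - g x) (fun x => derive1 (phi n) x - g x)) @[n --> \oo] --> (0 : R).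
  by apply/cvg0_sqr => //[n|n]; exact: ip_ge0.
apply: cvg_trans; rewrite (_ : (fun _ => _) = (fun n => H1norm (fun x => phi n x - v x)))//.
apply/funext => n; have [lp ldp] := C1c_L2 (Hp n).
by rewrite (@H1norm_sqr _ (fun x => derive1 (phi n) x - g x))//; [exact: L2B|exact: L2B|apply: weak_derivativeB => //; exact: C1c_weak (Hp n)].
Qed.

(** The functional is continuous in the pair (derivative, function), and [H10] is
    the closure of the test functions for the norm of that pair. *)
Lemma H10_density (a b : R) (A B : R -> R) v : L2 A -> L2 B -> H10 a b v ->
  (forall phi, C1c `]a, b[ phi -> ip A (derive1 phi) + ip B phi = 0) ->
  ip A (wderiv v) + ip B v = 0.
Proof.
move=> hA hB Hv H0; have [phi [Hp l1 l2]] := H10_approx Hv.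
have [_ _ H _] := Hv; have [hw _] := wderiv_spec H; have hv := H.1.
have lp n := (C1c_L2 (Hp n)).1; have ldp n := (C1c_L2 (Hp n)).2.
have c1 := ip_cvg0 hB (fun n => L2B (lp n) hv) l1.
have c2 := ip_cvg0 hA (fun n => L2B (ldp n) hw) l2.
pose u n := ip A (fun x => derive1 (phi n) x - wderiv v x) + ip B (fun x => phi n x - v x).
have cu : u n @[n --> \oo] --> (0 : R) by rewrite -(addr0 0); apply: cvgD.
have uE : u = (fun=> - (ip A (wderiv v) + ip B v)).
  apply/funext => n; rewrite /u ipBr// ipBr//.
  have := H0 _ (Hp n); lra.
have : - (ip A (wderiv v) + ip B v) = 0.
  by apply: cvg_cst_eq0; rewrite uE in cu.
lra.
Qed.

End Sobolev.

(** * The constrained minimizer on a given interval *)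

Section Perturbations.
Context {R : realType}.
Local Notation mu := (@lebesgue_measure R).
Implicit Types f g u v phi psi : R -> R.

Lemma ip0l f : ip (fun=> 0) f = 0.
Proof.
rewrite /ip /Rintegral (_ : integral _ _ _ = 0%E)//; under eq_integral do rewrite mul0r.
exact: integral0.
Qed.

Lemma ip_sub_sqr (f g : R -> R) : L2 f -> L2 g ->
  ip (fun x => f x - g x) (fun x => f x - g x) = ip f f - 2 * ip f g + ip g g.
Proof.
move=> hf hg; rewrite ipBl ?ipBr//; [|exact: L2B..].
rewrite (ipC g f); ring.
Qed.

Lemma C1c_combine (I : set R) (t : R) phi psi : C1c I phi -> C1c I psi ->
  C1c I (fun x => phi x + t * psi x) /\
  derive1 (fun x => phi x + t * psi x) = (fun x => derive1 phi x + t * derive1 psi x).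
Proof.
move=> H1 H2.
have d (x : R) : is_derive x 1 (fun x => phi x + t * psi x) (derive1 phi x + t * derive1 psi x).
  by apply: D_add; [exact: C1c_derive H1|apply: D_scale; exact: C1c_derive H2].
have dE : derive1 (fun x => phi x + t * psi x) = (fun x => derive1 phi x + t * derive1 psi x).
  by apply/funext => x; rewrite derive1E; have [_] := d x.
have [_ c1 k1 i1] := H1; have [_ c2 k2 i2] := H2.
have sub : closure [set x | phi x + t * psi x != 0] `<=`
    closure [set x | phi x != 0] `|` closure [set x | psi x != 0].
  rewrite -closureU; apply: closureS => x /= h.
  have [px|px] := eqVneq (phi x) 0; last by left.
  have [qx|qx] := eqVneq (psi x) 0; last by right.
  by move: h; rewrite px qx mulr0 addr0 eqxx.
split; last exact: dE.
split.
- by move=> x; have [] := d x.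
- rewrite dE => x; apply: cvgD; first exact: c1.
  by apply: cvgM; [exact: cvg_cst|exact: c2].
- apply: (subclosed_compact _ _ sub); first exact: closed_closure.
  exact: compactU.
- by move=> x /sub[/i1|/i2].
Qed.

Lemma H10_add_test (a b t : R) u phi : H10 a b u -> C1c `]a, b[ phi ->
  H10 a b (fun x => u x + t * phi x) /\
  {ae mu, forall x, wderiv (fun x => u x + t * phi x) x = wderiv u x + t * derive1 phi x}.
Proof.
move=> Hu Hp; have [cu u0 H _] := Hu; have [hw ww] := wderiv_spec H; have hu := H.1.
have [lp ldp] := C1c_L2 Hp.
have L : L2 (fun x => u x + t * phi x) by apply: L2D => //; exact: L2Z.
have Lw : L2 (fun x => wderiv u x + t * derive1 phi x) by apply: L2D => //; exact: L2Z.
have W : weak_derivative (fun x => u x + t * phi x) (fun x => wderiv u x + t * derive1 phi x).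
  apply: weak_derivativeD => //; [exact: L2Z|exact: L2Z|].
  by apply: weak_derivativeZ => //; exact: C1c_weak Hp.
split; last by have [] := wderiv_ae L Lw W.
have [f [Hf f1 f2]] := H10_approx Hu.
have Hc n := C1c_combine t (Hf n) Hp.
apply: (@H10_intro _ _ _ _ _ (fun n x => f n x + t * phi x)) W _ _ _ => //.
- move=> x; apply: cvgD; first exact: cu.
  by apply: cvgM; [exact: cvg_cst|exact: (C1c_continuous Hp)].
- by move=> x h; rewrite u0// (C1c_out Hp h) mulr0 addr0.
- by move=> n; have [] := Hc n.
- move: f1; apply: cvg_trans; rewrite (_ : (fun n => _) = (fun n => ip (fun x => f n x - u x) (fun x => f n x - u x)))//.
  by apply/funext => n; congr ip; apply/funext => x; ring.
- move: f2; apply: cvg_trans; rewrite (_ : (fun n => _) = (fun n => ip (fun x => derive1 (f n) x - wderiv u x) (fun x => derive1 (f n) x - wderiv u x)))//.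
  by apply/funext => n; have [_ ->] := Hc n; congr ip; apply/funext => x; ring.
Qed.

(** On the compact support of the test function [u] has a positive minimum. *)
Lemma positive_perturbation (a b : R) u phi : continuous u -> (forall x, 0 <= u x) ->
  (forall x, a < x < b -> 0 < u x) -> C1c `]a, b[ phi ->
  exists2 t0, 0 < t0 & forall t x, `|t| <= t0 -> 0 <= u x + t * phi x.
Proof.
move=> cu u0 up Hp; have [_ _ cpt sub] := Hp; have cp := C1c_continuous Hp.
set S := closure _ in cpt sub.
have [S0|/set0P S0] := eqVneq S set0.
  exists 1 => // t x _; have -> : phi x = 0; last by rewrite mulr0 addr0.
  by apply: contrapT => /eqP px; have : S x by [exact: subset_closure]; rewrite S0.
have [y Sy ymin] := compact_EVT_min S0 cpt (continuous_subspaceT cu).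
have [N N0 HN] := C1c_support Hp.
have [M M0 HM] := continuous_bounded_itv (- N) N cp.
have uy : 0 < u y by apply: up; have := sub _ (set_mem Sy); rewrite /= in_itv.
have M1 : 0 < M + 1 by rewrite ltr_wpDl.
exists (u y / (M + 1)); first by rewrite divr_gt0.
move=> t x tt; have [px|px] := eqVneq (phi x) 0; first by rewrite px mulr0 addr0.
have Sx : S x by exact: subset_closure.
have pM : `|phi x| <= M + 1.
  have [h|/HN[h _]] := pselect (- N <= x <= N); first by apply: le_trans (HM _ h) _; rewrite lerDl.
  by rewrite h eqxx in px.
have ux : u y <= u x by apply: ymin; rewrite inE.
have : `|t * phi x| <= u y.
  rewrite normrM; apply: (@le_trans _ _ (u y / (M + 1) * (M + 1))); first exact: ler_pM.
  by rewrite divfK// gt_eqF.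
by move=> /ler_normlP[]; lra.
Qed.

Lemma quadratic_first_order (L q t0 : R) : 0 < t0 -> 0 <= q ->
  (forall t, `|t| <= t0 -> 0 <= t * L + t ^+ 2 * q) -> L = 0.
Proof.
move=> t00 q0 H; apply: contrapT => /eqP L0.
have q1 : 0 < q + 1 by rewrite ltr_wpDl.
have nL : 0 < `|L| by rewrite normr_gt0.
pose r := Num.min t0 (`|L| / (q + 1)).
have r0 : 0 < r by rewrite lt_min t00 divr_gt0.
have rt : r <= t0 by rewrite ge_min lexx.
have rL : r * (q + 1) <= `|L| by rewrite -ler_pdivlMr// ge_min lexx orbT.
have h1 := H r; have h2 := H (- r).
rewrite normrN in h2; rewrite (gtr0_norm r0) in h1 h2.
have {}h1 := h1 rt; have {}h2 := h2 rt.
have : r * `|L| <= r ^+ 2 * q.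
  by case: (ler0P L) => _; [have : - (r * L) <= r ^+ 2 * q by nra | nra]; nra.
have : r * (r * (q + 1)) <= r * `|L| by rewrite ler_wpM2l// ltW.
have : 0 < r * r by rewrite mulr_gt0.
rewrite expr2; nra.
Qed.

(** The bookkeeping of [box_argmin], one letter per scalar product: [A], [B], [C]
    for the derivatives of competitor and minimizer, [D], [E], [F] for the
    functions themselves, [G], [H] for the gravity terms, [K] for the volume. *)
Lemma energy_gap (c s K A B C D E F G H : R) :
  0 <= A - 2 * B + C -> 0 <= c * (D - 2 * E + F) ->
  B + c * E - s * G - K = 0 -> C + c * F - s * H - K = 0 ->
  2^-1 * C + c / 2 * F - s * H <= 2^-1 * A + c / 2 * D - s * G.
Proof. lra. Qed.

(** The bookkeeping of [argmin_unique], with the letters of [energy_gap]: the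
    first two equations are that of the minimizer tested with itself and with
    the profile, the last two that of the profile. The multipliers [m] and [lam]
    cancel. *)
Lemma convex_gap (c s m lam V A B C D E F G H : R) :
  0 <= A - 2 * B + C -> A + (c * D - s * G - m * V) = 0 -> B + (c * E - s * H - m * V) = 0 ->
  B + c * E - s * G - lam * V = 0 -> C + c * F - s * H - lam * V = 0 ->
  c * (D - 2 * E + F) <= 0.
Proof. lra. Qed.

End Perturbations.

Section Profile.
Context {R : realType}.
Local Notation mu := (@lebesgue_measure R).
Variables (c s a b lam : R) (Y Y1 Y2 : R -> R).
Hypothesis ab : a < b.
Hypothesis c0 : 0 < c.
Hypothesis dY : forall x : R, is_derive x 1 Y (Y1 x).
Hypothesis dY1 : forall x : R, is_derive x 1 Y1 (Y2 x).
Hypothesis cY2 : continuous Y2.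
Hypothesis Ya : Y a = 0.
Hypothesis Yb : Y b = 0.
Hypothesis ode : forall x, - Y2 x + c * Y x - s * x = lam.

Definition box (f : R -> R) (x : R) : R := f x * \1_(`[a, b]%classic) x.

Lemma box_in f x : a <= x <= b -> box f x = f x.
Proof. by move=> h; rewrite /box indicE mem_set ?mulr1//= in_itv. Qed.

Lemma box_out f x : ~ (a <= x <= b) -> box f x = 0.
Proof. by move=> h; rewrite /box indicE memNset ?mulr0//= in_itv. Qed.

Let der_cont (F f : R -> R) : (forall x : R, is_derive x 1 F (f x)) -> continuous F.
Proof. by move=> dF x; apply: differentiable_continuous; apply/derivable1_diffP; have [] := dF x. Qed.

Let cY : continuous Y. Proof. exact: der_cont dY. Qed.
Let cY1 : continuous Y1. Proof. exact: der_cont dY1. Qed.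

Lemma box_L2 f : continuous f -> L2 (box f).
Proof. exact: L2_continuous_box. Qed.

Lemma box_continuous : continuous (box Y).
Proof.
have -> : box Y = Y \o (fun x => Num.max (Num.min x b) a).
  apply/funext => x /=; have [h|h] := pselect (a <= x <= b).
    by rewrite box_in//; case/andP: h => ax xb; rewrite (min_idPl xb) (max_idPl ax).
  rewrite box_out//; case: (leP x b) => bx; last by rewrite (max_idPl (ltW ab)) Yb.
  case: (leP x a) => ax; first by rewrite Ya.
  by case: h; rewrite bx ltW.
move=> x; apply: continuous_comp; last exact: cY.
apply: (@lipschitz_fun_continuous _ _ 1) => y z; rewrite mul1r.
by apply: le_trans (ler_dist_max _ _ _) _; exact: ler_dist_min.
Qed.

Lemma box_weak : weak_derivative (box Y) (box Y1).
Proof.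
move=> psi Hp; apply: parts_box => //.
- by rewrite Ya mul0r.
- by rewrite Yb mul0r.
Qed.

(** The two boundary values give the decay that balances the blow-up of the
    derivative of the cutoff. *)
Lemma boundary_decay (M x : R) : (forall y, a <= y <= b -> `|Y1 y| <= M) -> a <= x <= b ->
  `|Y x| <= 2 * M / (b - a) * ((x - a) * (b - x)).
Proof.
move=> HM /andP[ax xb].
have lip (y z : R) : a <= y -> y <= z -> z <= b -> `|Y z - Y y| <= M * (z - y).
  move=> ay yz zb; move: yz; rewrite le_eqVlt => /predU1P[->|yz].
    by rewrite !subrr normr0 mulr0.
  have [|d dyz ->] := @MVT _ Y Y1 y z yz (fun x _ => dY x).
    exact: continuous_subspaceT.
  rewrite normrM (ger0_norm (_ : 0 <= z - y)) ?subr_ge0 ?(ltW yz)//.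
  rewrite ler_wpM2r ?subr_ge0 ?(ltW yz)// HM//.
  by move: dyz; rewrite in_itv/= => /andP[d1 d2]; apply/andP; split; lra.
have h1 := lip a x (lexx a) ax xb; have h2 := lip x b ax xb (lexx b).
rewrite Ya subr0 in h1; rewrite Yb sub0r normrN in h2.
have ba : 0 < b - a by rewrite subr_gt0.
rewrite mulrAC ler_pdivlMr//.
have k1 : `|Y x| * (b - x) <= M * (x - a) * (b - x) by rewrite ler_wpM2r// subr_ge0.
have k2 : `|Y x| * (x - a) <= M * (b - x) * (x - a) by rewrite ler_wpM2r// subr_ge0.
lra.
Qed.

Let en (n : nat) : R := n.+1%:R^-1.
Let en0 n : 0 < en n. Proof. by rewrite invr_gt0. Qed.

(** The products of [Y] with the cutoffs converge in H^1 by dominated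
    convergence, [boundary_decay] supplying the bound for the derivative. *)
Lemma box_H10 : H10 a b (box Y).
Proof.
have [M M0 HM] := continuous_bounded_itv a b cY.
have [M1 M10 HM1] := continuous_bounded_itv a b cY1.
pose phi n x := Y x * cutoff a b (en n) x.
have hphi n := C1c_cutoff ab (en0 n) dY cY1.
have hC n : C1c `]a, b[ (phi n) by have [] := hphi n.
have hd n : derive1 (phi n) = (fun x => Y1 x * cutoff a b (en n) x + Y x * cutoff' a b (en n) x).
  by have [] := hphi n.
have lU := box_L2 cY; have lU1 := box_L2 cY1.
have interior x : ~ (a <= x <= b) -> ~ (a < x < b).
  by move=> h /andP[? ?]; apply: h; rewrite !ltW.
have cutb n x := (cutoff_ge0 a b x (en0 n), cutoff_le1 a b x (en0 n)).
have ae_in (P : R -> Prop) : (forall x, a < x < b -> P x) -> (forall x, ~ (a <= x <= b) -> P x) ->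
    {ae mu, forall x, P x}.
  move=> h1 h2; have := ae_neq b; have := ae_neq a; apply: filterS2; first exact: (ae_filter_ringOfSetsType mu).
  move=> x xa xb; have [xab|/h2//] := pselect (a <= x <= b).
  by apply: h1; rewrite !lt_neqAle xb eq_sym xa.
apply: (@H10_intro _ _ _ _ (box Y1) phi) => //.
- exact: box_continuous.
- move=> x; rewrite /= in_itv/= => h; have [h'|] := pselect (a <= x <= b); last exact: box_out.
  rewrite box_in//; case/andP: h' => ax xb.
  have [->//|xa] := eqVneq x a; have [->//|xb'] := eqVneq x b.
  by case: h; rewrite !lt_neqAle xb' eq_sym xa ax.
- exact: box_weak.
- apply: (@ip_dominated _ _ M a b).
  + by move=> n; apply: L2_measurable; apply: L2B => //; exact: (C1c_L2 (hC n)).1.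
  + move=> n x; have [h|h] := pselect (a <= x <= b); last first.
      by rewrite box_out// /phi (cutoff_out ab (en0 n) (interior _ h)).1 mulr0 subr0 normr0.
    rewrite box_in// /phi -{2}(mulr1 (Y x)) -mulrBr normrM.
    rewrite -[M]mulr1 ler_pM//; first exact: HM.
    by have [h1 h2] := cutb n x; apply/ler_normlP; split; lra.
  + by move=> n x h; rewrite box_out// /phi (cutoff_out ab (en0 n) (interior _ h)).1 mulr0 subr0.
  + apply: ae_in => x h.
    * rewrite box_in; last by case/andP: h => ? ?; rewrite !ltW.
      rewrite -[X in _ --> X](subrr (Y x)); apply: cvgB; last exact: cvg_cst.
      rewrite -[X in _ --> X]mulr1; apply: cvgM; first exact: cvg_cst.
      exact: cutoff_cvg1.
    * rewrite (_ : (fun _ => _) = (fun=> 0)); first exact: cvg_cst.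
      by apply/funext => n; rewrite box_out// /phi (cutoff_out ab (en0 n) (interior _ h)).1 mulr0 subr0.
- apply: (@ip_dominated _ _ (M1 + 4 * M1) a b).
  + by move=> n; apply: L2_measurable; apply: L2B => //; exact: (C1c_L2 (hC n)).2.
  + move=> n x; have [h|h] := pselect (a <= x <= b); last first.
      rewrite box_out// hd; have [-> ->] := cutoff_out ab (en0 n) (interior _ h).
      by rewrite !mulr0 addr0 subr0 normr0 addr_ge0// mulr_ge0.
    rewrite box_in// hd (_ : _ - _ = Y1 x * (cutoff a b (en n) x - 1) + Y x * cutoff' a b (en n) x); last ring.
    apply: le_trans (ler_normD _ _) _; apply: lerD.
      rewrite normrM -[M1]mulr1 ler_pM//; first exact: HM1.
      by have [h1 h2] := cutb n x; apply/ler_normlP; split; lra.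
    have [xab|xab] := pselect (a < x < b); last first.
      by rewrite (cutoff_out ab (en0 n) xab).2 mulr0 normr0 mulr_ge0.
    have bd := boundary_decay HM1 h; have cb := cutoff'_bounded (en0 n) xab.
    have ba : 0 < b - a by rewrite subr_gt0.
    have pp : 0 <= (x - a) * (b - x) by case/andP: h => ? ?; rewrite mulr_ge0// subr_ge0.
    rewrite normrM (ger0_norm pp) in cb.
    have wid : `|a + b - 2 * x| <= b - a.
      by case/andP: h => ? ?; apply/ler_normlP; split; lra.
    rewrite normrM; apply: (@le_trans _ _ (2 * M1 / (b - a) * ((x - a) * (b - x)) * `|cutoff' a b (en n) x|)).
      by rewrite ler_wpM2r.
    rewrite -mulrA; apply: (@le_trans _ _ (2 * M1 / (b - a) * (2 * (b - a)))).
      rewrite ler_wpM2l//; last by apply: le_trans cb _; rewrite ler_wpM2l.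
      by rewrite divr_ge0 ?mulr_ge0// ltW.
    rewrite le_eqVlt; apply/orP; left; apply/eqP; field; exact: lt0r_neq0.
  + move=> n x h; rewrite box_out// hd; have [-> ->] := cutoff_out ab (en0 n) (interior _ h).
    by rewrite !mulr0 addr0 subr0.
  + apply: ae_in => x h.
    * rewrite box_in; last by case/andP: h => ? ?; rewrite !ltW.
      rewrite (_ : (fun n => _) = (fun n => Y1 x * cutoff a b (en n) x + Y x * cutoff' a b (en n) x - Y1 x)); last by apply/funext => n; rewrite hd.
      rewrite -[X in _ --> X](subrr (Y1 x)); apply: cvgB; last exact: cvg_cst.
      rewrite -[X in _ --> X]addr0; apply: cvgD.
        rewrite -[X in _ --> X]mulr1; apply: cvgM; first exact: cvg_cst.
        exact: cutoff_cvg1.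
      rewrite -[X in _ --> X](mulr0 (Y x)); apply: cvgM; first exact: cvg_cst.
      exact: cutoff'_cvg0.
    * rewrite (_ : (fun _ => _) = (fun=> 0)); first exact: cvg_cst.
      apply/funext => n; rewrite box_out// hd; have [-> ->] := cutoff_out ab (en0 n) (interior _ h).
      by rewrite !mulr0 addr0 subr0.
Qed.


(** The equation holds against test functions by parts and extends by density;
    the second derivative is eliminated by the differential equation. *)
Lemma euler_lagrange v : H10 a b v ->
  ip (box Y1) (wderiv v) + c * ip (box Y) v - s * ip (box id) v - lam * ip (box (fun=> 1)) v = 0.
Proof.
move=> Hv; have [_ _ H _] := Hv; have [hw _] := wderiv_spec H; have hv := H.1.
have l2 := box_L2 cY2.
have := H10_density (box_L2 cY1) l2 Hv.
have -> : ip (box Y2) v = c * ip (box Y) v - s * ip (box id) v - lam * ip (box (fun=> 1)) v.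
  have lY := box_L2 cY; have lid : L2 (box id) by apply: box_L2 => x; exact: cvg_id.
  have l1 : L2 (box (fun=> 1)) by apply: box_L2 => x; exact: cvg_cst.
  rewrite -!ipZl// -ipBl; [|exact: L2Z..|by []].
  rewrite -ipBl; [|by apply: L2B; exact: L2Z|exact: L2Z|by []].
  congr ip; apply/funext => x; rewrite /box/= (_ : Y2 x = c * Y x - s * x - lam); last by have := ode x; lra.
  ring.
rewrite !addrA; apply => phi Hp.
have HpT : C1c setT phi by exact: C1c_subset Hp.
have out x : ~ (a < x < b) -> phi x = 0 by move=> h; apply: (C1c_out Hp); rewrite /= in_itv.
rewrite (@parts_box R Y1 Y2 phi a b) ?addNr//.
- by rewrite out ?mulr0// ltxx.
- by rewrite out ?mulr0// ltxx andbF.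
Qed.

Variables (V0 kappa alpha : R).
Hypothesis cE : c = kappa * cos alpha.
Hypothesis sE : s = kappa * sin alpha.

Let one := (fun=> 1) : R -> R.
Let l1 : L2 (box one). Proof. by apply: box_L2 => x; exact: cvg_cst. Qed.
Let lid : L2 (box id). Proof. by apply: box_L2 => x; exact: cvg_id. Qed.
Let lY : L2 (box Y). Proof. exact: box_L2. Qed.
Let lY1 : L2 (box Y1). Proof. exact: box_L2. Qed.

Lemma H10_out v x : H10 a b v -> ~ (a <= x <= b) -> v x = 0.
Proof.
move=> [_ v0 _ _] h; apply: v0; rewrite /= in_itv/= => /andP[ax xb]; apply: h.
by rewrite !ltW.
Qed.

Lemma energyE v : H10 a b v -> energy kappa alpha v =
  2^-1 * ip (wderiv v) (wderiv v) + c / 2 * ip v v - s * ip v (box id).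
Proof.
move=> Hv; have [_ v0 H _] := Hv; have [hw _] := wderiv_spec H; have hv := H.1.
have zl (r : R) f : L2 f -> L2 (fun x => r * f x) by exact: L2Z.
rewrite -!ipZl// /ip -RintegralD//; [|by apply: L2_mul_integrable => //; exact: L2Z..].
rewrite -RintegralB//; last 2 first.
- apply: (@eq_integrable _ _ _ mu setT measurableT (fun x => ((2^-1 * wderiv v x * wderiv v x)%:E + (c / 2 * v x * v x)%:E)%E)) => //.
  by apply: integrableD => //; apply: L2_mul_integrable => //; exact: L2Z.
- by apply: L2_mul_integrable => //; exact: L2Z.
apply: eq_Rintegral => x _; rewrite -cE -sE real_normK ?num_real//.
have -> : s * v x * box id x = s * v x * x.
  have [h|h] := pselect (a <= x <= b); first by rewrite box_in.
  by rewrite (H10_out Hv h) mulr0 !mul0r.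
by rewrite expr2; lra.
Qed.

Lemma volumeE v : H10 a b v -> (\int[mu]_(x in `]a, b[) v x)%R = ip (box one) v.
Proof.
move=> Hv; have [_ v0 _ _] := Hv.
rewrite Rintegral_mkcond; apply: eq_Rintegral => x _; rewrite patchE.
case: ifPn => [|/negP] h.
  rewrite box_in ?mul1r//; move: h; rewrite inE/= in_itv/= => /andP[? ?].
  by rewrite !ltW.
by rewrite v0 ?mulr0// => h'; apply: h; rewrite inE.
Qed.

Let HY := box_H10.
Let wY : [/\ H1 (box Y), L2 (wderiv (box Y)) & {ae mu, forall x, wderiv (box Y) x = box Y1 x}].
Proof. by apply: wderiv_ae => //; exact: box_weak. Qed.

Hypothesis volY : (\int[mu]_(x in `[a, b]) Y x)%R = V0.

Lemma volume_box : ip (box one) (box Y) = V0.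
Proof.
rewrite -volY /ip [RHS]Rintegral_mkcond; apply: eq_Rintegral => x _.
rewrite patchE /box indicE; case: (_ \in _); rewrite ?mulr1 ?mulr0 ?mul0r//.
by rewrite mul1r.
Qed.

(** Strict convexity: the Euler-Lagrange equation turns the energy gap into
    a sum of squares. *)
Lemma box_argmin : (forall x, 0 <= box Y x) -> is_argmin V0 kappa alpha a b (box Y).
Proof.
move=> Y0; split.
  by split=> //; rewrite volumeE// volume_box.
move=> v [Hv _ vV]; rewrite !energyE//.
have [_ _ H _] := Hv; have [hw _] := wderiv_spec H; have hv := H.1.
have [_ hwY aeY] := wY.
have e1 := euler_lagrange Hv; have e2 := euler_lagrange HY.
rewrite volumeE// in vV; rewrite vV in e1; rewrite volume_box in e2.
have q1 := ip_ge0 (fun x => wderiv v x - box Y1 x); rewrite ip_sub_sqr// in q1.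
have q2 := ip_ge0 (fun x => v x - box Y x); rewrite ip_sub_sqr// in q2.
have -> : ip (wderiv (box Y)) (wderiv (box Y)) = ip (box Y1) (box Y1).
  by rewrite (ip_ae hwY lY1 hwY aeY) ipC (ip_ae hwY lY1 lY1 aeY).
have e3 : ip (box Y1) (wderiv (box Y)) = ip (box Y1) (box Y1) by rewrite ipC (ip_ae hwY lY1 lY1 aeY).
rewrite e3 in e2; rewrite (ipC _ v) in e1; rewrite (ipC _ v) in e1.
rewrite (ipC (box id)) in e2; rewrite (ipC (box Y1)) in e1.
have q3 := mulr_ge0 (ltW c0) q2.
exact: energy_gap q1 q3 e1 e2.
Qed.

Variable u : R -> R.
Hypothesis Hu : is_argmin V0 kappa alpha a b u.
Hypothesis Hpos : [set x | 0 < u x] = `]a, b[%classic.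
Hypothesis V00 : 0 < V0.

Let L phi := ip (wderiv u) (derive1 phi) + c * ip u phi - s * ip (box id) phi.

Lemma first_variation phi : C1c `]a, b[ phi -> ip (box one) phi = 0 -> L phi = 0.
Proof.
move=> Hp Z; have [[Hu0 up uV] min] := Hu.
have [cu _ H _] := Hu0; have [hw _] := wderiv_spec H; have hu := H.1.
have [lp ldp] := C1c_L2 Hp.
have pos x : a < x < b -> 0 < u x.
  by move=> h; have : `]a, b[%classic x; [rewrite /= in_itv|rewrite -Hpos].
have [t0 t00 Ht] := positive_perturbation cu up pos Hp.
pose q := 2^-1 * ip (derive1 phi) (derive1 phi) + c / 2 * ip phi phi.
have q0 : 0 <= q.
  apply: addr_ge0; apply: mulr_ge0; rewrite ?ip_ge0 ?invr_ge0//.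
  by rewrite divr_ge0// ltW.
apply: (quadratic_first_order t00 q0) => t tt.
have [HH aeH] := H10_add_test t Hu0 Hp.
have : energy kappa alpha u <= energy kappa alpha (fun x => u x + t * phi x).
  apply: min; split=> //; first by move=> x; exact: Ht.
  by rewrite volumeE// ipDr ?ipZr//; [rewrite Z mulr0 addr0 -volumeE|exact: L2Z].
rewrite !energyE//.
have [_ _ H' _] := HH; have [hw' _] := wderiv_spec H'.
have L1 : L2 (fun x => wderiv u x + t * derive1 phi x) by apply: L2D => //; exact: L2Z.
have tp : L2 (fun x => t * phi x) by exact: L2Z.
have tdp : L2 (fun x => t * derive1 phi x) by exact: L2Z.
have -> : ip (wderiv (fun x => u x + t * phi x)) (wderiv (fun x => u x + t * phi x)) =
    ip (wderiv u) (wderiv u) + 2 * t * ip (wderiv u) (derive1 phi) + t ^+ 2 * ip (derive1 phi) (derive1 phi).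
  rewrite (ip_ae hw' L1 hw' aeH) ipC (ip_ae hw' L1 L1 aeH).
  rewrite ipDl// !ipDr// !ipZl// !ipZr// (ipC (derive1 phi) (wderiv u)); ring.
have -> : ip (fun x => u x + t * phi x) (fun x => u x + t * phi x) =
    ip u u + 2 * t * ip u phi + t ^+ 2 * ip phi phi.
  have lu : L2 (fun x => u x + t * phi x) by exact: L2D.
  rewrite ipDl// !ipDr// !ipZl// !ipZr// (ipC phi u); ring.
rewrite ipDl// ipZl// -subr_ge0 /L /q (ipC (box id) phi).
set A := ip _ _; set B := ip _ _; set C := ip _ _; set D := ip _ _; set E := ip _ _.
set F := ip _ _; set G := ip _ _; set K := ip _ _; move=> h.
apply: le_trans h _; rewrite le_eqVlt; apply/orP; left; apply/eqP; by field.
Qed.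

(** The minimizer satisfies the Euler-Lagrange equation of the profile with
    its own Lagrange multiplier; testing the difference of the two equations
    with the difference of the functions, the multipliers drop out since both
    functions have the same integral. *)
Lemma argmin_unique : u = box Y.
Proof.
have [[Hu0 up uV] min] := Hu.
have [cu _ H _] := Hu0; have [hw ww] := wderiv_spec H; have hu := H.1.
have z2 : L2 ((fun=> 0) : R -> R).
  by rewrite (_ : (fun=> 0) = (fun x => 0 * box one x)); [exact: L2Z|apply/funext => x; rewrite mul0r].
have [phi0 Hp0 n0] : exists2 phi0, C1c `]a, b[ phi0 & ip (box one) phi0 != 0.
  apply: contrapT => nex.
  have h phi : C1c `]a, b[ phi -> ip (fun=> 0) (derive1 phi) + ip (box one) phi = 0.
    move=> Hp; have [e|e] := eqVneq (ip (box one) phi) 0; last by case: nex; exists phi.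
    by rewrite e addr0 ip0l.
  have := H10_density z2 l1 Hu0 h.
  by rewrite -volumeE// uV ip0l add0r => e; move: V00; rewrite e ltxx.
pose m := L phi0 / ip (box one) phi0.
have lcu : L2 (fun x => c * u x) by exact: L2Z.
have lsid : L2 (fun x => s * box id x) by exact: L2Z.
have lm1 : L2 (fun x => m * box one x) by exact: L2Z.
have lcs := L2B lcu lsid.
have lB := L2B lcs lm1.
have BE f : L2 f -> ip (fun x => c * u x - s * box id x - m * box one x) f =
    c * ip u f - s * ip (box id) f - m * ip (box one) f.
  by move=> hf; rewrite ipBl// ipBl// (ipZl c hu hf) (ipZl s lid hf) (ipZl m l1 hf).
have EL phi : C1c `]a, b[ phi -> ip (wderiv u) (derive1 phi) +
    ip (fun x => c * u x - s * box id x - m * box one x) phi = 0.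
  move=> Hp; have [lp ldp] := C1c_L2 Hp; have [lp0 ldp0] := C1c_L2 Hp0.
  pose r := - (ip (box one) phi / ip (box one) phi0).
  have [Hr dr] := C1c_combine r Hp Hp0.
  have rl : L2 (fun x => r * phi0 x) by exact: L2Z.
  have rdl : L2 (fun x => r * derive1 phi0 x) by exact: L2Z.
  have := first_variation Hr; rewrite /L dr !ipDr// !ipZr// => h.
  have {}h := h (ltac:(by rewrite /r mulNr divfK// subrr)).
  rewrite BE//; apply: etrans h.
  have e : m * ip (box one) phi = - r * L phi0 by rewrite /m /r; field.
  rewrite e /L; move: (ip (wderiv u) (derive1 phi)) (ip u phi) (ip (box id) phi).
  clearbody r m; move: r dr Hr rl rdl e => /= r _ _ _ _ _.
  by move: (ip (wderiv u) (derive1 phi0)) (ip u phi0) (ip (box id) phi0) => *; ring.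
have h1 := H10_density hw lB Hu0 EL; have h2 := H10_density hw lB HY EL.
rewrite !BE// in h1 h2.
have k1 := euler_lagrange Hu0; have k2 := euler_lagrange HY.
have [_ hwY aeY] := wY.
rewrite -/one -(volumeE Hu0) uV in k1 h1; rewrite -/one volume_box in k2 h2.
have aeE f : L2 f -> ip f (wderiv (box Y)) = ip f (box Y1).
  by move=> hf; rewrite ipC (ip_ae hwY lY1 hf aeY) ipC.
rewrite !aeE// in h2 k2.
have q1 := ip_ge0 (fun x => wderiv u x - box Y1 x); rewrite ip_sub_sqr// in q1.
have q2 := ip_ge0 (fun x => u x - box Y x).
have e2 := ip_sub_sqr hu lY.
rewrite (ipC (box Y1) (wderiv u)) (ipC (box Y) u) in k1.
have z : ip (fun x => u x - box Y x) (fun x => u x - box Y x) = 0.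
  apply/eqP; rewrite eq_le q2 andbT -(pmulr_rle0 _ c0) e2.
  exact: (convex_gap q1 h1 h2 k1 k2).
have := continuous_ae_eq0 _ (ip_eq0 (L2B hu lY) z).
move=> h; apply/funext => x; apply/subr0_eq; apply: h.
by move=> y; apply: cvgB; [exact: cu|exact: box_continuous].
Qed.

End Profile.

(** * Hyperbolic functions *)

Section Hyperbolic.
Context {R : realType}.
Implicit Types x y z : R.

Definition sh z : R := (expR z - expR (- z)) / 2.
Definition ch z : R := (expR z + expR (- z)) / 2.

Lemma D_sh (g : R -> R) (t dg : R) : is_derive t 1 g dg ->
  is_derive t 1 (fun x => sh (g x)) (dg * ch (g t)).
Proof.
move=> h; have h1 := D_sub (D_expR h) (D_expR (D_opp h)).
have -> : (fun x => sh (g x)) = (fun x => 2^-1 * (expR (g x) - expR (- g x))).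
  by apply/funext => x; rewrite /sh mulrC.
by apply: D_ext (D_scale h1 _) _; rewrite /ch; field.
Qed.

Lemma D_ch (g : R -> R) (t dg : R) : is_derive t 1 g dg ->
  is_derive t 1 (fun x => ch (g x)) (dg * sh (g t)).
Proof.
move=> h; have h1 := D_add (D_expR h) (D_expR (D_opp h)).
have -> : (fun x => ch (g x)) = (fun x => 2^-1 * (expR (g x) + expR (- g x))).
  by apply/funext => x; rewrite /ch mulrC.
by apply: D_ext (D_scale h1 _) _; rewrite /sh; field.
Qed.

Lemma sh0 : sh 0 = 0. Proof. by rewrite /sh oppr0 subrr mul0r. Qed.
Lemma ch0 : ch 0 = 1. Proof. by rewrite /ch oppr0 expR0; field. Qed.
Lemma shN z : sh (- z) = - sh z. Proof. by rewrite /sh opprK; field. Qed.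
Lemma chN z : ch (- z) = ch z. Proof. by rewrite /ch opprK addrC. Qed.

Lemma ch_sub_sh z : ch z - sh z = expR (- z).
Proof. by rewrite /ch /sh; field. Qed.

Lemma ch2_sub_sh2 z : ch z ^+ 2 - sh z ^+ 2 = 1.
Proof.
have e : expR z * expR (- z) = 1 by rewrite -expRD subrr expR0.
by rewrite -[RHS]e /ch /sh; field.
Qed.

Lemma shD x y : sh (x + y) = sh x * ch y + ch x * sh y.
Proof. by rewrite /sh /ch opprD !expRD; field. Qed.

Lemma ch_ge1 z : 1 <= ch z.
Proof.
have h1 := expR_ge1Dx z; have h2 := expR_ge1Dx (- z).
by rewrite /ch ler_pdivlMr//; lra.
Qed.

Lemma mvt (f df : R -> R) (x y : R) : x < y -> (forall t : R, is_derive t 1 f (df t)) ->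
  exists2 z, x < z < y & f y - f x = df z * (y - x).
Proof.
move=> xy d; have [|z] := @MVT _ f df x y xy (fun t _ => d t).
  apply: continuous_subspaceT => t; apply: differentiable_continuous.
  by apply/derivable1_diffP; have [] := d t.
by rewrite in_itv/= => zxy e; exists z.
Qed.

Lemma mvt_sh x y : x < y -> exists2 z, x < z < y & sh y - sh x = ch z * (y - x).
Proof. by move=> xy; apply: (mvt xy) => t; apply: D_ext (D_sh (D_id t)) _; rewrite mul1r. Qed.

Lemma mvt_ch x y : x < y -> exists2 z, x < z < y & ch y - ch x = sh z * (y - x).
Proof. by move=> xy; apply: (mvt xy) => t; apply: D_ext (D_ch (D_id t)) _; rewrite mul1r. Qed.

Lemma sh_gt0 z : 0 < z -> 0 < sh z.
Proof. by move=> z0; rewrite /sh divr_gt0// subr_gt0 ltr_expR; lra. Qed.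

Lemma ch_strict x y : 0 <= x -> x < y -> ch x < ch y.
Proof.
move=> x0 xy; have [z /andP[xz zy] e] := mvt_ch xy.
by rewrite -subr_gt0 e mulr_gt0 ?subr_gt0// sh_gt0// (le_lt_trans x0).
Qed.

Lemma ch_gt1 z : 0 < z -> 1 < ch z.
Proof. by move=> z0; rewrite -ch0 ch_strict. Qed.

Lemma sh_gt_id z : 0 < z -> z < sh z.
Proof.
move=> z0; have [y /andP[y0 yz]] := mvt_sh z0; rewrite sh0 !subr0 => ->.
by rewrite ltr_pMl// ch_gt1.
Qed.

Lemma sh_superadditive x y : 0 <= x -> 0 <= y -> sh x + sh y <= sh (x + y).
Proof.
have ge0 z : 0 <= z -> 0 <= sh z.
  by rewrite le_eqVlt => /predU1P[<-|/sh_gt0/ltW//]; rewrite sh0.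
move=> /ge0 x0 /ge0 y0; rewrite shD lerD//.
- by rewrite ler_peMr// ch_ge1.
- by rewrite ler_peMl// ch_ge1.
Qed.

Lemma sh_convex x z : 0 <= x <= z -> z * sh x <= x * sh z.
Proof.
move=> /andP[]; rewrite le_eqVlt => /predU1P[<-|x0]; first by rewrite sh0 mulr0 mul0r.
rewrite le_eqVlt => /predU1P[<-|xz]; first by rewrite mulrC.
have [p /andP[p0 px] ep] := mvt_sh x0; have [q /andP[xq qz] eq] := mvt_sh xz.
rewrite sh0 !subr0 in ep.
have h : ch p < ch q by apply: ch_strict; [exact: ltW|exact: lt_trans xq].
rewrite -subr_ge0 (_ : _ - _ = x * (sh z - sh x) - (z - x) * sh x); last ring.
rewrite eq ep (_ : _ - _ = x * (z - x) * (ch q - ch p)); last ring.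
by rewrite mulr_ge0 ?mulr_ge0 ?subr_ge0// ltW.
Qed.

(** The function z coth z - 1, through which both end slopes of the profile
    depend on the half-width z in units of the capillary length. *)
Definition tau z : R := z * ch z / sh z - 1.

Lemma tauE z : 0 < z -> (tau z + 1) * sh z = z * ch z.
Proof. by move=> /sh_gt0 h; rewrite /tau subrK divfK// gt_eqF. Qed.

Lemma tau_gt0 z : 0 < z -> 0 < tau z.
Proof.
move=> z0; have s0 := sh_gt0 z0; rewrite subr_gt0 ltr_pdivlMr// mul1r.
have [y /andP[y0 yz]] := mvt_sh z0; rewrite sh0 !subr0 => ->.
by rewrite mulrC ltr_pM2l// ch_strict// ltW.
Qed.

Lemma tau_le z : 0 < z -> tau z <= z.
Proof.
move=> z0; have s0 := sh_gt0 z0; rewrite lerBlDr ler_pdivrMr//.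
have : z * expR (- z) <= sh z.
  apply: le_trans (ltW (sh_gt_id z0)); rewrite ler_piMr// ?(ltW z0)//.
  by rewrite -expR0 ler_expR; lra.
rewrite -ch_sub_sh; lra.
Qed.

Lemma tau_ge z : 0 < z -> z - 1 <= tau z.
Proof.
move=> z0; have s0 := sh_gt0 z0; rewrite lerD2r ler_pdivlMr// ler_wpM2l// ?(ltW z0)//.
by rewrite -subr_ge0 ch_sub_sh expR_ge0.
Qed.

Definition tau' z : R := (sh z * ch z - z) / sh z ^+ 2.

Lemma D_tau z : 0 < z -> is_derive z 1 tau (tau' z).
Proof.
move=> z0; have s0 := sh_gt0 z0; have n0 : sh z != 0 by rewrite gt_eqF.
have d := D_sub (D_mul (D_mul (D_id z) (D_ch (D_id z))) (D_inv (D_sh (D_id z)) n0)) (D_cst z 1).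
apply: D_ext d _; have e := ch2_sub_sh2 z.
have -> : tau' z = (sh z * ch z - z * (ch z ^+ 2 - sh z ^+ 2)) / sh z ^+ 2.
  by rewrite e mulr1.
by field.
Qed.

Lemma tau'_bounds z : 0 < z -> 0 < tau' z <= 1.
Proof.
move=> z0; have s0 := sh_gt0 z0; have si := sh_gt_id z0; have c1 := ch_gt1 z0.
rewrite divr_gt0 ?exprn_gt0//=; last first.
  by rewrite subr_gt0; apply: lt_trans si _; rewrite ltr_pMr.
rewrite ler_pdivrMr ?exprn_gt0// mul1r expr2.
have : sh z * expR (- z) <= z.
  have -> : sh z * expR (- z) = (1 - expR (- (2 * z))) / 2.
    have e : expR z * expR (- z) = 1 by rewrite -expRD subrr expR0.
    have -> : - (2 * z) = - z + - z by ring.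
    rewrite expRD /sh; move: e; set E := expR (- z); set F := expR z => e.
    have -> : (F - E) / 2 * E = (F * E - E * E) / 2 by field.
    by rewrite e.
  have := expR_ge1Dx (- (2 * z)); rewrite ler_pdivrMr//; lra.
rewrite -ch_sub_sh; lra.
Qed.

Lemma tau_increment x y : 0 < x -> x < y -> 0 < tau y - tau x <= y - x.
Proof.
move=> x0 xy.
have [||z] := @MVT _ tau tau' x y xy.
- by move=> t; rewrite in_itv/= => /andP[xt _]; apply: D_tau; exact: lt_trans xt.
- apply: derivable_within_continuous => t; rewrite in_itv/= => /andP[xt _].
  by have [] := D_tau (lt_le_trans x0 xt).
rewrite in_itv/= => /andP[xz _] ->.
have /andP[t0 t1] := tau'_bounds (lt_trans x0 xz).
have yx : 0 < y - x by rewrite subr_gt0.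
by rewrite mulr_gt0//= ler_piMl// ltW.
Qed.

Lemma tau_surjective r : 0 < r -> exists2 z, 0 < z & tau z = r.
Proof.
move=> r0; have rr : r <= r + 1 by rewrite lerDl.
have c : {within `[r, r + 1], continuous tau}.
  apply: derivable_within_continuous => t; rewrite in_itv/= => /andP[rt _].
  by have [] := D_tau (lt_le_trans r0 rt).
have h1 := tau_le r0.
have h2 : r <= tau (r + 1).
  have : 0 < r + 1 by rewrite addr_gt0.
  by move=> /tau_ge; rewrite addrK.
have [|z] := IVT rr c (v := r).
  by rewrite ge_min le_max h1 h2 orbT.
rewrite in_itv/= => /andP[rz _] e; exists z => //; exact: lt_le_trans rz.
Qed.

End Hyperbolic.

(** * The explicit profile and its slopes *)

Section DropProfile.
Context {R : realType}.
Local Notation mu := (@lebesgue_measure R).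
Variables (c s V0 : R).
Hypotheses (c0 : 0 < c) (s0 : 0 < s) (V00 : 0 < V0).

Let k := Num.sqrt c.
Let o := s / c.
Let e := V0 * c / 2.

Let k0 : 0 < k. Proof. by rewrite sqrtr_gt0. Qed.
Let kk : k * k = c. Proof. by rewrite -expr2 sqr_sqrtr// ltW. Qed.
Let o0 : 0 < o. Proof. by rewrite divr_gt0. Qed.
Let e0 : 0 < e. Proof. by rewrite divr_gt0 ?mulr_gt0. Qed.

(** The slopes at the ends of the profile of width [w] are the difference and
    minus the sum of [even_slope], due to the volume, and [odd_slope], due to
    gravity along the plane. *)
Definition slope_param (w : R) : R := tau (k * w / 2).
Definition even_slope (w : R) : R := e / slope_param w.
Definition odd_slope (w : R) : R := o * slope_param w.
Definition slope_energy (w : R) : R := even_slope w ^+ 2 + odd_slope w ^+ 2.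

Let t := slope_param.

Let kw0 w : 0 < w -> 0 < k * w / 2. Proof. by move=> w0; rewrite divr_gt0 ?mulr_gt0. Qed.

Lemma slope_param_gt0 w : 0 < w -> 0 < t w.
Proof. by move=> w0; apply: tau_gt0; exact: kw0. Qed.

Lemma slope_param_increment x y : 0 < x -> x <= y -> 0 <= t y - t x <= k / 2 * (y - x).
Proof.
move=> x0; rewrite le_eqVlt => /predU1P[->|xy]; first by rewrite !subrr mulr0 lexx.
rewrite (_ : k / 2 * (y - x) = k * y / 2 - k * x / 2); last by field.
have lt_xy : k * x / 2 < k * y / 2 by rewrite ltr_pM2r// ltr_pM2l.
by have /andP[/ltW-> ->] := tau_increment (kw0 x0) lt_xy.
Qed.

Lemma slope_difference w : 0 < w ->
  (even_slope w + odd_slope w) ^+ 2 - (even_slope w - odd_slope w) ^+ 2 = 2 * (s * V0).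
Proof.
move=> /slope_param_gt0 t0; rewrite /even_slope /odd_slope /o /e -/t.
by field; rewrite !gt_eqF.
Qed.

(** The left slope vanishes where the squared slope parameter is e / o, and the
    parameter takes every positive value. *)
Lemma max_width_exists : exists W, [/\ 0 < W, even_slope W = odd_slope W, slope_energy W = s * V0,
  forall w, 0 < w -> (w <= W) = (odd_slope w <= even_slope w) &
  forall w, 0 < w -> w < W -> odd_slope w < even_slope w].
Proof.
have r0 : 0 < Num.sqrt (e / o) by rewrite sqrtr_gt0 divr_gt0.
have [z z0 zE] := tau_surjective r0.
pose W := 2 * z / k; have W0 : 0 < W by rewrite divr_gt0 ?mulr_gt0.
have tW : t W = Num.sqrt (e / o).
  by rewrite -zE /t /slope_param; congr tau; rewrite /W; field; rewrite gt_eqF.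
have t2 : t W ^+ 2 = e / o by rewrite tW sqr_sqrtr// divr_ge0 ?ltW.
have tW0 := slope_param_gt0 W0.
have eqW : even_slope W = odd_slope W.
  have eE : e = o * t W ^+ 2 by rewrite t2 mulrC divfK// gt_eqF.
  by rewrite /even_slope /odd_slope -/e -/o -/t eE; field; rewrite gt_eqF.
have key w : 0 < w -> (odd_slope w <= even_slope w) = (t w <= t W).
  move=> w0; have tw0 := slope_param_gt0 w0.
  rewrite /odd_slope /even_slope -/t ler_pdivlMr// -mulrA -expr2.
  rewrite -ler_pdivlMl// mulrC -t2 ler_pXn2r// nnegrE ltW//.
have strict w : 0 < w -> w < W -> odd_slope w < even_slope w.
  move=> w0 wW; have h1 : k * w / 2 < k * W / 2 by rewrite ltr_pM2r// ltr_pM2l.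
  have /andP[+ _] := tau_increment (kw0 w0) h1; rewrite subr_gt0 -!/(slope_param _) -/t => tt.
  apply: (@lt_trans _ _ (odd_slope W)); first by rewrite ltr_pM2l.
  by rewrite -eqW ltr_pM2l// ltf_pV2// posrE slope_param_gt0.
exists W; split=> //.
- rewrite /slope_energy -eqW; have := slope_difference W0; rewrite -eqW; lra.
- move=> w w0; rewrite key//; have [wW|Ww] := leP w W.
    by have /andP[h _] := slope_param_increment w0 wW; rewrite -subr_ge0 h.
  apply/esym/negbTE; rewrite -ltNge.
  have h1 : k * W / 2 < k * w / 2 by rewrite ltr_pM2r// ltr_pM2l.
  by have /andP[] := tau_increment (kw0 W0) h1; rewrite subr_gt0.
Qed.

(** As a function of t = [slope_param] the energy is (e/t)^2 + (o t)^2, which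
    decreases as long as o t <= e/t, that is up to the maximal width. *)
Lemma slope_energy_antitone W x y : 0 < W -> even_slope W = odd_slope W ->
  0 < x -> x <= y -> y <= W -> slope_energy y <= slope_energy x.
Proof.
move=> W0 eW x0 xy yW; have y0 := lt_le_trans x0 xy.
have := slope_param_increment x0 xy; have := slope_param_increment y0 yW.
move=> /andP[h1 _] /andP[h2 _].
have tx := slope_param_gt0 x0; have ty := slope_param_gt0 y0; have tW := slope_param_gt0 W0.
move: eW; rewrite /slope_energy /even_slope /odd_slope -/t -/e -/o.
move: (t x) (t y) (t W) tx ty tW h1 h2 => p q r p0 q0 r0 qr pq.
move=> er; have {er} re : e = o * r * r by rewrite -er divfK// gt_eqF.
rewrite -subr_ge0.
have -> : (e / p) ^+ 2 + (o * p) ^+ 2 - ((e / q) ^+ 2 + (o * q) ^+ 2) =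
  (q - p) * (q + p) * ((e / (p * q)) ^+ 2 - o ^+ 2).
  by field; rewrite !gt_eqF.
apply: mulr_ge0; first by rewrite mulr_ge0; lra.
have oe : o <= e / (p * q).
  rewrite ler_pdivlMr ?mulr_gt0// re -mulrA ler_wpM2l ?(ltW o0)//.
  by apply: ler_pM; lra.
by rewrite subr_ge0 lerXn2r// nnegrE ?(ltW o0)// (le_trans (ltW o0)).
Qed.

Lemma slope_energy_lipschitz W d : 0 < d -> exists2 L, 0 <= L &
  forall x y, d <= x <= W -> d <= y <= W -> `|slope_energy x - slope_energy y| <= L * `|x - y|.
Proof.
move=> d0; have td := slope_param_gt0 d0.
have [dW|Wd] := leP d W; last first.
  by exists 0 => // x y /andP[dx xW]; have := le_trans dx xW; rewrite leNgt Wd.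
have W0 := lt_le_trans d0 dW.
pose C := 2 * t W * (e ^+ 2 / t d ^+ 4 + o ^+ 2).
have tW := slope_param_gt0 W0.
have C0 : 0 <= C.
  apply: mulr_ge0; first by rewrite mulr_ge0// ltW.
  by rewrite addr_ge0 ?sqr_ge0// divr_ge0 ?sqr_ge0// exprn_ge0// ltW.
exists (C * (k / 2)); first by rewrite mulr_ge0// divr_ge0// ltW.
have one x y : d <= x -> x <= y -> y <= W -> `|slope_energy y - slope_energy x| <= C * (k / 2) * (y - x).
  move=> dx xy yW; have x0 := lt_le_trans d0 dx; have y0 := lt_le_trans x0 xy.
  have /andP[h1 h1'] := slope_param_increment x0 xy.
  have /andP[h2 _] := slope_param_increment y0 yW.
  have /andP[h3 _] := slope_param_increment d0 dx.
  have tx := slope_param_gt0 x0; have ty := slope_param_gt0 y0.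
  rewrite -mulrA; apply: (@le_trans _ _ (C * (t y - t x))); last by rewrite ler_wpM2l.
  rewrite /slope_energy /even_slope /odd_slope -/t /C.
  move: (t x) (t y) (t W) (t d) tx ty tW td h1 h2 h3 => p q r i p0 q0 r0 i0 qp rq pi.
  have -> : (e / q) ^+ 2 + (o * q) ^+ 2 - ((e / p) ^+ 2 + (o * p) ^+ 2) =
    (q + p) * (o ^+ 2 - e ^+ 2 / (p * q) ^+ 2) * (q - p).
    by field; rewrite !gt_eqF.
  rewrite normrM (ger0_norm qp) ler_wpM2r// normrM; apply: ler_pM => //.
    by rewrite ger0_norm; lra.
  apply: le_trans (ler_normB _ _) _; rewrite (ger0_norm (sqr_ge0 _)) addrC lerD2r.
  rewrite ger0_norm ?divr_ge0 ?sqr_ge0// ler_wpM2l ?sqr_ge0// lef_pV2 ?posrE ?exprn_gt0 ?mulr_gt0//.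
  have -> : i ^+ 4 = (i * i) ^+ 2 by ring.
  by apply: lerXn2r; rewrite ?nnegrE ?mulr_ge0 ?ler_pM//; lra.
move=> x y /andP[dx xW] /andP[dy yW]; have [xy|/ltW yx] := leP x y.
- by rewrite distrC [`|x - y|]distrC (ger0_norm (_ : 0 <= y - x)) ?subr_ge0// one.
- by rewrite (ger0_norm (_ : 0 <= x - y)) ?subr_ge0// one.
Qed.

(** The slope parameter is at most the half-width, in units of the capillary
    length, so the even slope explodes. *)
Lemma slope_energy_blowup W M : 0 < W -> exists d, [/\ 0 < d, d < W & M < slope_energy d].
Proof.
move=> W0; pose d := Num.min (W / 2) (2 / k * (e / (`|M| + 1))).
have M1 : 0 < `|M| + 1 by rewrite ltr_wpDl.
have d0 : 0 < d by rewrite lt_min !(mulr_gt0, divr_gt0, invr_gt0).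
have dW : d <= W / 2 by rewrite ge_min lexx.
have dM : d <= 2 / k * (e / (`|M| + 1)) by rewrite ge_min lexx orbT.
exists d; split=> //; first by lra.
have t0 := slope_param_gt0 d0.
have tl : t d <= e / (`|M| + 1).
  apply: le_trans (tau_le (kw0 d0)) _.
  have -> : e / (`|M| + 1) = k * (2 / k * (e / (`|M| + 1))) / 2.
    by field; rewrite !gt_eqF.
  by rewrite ler_pM2r// ler_pM2l.
have el : `|M| + 1 <= even_slope d.
  by rewrite /even_slope -/t ler_pdivlMr// mulrC -ler_pdivlMr.
apply: (@lt_le_trans _ _ (`|M| + 1)); first by have := ler_norm M; lra.
apply: (@le_trans _ _ ((`|M| + 1) ^+ 2)).
  by rewrite expr2 ler_peMr// ?(ltW M1)//; have := normr_ge0 M; lra.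
apply: (@le_trans _ _ (even_slope d ^+ 2)); last by rewrite lerDl sqr_ge0.
by rewrite lerXn2r// nnegrE ?(ltW M1)// (le_trans (ltW M1)).
Qed.

Section Interval.
Variables (a b : R).
Hypothesis ab : a < b.

Let h := (b - a) / 2.
Let m := (a + b) / 2.
Let z := k * h.
Let N := even_slope (b - a) * ch z / (k * sh z).

(** An odd part balancing the linear potential and an even part carrying the
    volume, both vanishing at the ends. *)
Definition profile (x : R) : R :=
  o * (x - m - h * sh (k * (x - m)) / sh z) + N * (1 - ch (k * (x - m)) / ch z).
Definition profile' (x : R) : R :=
  o * (1 - z * ch (k * (x - m)) / sh z) - N * k * sh (k * (x - m)) / ch z.
Definition profile'' (x : R) : R :=
  - o * z * k * sh (k * (x - m)) / sh z - N * k ^+ 2 * ch (k * (x - m)) / ch z.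

Let h0 : 0 < h. Proof. by rewrite divr_gt0// subr_gt0. Qed.
Let z0 : 0 < z. Proof. by rewrite mulr_gt0. Qed.
Let sz0 : 0 < sh z. Proof. exact: sh_gt0. Qed.
Let cz0 : 0 < ch z. Proof. exact: lt_le_trans (ch_ge1 z). Qed.
Let shn0 : sh z != 0. Proof. by rewrite gt_eqF. Qed.
Let chn0 : ch z != 0. Proof. by rewrite gt_eqF. Qed.
Let kn0 : k != 0. Proof. by rewrite gt_eqF. Qed.
Let zE : k * (b - a) / 2 = z. Proof. by rewrite /z /h mulrA. Qed.

Let D_arg (x : R) : is_derive x 1 (fun x => k * (x - m)) k.
Proof. by apply: D_ext (D_scale (D_sub (D_id x) (D_cst x m)) k) _; rewrite subr0 mulr1. Qed.

Lemma D_profile (x : R) : is_derive x 1 profile (profile' x).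
Proof.
have d := D_add
  (D_scale (D_sub (D_sub (D_id x) (D_cst x m))
     (D_mul (D_scale (D_sh (D_arg x)) h) (D_cst x (sh z)^-1))) o)
  (D_scale (D_sub (D_cst x 1) (D_mul (D_ch (D_arg x)) (D_cst x (ch z)^-1))) N).
by apply: D_ext d _; rewrite /profile' /z; ring.
Qed.

Lemma D_profile' (x : R) : is_derive x 1 profile' (profile'' x).
Proof.
have d := D_sub
  (D_scale (D_sub (D_cst x 1)
     (D_mul (D_scale (D_ch (D_arg x)) z) (D_cst x (sh z)^-1))) o)
  (D_mul (D_scale (D_sh (D_arg x)) (N * k)) (D_cst x (ch z)^-1)).
by apply: D_ext d _; rewrite /profile'' /z; ring.
Qed.

Lemma profile''_continuous : continuous profile''.
Proof.
have d (x : R) := D_sub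
  (D_mul (D_scale (D_sh (D_arg x)) (- o * z * k)) (D_cst x (sh z)^-1))
  (D_mul (D_scale (D_ch (D_arg x)) (N * k ^+ 2)) (D_cst x (ch z)^-1)).
move=> x; have df : differentiable profile'' x by apply/derivable1_diffP; have [] := d x.
exact: differentiable_continuous df.
Qed.

Lemma profile_ode (x : R) : - profile'' x + c * profile x - s * x = N * c - s * m.
Proof.
have sE : s = o * c by rewrite divfK// gt_eqF.
rewrite sE -kk /profile /profile'' /z; ring.
Qed.

Let am : k * (a - m) = - z. Proof. by rewrite /z /m /h; field. Qed.
Let bm : k * (b - m) = z. Proof. by rewrite /z /m /h; field. Qed.

Lemma profile_left : profile a = 0.
Proof.
by rewrite /profile am shN chN mulrN mulNr mulfK// divff// subrr mulr0 /h /m; field.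
Qed.

Lemma profile_right : profile b = 0.
Proof.
by rewrite /profile bm mulfK// divff// subrr mulr0 /h /m; field.
Qed.

Let tauz : z * ch z = (slope_param (b - a) + 1) * sh z.
Proof. by rewrite /slope_param zE tauE. Qed.

Lemma profile'_left : profile' a = even_slope (b - a) - odd_slope (b - a).
Proof.
rewrite /profile' am chN shN tauz mulfK// /odd_slope /N.
by field; rewrite shn0 chn0.
Qed.

Lemma profile'_right : profile' b = - (even_slope (b - a) + odd_slope (b - a)).
Proof.
rewrite /profile' bm tauz mulfK// /odd_slope /N.
by field; rewrite shn0 chn0.
Qed.

Lemma profile_volume : (\int[mu]_(x in `[a, b]) profile x)%R = V0.
Proof.
pose F x := o * ((x - m) * (x - m) / 2 - h / k * ch (k * (x - m)) / sh z) +
   N * (x - m - sh (k * (x - m)) / (k * ch z)).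
have dF (x : R) : is_derive x 1 F (profile x).
  have dm := D_sub (D_id x) (D_cst x m).
  have d := D_add
    (D_scale (D_sub (D_mul (D_mul dm dm) (D_cst x 2^-1))
       (D_mul (D_scale (D_ch (D_arg x)) (h / k)) (D_cst x (sh z)^-1))) o)
    (D_scale (D_sub dm (D_mul (D_sh (D_arg x)) (D_cst x (k * ch z)^-1))) N).
  by apply: D_ext d _; rewrite /profile; field; rewrite shn0 chn0.
have cont : continuous profile.
  move=> x; apply: differentiable_continuous; apply/derivable1_diffP.
  by have [] := D_profile x.
rewrite (FTC_itv ab cont dF) /F am bm chN shN.
have hh : h = z / k by rewrite /z mulrAC mulfV// mul1r.
have -> : a - m = - h by rewrite /m /h; field.
have -> : b - m = h by rewrite /m /h; field.
have t0 : slope_param (b - a) != 0 by rewrite gt_eqF// slope_param_gt0// subr_gt0.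
transitivity (2 * N / k * (z * ch z - sh z) / ch z); first by rewrite hh; field; rewrite kn0 shn0 chn0.
rewrite tauz /N /even_slope -/t /e -kk; field.
by rewrite t0 kn0 shn0 chn0.
Qed.

(** The profile on the left half in the critical case of zero left slope, up to
    scaling, as a function of the distance [x] from the centre. It vanishes at the end
    and decreases: superadditivity of the hyperbolic sine and z < sh z make the
    derivative negative. *)
Lemma left_balance x : 0 <= x -> x < z ->
  0 < tau z * ch z / sh z * (1 - ch x / ch z) - x + z * sh x / sh z.
Proof.
move=> x0 xz.
pose D y := tau z * ch z / sh z * (1 - ch y / ch z) - y + z * sh y / sh z.
pose D' y := (z * sh (z - y) + sh z * sh y - sh z ^+ 2) / sh z ^+ 2.
have dD (y : R) : is_derive y 1 D (D' y).
  have d := D_add (D_sub (D_scale (D_sub (D_cst y 1) (D_mul (D_ch (D_id y)) (D_cst y (ch z)^-1)))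
    (tau z * ch z / sh z)) (D_id y)) (D_mul (D_scale (D_sh (D_id y)) z) (D_cst y (sh z)^-1)).
  apply: D_ext d _; rewrite /D' shD shN chN /tau; field.
  by rewrite shn0 chn0.
have Dz : D z = 0 by rewrite /D mulfK// divff// subrr mulr0; ring.
have [y /andP[xy yz] eq] := mvt xz dD.
have y0 := le_lt_trans x0 xy.
have D'0 : D' y < 0.
  rewrite /D' pmulr_llt0 ?invr_gt0 ?exprn_gt0//.
  have zy : 0 < z - y by rewrite subr_gt0.
  have h1 := sh_superadditive (ltW zy) (ltW y0); rewrite subrK in h1.
  have h2 := sh_gt0 zy; have h3 := sh_gt_id z0.
  have h4 : sh z * sh (z - y) <= sh z * (sh z - sh y) by rewrite ler_wpM2l ?(ltW sz0)//; lra.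
  have h5 : z * sh (z - y) < sh z * sh (z - y) by rewrite ltr_pM2r.
  rewrite expr2; lra.
have : D x = - (D' y * (z - x)) by rewrite -eq Dz; ring.
by rewrite -/(D x) => ->; rewrite oppr_gt0 nmulr_rlt0// subr_gt0.
Qed.

(** On the right half both parts are nonnegative. On the left half the even part
    dominates at least as much as in the critical case of [left_balance]. *)
Lemma profile_gt0 x : odd_slope (b - a) <= even_slope (b - a) -> a < x < b -> 0 < profile x.
Proof.
move=> slope /andP[ax xb]; have w0 : 0 < b - a by rewrite subr_gt0.
have N0 : 0 < N.
  rewrite /N divr_gt0//; last exact: mulr_gt0.
  by rewrite mulr_gt0// divr_gt0// slope_param_gt0.
have even y : 0 <= y -> y < z -> 0 < N * (1 - ch y / ch z).
  move=> y0 yz; rewrite mulr_gt0// subr_gt0 ltr_pdivrMr// mul1r; exact: ch_strict.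
have [mx|xm] := leP m x.
  have y0 : 0 <= k * (x - m) by rewrite mulr_ge0 ?subr_ge0// ltW.
  have yz : k * (x - m) < z by rewrite -bm ltr_pM2l// ltrD2r.
  apply: ltr_wpDl; last exact: even.
  rewrite mulr_ge0 ?(ltW o0)// subr_ge0 ler_pdivrMr// -(ler_pM2l k0) mulrA -/z.
  by rewrite (mulrA k) sh_convex// y0 ltW.
pose y := k * (m - x).
have yE : k * (x - m) = - y by rewrite /y; ring.
have y0 : 0 <= y by rewrite mulr_ge0 ?subr_ge0// ltW.
have yz : y < z by rewrite -(opprK z) -am -mulrN ltr_pM2l// opprB ltrD2l ltrN2.
have bal := left_balance y0 yz.
have Nlow : o / k * (tau z * ch z / sh z) <= N.
  have -> : o / k * (tau z * ch z / sh z) = odd_slope (b - a) * (ch z / (k * sh z)).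
    by rewrite /odd_slope /slope_param zE; field; rewrite kn0 shn0.
  rewrite /N -mulrA ler_wpM2r// divr_ge0 ?(ltW cz0)//.
  by rewrite mulr_ge0 ?(ltW sz0) ?(ltW k0).
have ev : 0 <= 1 - ch y / ch z.
  by rewrite subr_ge0 ler_pdivrMr// mul1r ltW// ch_strict.
have h1 : o / k * (tau z * ch z / sh z) * (1 - ch y / ch z) <= N * (1 - ch y / ch z) by rewrite ler_wpM2r.
have h2 : 0 < o / k * (tau z * ch z / sh z * (1 - ch y / ch z) - y + z * sh y / sh z).
  by rewrite mulr_gt0// divr_gt0.
have -> : profile x = o / k * (z * sh y / sh z - y) + N * (1 - ch y / ch z).
  rewrite /profile yE shN chN -/o (_ : x - m = - (y / k)); last by rewrite /y; field.
  by rewrite /z; field; rewrite kn0 shn0 chn0.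
apply: lt_le_trans h2 _; rewrite -subr_ge0.
apply: le_trans (_ : 0 <= N * (1 - ch y / ch z) - o / k * (tau z * ch z / sh z) * (1 - ch y / ch z)) _.
  by rewrite subr_ge0.
by rewrite le_eqVlt; apply/orP; left; apply/eqP; ring.
Qed.

Lemma profile_slope : (forall x, a < x < b -> 0 <= profile x) -> odd_slope (b - a) <= even_slope (b - a).
Proof.
move=> pos; rewrite -subr_ge0 -profile'_left leNgt; apply/negP => p0.
have np : 0 < - profile' a / 2 by rewrite divr_gt0// oppr_gt0.
have [r r0 H] := (is_deriveP _ _ _).1 (D_profile a) _ np.
pose d := Num.min r (b - a) / 2.
have d0 : 0 < d by rewrite divr_gt0// lt_min r0 subr_gt0.
have dr : d < r by rewrite ltr_pdivrMr// gt_min; apply/orP; left; lra.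
have db : d < b - a by rewrite ltr_pdivrMr// gt_min; apply/orP; right; have := ab; lra.
have := H (a + d); have -> : a + d - a = d by ring.
rewrite gtr0_norm// profile_left subr0 => /(_ dr) /ler_normlP[_ h1].
have h2 : 0 <= profile (a + d) by apply: pos; apply/andP; split; lra.
have : 0 < - profile' a * d by rewrite mulr_gt0// oppr_gt0.
lra.
Qed.

End Interval.

End DropProfile.

(** * From the contact line law to the motion and back *)

Section OneSided.
Context {R : realType}.
Implicit Types f : R -> R.

Lemma lipschitz_constant (A : set R) f : [lipschitz f x | x in A] ->
  exists2 K, 0 <= K & forall x y, A x -> A y -> `|f x - f y| <= K * `|x - y|.
Proof.
move=> [M [_ H]]; pose K := Num.max M 0 + 1.
have MK : M < K by rewrite (@le_lt_trans _ _ (Num.max M 0)) ?ltrDl// le_max lexx.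
exists K; first by rewrite addr_ge0// le_max lexx orbT.
by move=> x y Ax Ay; have := H K MK (x, y) (conj Ax Ay).
Qed.

Lemma lip0_lipschitz K f : lip0 K f -> [lipschitz f t | t in `[0, +oo[].
Proof.
move=> H; have z : `[0, +oo[%classic (0 : R) by rewrite /= in_itv/= lexx.
apply: (@klipschitzW _ _ _ K); first exact: (@globally_properfilter _ _ (0, 0)).
by move=> [x y] /=; rewrite !in_itv/= !andbT => -[x0 y0]; exact: H.
Qed.

Lemma itvoo_inj (a b a' b' : R) : a < b -> `]a, b[%classic = `]a', b'[%classic -> a = a' /\ b = b'.
Proof.
move=> ab E.
have H x : a < x < b <-> a' < x < b'.
  by have := congr1 (fun S : set R => S x) E; rewrite /= !in_itv/= => ->.
have /andP[am mb] : a < (a + b) / 2 < b by rewrite ltr_pdivlMr// ltr_pdivrMr//; apply/andP; split; lra.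
have /H/andP[a'm mb'] : a < (a + b) / 2 < b by rewrite am.
split; apply/eqP; rewrite eq_le; apply/andP; split; rewrite leNgt; apply/negP => lt_.
- have /H/andP[] : a' < (a' + Num.min a ((a + b) / 2)) / 2 < b'.
    rewrite (min_idPl (ltW am)) ltr_pdivlMr// ltr_pdivrMr//; apply/andP; split; lra.
  by rewrite (min_idPl (ltW am)) ltr_pdivlMr//; lra.
- have /H/andP[] : a < (a + a') / 2 < b by rewrite ltr_pdivlMr// ltr_pdivrMr//; apply/andP; split; lra.
  by rewrite ltr_pdivlMr//; lra.
- have /H/andP[] : a < (b + b') / 2 < b by rewrite ltr_pdivlMr// ltr_pdivrMr//; apply/andP; split; lra.
  by rewrite ltr_pdivrMr//; lra.
- have /H/andP[] : a' < (b + b') / 2 < b' by rewrite ltr_pdivlMr// ltr_pdivrMr//; apply/andP; split; lra.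
  by rewrite ltr_pdivrMr//; lra.
Qed.

Lemma right_deriv_agree (f g : R -> R) (x y d : R) : x < y -> (forall z, x <= z <= y -> f z = g z) ->
  is_derive x 1 g d -> is_right_deriv f x d.
Proof.
move=> xy fg /is_deriveP dg; apply/cvgrPdist_le => e e0.
have [r r0 H] := dg e e0.
have m0 : 0 < Num.min r (y - x) by rewrite lt_min r0 subr_gt0.
near=> h.
have h0 : 0 < h by near: h; exact: nbhs_right_gt.
have : h < Num.min r (y - x) by near: h; exact: nbhs_right_lt.
rewrite lt_min => /andP[hr hy].
rewrite !fg; [|by apply/andP; split; lra..].
have := H (x + h); have -> : x + h - x = h by ring.
rewrite (gtr0_norm h0) => /(_ hr) Hh.
rewrite distrC (_ : _ - d = h^-1 * (g (x + h) - g x - d * h)); last by field; rewrite gt_eqF.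
by rewrite normrM (gtr0_norm (_ : 0 < h^-1)) ?invr_gt0// mulrC ler_pdivrMr.
Unshelve. all: by end_near. Qed.

Lemma left_deriv_agree (f g : R -> R) (x y d : R) : y < x -> (forall z, y <= z <= x -> f z = g z) ->
  is_derive x 1 g d -> is_left_deriv f x d.
Proof.
move=> yx fg /is_deriveP dg; apply/cvgrPdist_le => e e0.
have [r r0 H] := dg e e0.
have m0 : - Num.min r (x - y) < 0 by rewrite oppr_lt0 lt_min r0 subr_gt0.
near=> h.
have h0 : h < 0 by near: h; exact: nbhs_left_lt.
have : - Num.min r (x - y) < h by near: h; exact: nbhs_left_gt.
rewrite ltrNl lt_min => /andP[hr hy].
rewrite !fg; [|by apply/andP; split; lra..].
have := H (x + h); have -> : x + h - x = h by ring.
rewrite (ltr0_norm h0) => /(_ hr) Hh.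
rewrite distrC (_ : _ - d = h^-1 * (g (x + h) - g x - d * h)); last by field; rewrite lt_eqF.
by rewrite normrM (ltr0_norm (_ : h^-1 < 0)) ?invr_lt0// -invrN mulrC ler_pdivrMr// oppr_gt0.
Unshelve. all: by end_near. Qed.

Lemma right_deriv_unique (f : R -> R) (x p q : R) : is_right_deriv f x p -> is_right_deriv f x q -> p = q.
Proof. by move=> h1 h2; apply: (cvg_unique _ h1 h2); exact: Rhausdorff. Qed.

Lemma left_deriv_unique (f : R -> R) (x p q : R) : is_left_deriv f x p -> is_left_deriv f x q -> p = q.
Proof. by move=> h1 h2; apply: (cvg_unique _ h1 h2); exact: Rhausdorff. Qed.

Lemma min_eq0 (x y : R) : 0 < y -> Num.min x y = 0 -> x = 0.
Proof. by move=> y0; case: leP => // _ e; move: y0; rewrite e ltxx. Qed.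

End OneSided.

Section SlidingDrop.
Context {R : realType}.
Local Notation mu := (@lebesgue_measure R).
Variables (V0 kappa alpha : R).
Hypothesis hV0 : 0 < V0.
Hypothesis hkappa : 0 < kappa.
Hypothesis halpha : 0 < alpha < pi / 2.

Let c := kappa * cos alpha.
Let s := kappa * sin alpha.

Lemma cos_coeff_gt0 : 0 < c.
Proof.
case/andP: halpha => h1 h2; rewrite mulr_gt0// cos_gt0_pihalf//.
by rewrite h2 andbT (lt_trans _ h1)// oppr_lt0 divr_gt0// pi_gt0.
Qed.

Lemma sin_coeff_gt0 : 0 < s.
Proof.
case/andP: halpha => h1 h2; rewrite mulr_gt0// sin_gt0_pi//.
rewrite h1/= (lt_trans h2)// ltr_pdivrMr// ltr_pMr ?pi_gt0// ltr1n//.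
Qed.

Let c0 := cos_coeff_gt0.
Let s0 := sin_coeff_gt0.

Let E := even_slope c V0.
Let O := odd_slope c s.

Definition drop_profile (a b : R) : R -> R := box a b (profile c s V0 a b).

Lemma drop_argmin_unique a b u : a < b -> [set x | 0 < u x] = `]a, b[%classic ->
  is_argmin V0 kappa alpha a b u -> u = drop_profile a b /\ O (b - a) <= E (b - a).
Proof.
move=> ab pos Hu.
have uE : u = drop_profile a b.
  apply: (argmin_unique ab c0 (D_profile c s V0 a b) (D_profile' c s V0 a b)
    (@profile''_continuous _ c s V0 a b) (profile_left s V0 c0 ab) (profile_right s V0 c0 ab)
    (profile_ode s V0 c0 a b) (erefl c) (erefl s) (profile_volume s V0 c0 ab) Hu pos hV0).
split=> //; apply: (profile_slope c0 ab) => x xab; apply: ltW.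
have : 0 < u x by have : `]a, b[%classic x; [rewrite /= in_itv|rewrite -pos].
by rewrite uE /drop_profile box_in//; case/andP: xab => ? ?; rewrite !ltW.
Qed.

Lemma drop_spec a b : a < b -> O (b - a) <= E (b - a) ->
  [/\ [set x | 0 < drop_profile a b x] = `]a, b[%classic, is_argmin V0 kappa alpha a b (drop_profile a b),
    is_right_deriv (drop_profile a b) a (E (b - a) - O (b - a)) &
    is_left_deriv (drop_profile a b) b (- (E (b - a) + O (b - a)))].
Proof.
move=> ab slope.
have pos x : a < x < b -> 0 < drop_profile a b x.
  move=> xab; rewrite /drop_profile box_in; last by case/andP: xab => ? ?; rewrite !ltW.
  exact: profile_gt0.
have zero x : ~ (a < x < b) -> drop_profile a b x = 0.
  move=> h; have [h'|h'] := pselect (a <= x <= b); last exact: box_out.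
  rewrite /drop_profile box_in//; case/andP: h' => ax xb.
  have [->|xa] := eqVneq x a; first exact: profile_left.
  have [->|xb'] := eqVneq x b; first exact: profile_right.
  by case: h; rewrite !lt_neqAle xb' eq_sym xa ax.
split.
- apply/seteqP; split=> x /=; rewrite in_itv/=; last exact: pos.
  by move=> h; apply: contrapT => /zero e; rewrite e ltxx in h.
- apply: (box_argmin ab c0 (D_profile c s V0 a b) (D_profile' c s V0 a b)
    (@profile''_continuous _ c s V0 a b) (profile_left s V0 c0 ab) (profile_right s V0 c0 ab)
    (profile_ode s V0 c0 a b) (erefl c) (erefl s) (profile_volume s V0 c0 ab)) => // x.
  by have [/pos/ltW//|/zero e] := pselect (a < x < b); rewrite -/(drop_profile a b x) e.
- rewrite -profile'_left//; apply: (right_deriv_agree ab) (D_profile _ _ _ _ _ _).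
  by move=> z; exact: box_in.
- rewrite -profile'_right//; apply: (left_deriv_agree ab) (D_profile _ _ _ _ _ _).
  by move=> z; exact: box_in.
Qed.

Section Dynamics.
Variables (W K : R) (beta : R -> R).
Hypothesis W0 : 0 < W.
Hypothesis eW : E W = O W.
Hypothesis Wmax : forall w, 0 < w -> (w <= W) = (O w <= E w).
Hypothesis Wstrict : forall w, 0 < w -> w < W -> O w < E w.

Let G := slope_energy c s V0.
Let gs := s * V0.
Hypothesis GW : G W = gs.

Let half_left w : 0 < w -> 2^-1 * (E w - O w) ^+ 2 = (G w - gs) / 2.
Proof.
move=> w0; have := slope_difference s V0 c0 w0; rewrite -/E -/O -/gs /G /slope_energy -/E -/O; lra.
Qed.

Let half_right w : 0 < w -> 2^-1 * (E w + O w) ^+ 2 = (G w + gs) / 2.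
Proof.
move=> w0; have := slope_difference s V0 c0 w0; rewrite -/E -/O -/gs /G /slope_energy -/E -/O; lra.
Qed.

Let right_gt0 w : 0 < w -> 0 < E w + O w.
Proof.
move=> w0; have t0 := slope_param_gt0 c0 w0.
by apply: addr_gt0; [apply: divr_gt0 => //; rewrite divr_gt0// mulr_gt0|apply: mulr_gt0 => //; exact: divr_gt0].
Qed.

(** The slope at the front never vanishes, so the front obeys an equation. The
    slope at the rear vanishes exactly at the maximal width; the excess speed
    the law then allows to the rear is the reaction [r]. *)
Lemma contact_law_motion u a b t : 0 < b t - a t <= W ->
  u ^~ t = drop_profile (a t) (b t) -> contact_line_law beta u a b t ->
  is_derive t 1 b (front_speed gs G beta (b t - a t) (b t)) /\
  exists r, [/\ 0 <= r, b t - a t < W -> r = 0 &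
    is_derive t 1 (fun t => b t - a t) (width_drift G beta (b t - a t) (b t) - r)].
Proof.
move=> /andP[w0 wW] uE [p [q [hp hq [da db] lp lq]]].
have D (f : R -> R) : derivable f t 1 -> is_derive t 1 f (derive1 f t).
  by clear => df; rewrite derive1E; exact: derivableP.
have {da} Da := D _ da; have {db D} Db := D _ db.
have ab : a t < b t by rewrite -subr_gt0.
have slope : O (b t - a t) <= E (b t - a t) by rewrite -Wmax.
have [_ _ Dp Dq] := drop_spec ab slope.
rewrite uE in hp hq; have pE := right_deriv_unique hp Dp; have qE := left_deriv_unique hq Dq.
have R0 := right_gt0 w0; have Hl := half_left w0; have Hr := half_right w0.
move: lp lq; rewrite pE qE normrN (real_normK (num_real (E _ - O _))) (real_normK (num_real (E _ + O _))) Hl Hr => lp lq.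
have bpos : 0 < `|E (b t - a t) + O (b t - a t)| by rewrite normr_gt0 gt_eqF.
have bE := min_eq0 bpos lq.
split; first by apply: D_ext Db _; rewrite /front_speed; lra.
pose r := derive1 a t + (G (b t - a t) - gs) / 2 - beta (a t).
exists r; split.
- by have := lp; rewrite -/r => <-; rewrite ge_min lexx.
- move=> wlt; apply: min_eq0 lp; rewrite normr_gt0 subr_eq0 gt_eqF//; exact: Wstrict.
- apply: D_ext (D_sub Db Da) _; rewrite /width_drift /r.
  have -> : b t - (b t - a t) = a t by ring.
  lra.
Qed.

(** At a contact time the width is stationary, hence the rear moves with the
    front, and the law at the rear is the sign of the drift. *)
Lemma motion_contact_law u (w b : R -> R) t : 0 < w t <= W ->
  u ^~ t = drop_profile (b t - w t) (b t) ->
  is_derive t 1 b (front_speed gs G beta (w t) (b t)) ->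
  (w t < W /\ is_derive t 1 w (width_drift G beta (w t) (b t))) \/
  [/\ w t = W, is_derive t 1 w 0 & 0 <= width_drift G beta (w t) (b t)] ->
  contact_line_law beta u (fun t => b t - w t) b t.
Proof.
move=> /andP[w0 wW] uE Db Dw.
have wE : b t - (b t - w t) = w t by ring.
have ab : b t - w t < b t by rewrite -subr_gt0 wE.
have slope : O (w t) <= E (w t) by rewrite -Wmax.
have [_ _] := drop_spec ab (ltac:(by rewrite wE)); rewrite wE => Dp Dq.
have Hl := half_left w0; have Hr := half_right w0.
exists (E (w t) - O (w t)), (- (E (w t) + O (w t))).
have der (f : R -> R) d : is_derive t 1 f d -> derivable f t 1 /\ derive1 f t = d.
  by move=> [h1 h2]; rewrite derive1E.
have [db bE] := der _ _ Db.
rewrite normrN (real_normK (num_real (E (w t) - O (w t)))) (real_normK (num_real (E (w t) + O (w t)))).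
rewrite Hl Hr bE uE.
have [d [Dw' h]] : exists d, is_derive t 1 w d /\
    Num.min (front_speed gs G beta (w t) (b t) - d + (G (w t) - gs) / 2 - beta (b t - w t)) `|E (w t) - O (w t)| = 0.
  case: Dw => [[wlt Dw]|[wt Dw drift]].
    exists (width_drift G beta (w t) (b t)); split=> //.
    rewrite (_ : _ - beta _ = 0); last by rewrite /front_speed /width_drift; field.
    by apply/min_idPl.
  exists 0; split=> //; rewrite wt eW subrr normr0; apply/min_idPr.
  by move: drift; rewrite /front_speed /width_drift wt GW; lra.
have [da aE] := der _ _ (D_sub Db Dw').
split=> //; first by rewrite aE.
rewrite /front_speed (_ : _ - beta (b t) = 0); last by ring.
by apply/min_idPl.
Qed.

(** The positive volume makes every support nonempty. *)
Lemma solution_reflected (u : R -> R -> R) (a b : R -> R) :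
  [lipschitz a t | t in `[0, +oo[] /\ [lipschitz b t | t in `[0, +oo[] ->
  (forall t, 0 <= t -> [set x | 0 < u x t] = `]a t, b t[%classic) ->
  (forall t, 0 <= t -> is_argmin V0 kappa alpha (a t) (b t) (u ^~ t)) ->
  {ae mu, forall t, 0 <= t -> contact_line_law beta u a b t} ->
  (forall t, 0 <= t -> u ^~ t = drop_profile (a t) (b t)) /\
  (forall T, reflected_solution W gs G beta T (fun t => b t - a t) b).
Proof.
move=> [la lb] pos arg law.
have key t : 0 <= t -> u ^~ t = drop_profile (a t) (b t) /\ a t < b t /\ 0 < b t - a t <= W.
  move=> t0; have ab : a t < b t.
    have [[_ _ vol] _] := arg t t0; rewrite ltNge; apply/negP => ba.
    move: vol; rewrite set_itv_ge ?Rintegral_set0 -?leNgt ?bnd_simp//.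
    by move=> e; move: hV0; rewrite -e ltxx.
  have [uE slope] := drop_argmin_unique ab (pos t t0) (arg t t0).
  by split=> //; split=> //; rewrite subr_gt0 ab/= Wmax// subr_gt0.
split; first by move=> t /key[].
move=> T; split.
- have [Ka Ka0 Ha] := lipschitz_constant la; have [Kb Kb0 Hb] := lipschitz_constant lb.
  exists (Ka + Kb); split=> x y; rewrite !in_itv/= => /andP[x0 _] /andP[y0 _].
  + have hx : `[0, +oo[%classic x by rewrite /= in_itv/= x0.
    have hy : `[0, +oo[%classic y by rewrite /= in_itv/= y0.
    rewrite (_ : _ - _ = (b x - b y) - (a x - a y)); last ring.
    apply: le_trans (ler_normB _ _) _.
    by have := Ha _ _ hx hy; have := Hb _ _ hx hy; rewrite mulrDl; lra.
  + have hx : `[0, +oo[%classic x by rewrite /= in_itv/= x0.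
    have hy : `[0, +oo[%classic y by rewrite /= in_itv/= y0.
    by apply: le_trans (Hb _ _ hx hy) _; rewrite ler_wpM2r// lerDr.
- by move=> t; rewrite in_itv/= => /andP[/key[_ [_ ]]].
- case: law => N [mN N0 hN]; exists N; first by exists N; split.
  move=> t /andP[t0 _] nN; have t0' := ltW t0.
  have [uE [_ wb]] := key t t0'.
  apply: (contact_law_motion wb uE).
  exact: contrapT (fun h => nN (hN t (fun k => h (k t0')))).
Qed.

Hypothesis beta0 : forall x, 0 <= beta x.
Hypothesis K0 : 0 <= K.
Hypothesis beta_lip : forall x y, `|beta x - beta y| <= K * `|x - y|.

Let G_lip := @slope_energy_lipschitz R c s V0 c0 W.

Lemma sliding_drop_wellposed u0 : admissible V0 kappa alpha u0 ->
  exists u, solution V0 kappa alpha beta u0 u /\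
    forall v, solution V0 kappa alpha beta u0 v -> forall x t, 0 <= t -> v x t = u x t.
Proof.
move=> [a0 [b0 H0]]; have [ab0 pos0 arg0] := H0.
have [u0E slope0] := drop_argmin_unique ab0 pos0 arg0.
have w00 : 0 < b0 - a0 by rewrite subr_gt0.
have w0W : b0 - a0 <= W by rewrite Wmax.
have gs0 : 0 <= gs by rewrite mulr_ge0// ltW.
have [w [b Hflow]] := flow_exists W0 gs0 K0
  (fun x y => @slope_energy_antitone R c s V0 c0 s0 W x y W0 eW) G_lip
  (fun M => slope_energy_blowup s c0 hV0 M W0) GW beta0 beta_lip b0 w00 w0W.
pose u x t := drop_profile (b t - w t) (b t) x.
have [[lw lb] [ew eb] wW _ _] := Hflow 0.
have wE t : b t - (b t - w t) = w t by ring.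
have spec t : 0 <= t -> [set x | 0 < u x t] = `]b t - w t, b t[%classic /\
    is_argmin V0 kappa alpha (b t - w t) (b t) (u ^~ t).
  move=> t0; have /andP[wt wtW] := wW t t0.
  have ab : b t - w t < b t by rewrite -subr_gt0 wE.
  have [|h1 h2 _ _] := drop_spec ab; first by rewrite wE -Wmax.
  by [].
exists u; split.
  exists a0, b0; split=> //; exists (fun t => b t - w t), b; split.
  - split; last exact: lip0_lipschitz lb.
    apply: (@lip0_lipschitz _ (speed_bound W gs K G beta (b0 - a0) b0 + speed_bound W gs K G beta (b0 - a0) b0)).
    move=> x y x0 y0; rewrite (_ : _ - _ = (b x - b y) - (w x - w y)); last ring.
    apply: le_trans (ler_normB _ _) _; rewrite mulrDl lerD//; [exact: lb|exact: lw].
  - by rewrite eb ew; split=> //; ring.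
  - by move=> t /spec[].
  - by move=> t /spec[].
  have H : {ae mu, forall t : R, forall n : nat, 0 < t < n.+1%:R ->
      (w t < W /\ is_derive t 1 w (width_drift G beta (w t) (b t))) \/
      [/\ w t = W, is_derive t 1 w 0 & 0 <= width_drift G beta (w t) (b t)]}.
    by apply/ae_foralln => n; have [_ _ _ _ h] := Hflow n.+1%:R.
  move: H (ae_neq (0 : R)); apply: filterS2; first exact: (ae_filter_ringOfSetsType mu).
  move=> t H tn t0; have {}t0 : 0 < t by rewrite lt_neqAle eq_sym tn.
  have tT : 0 < t < (Num.truncn t).+1%:R by rewrite t0 truncnS_gt.
  apply: motion_contact_law.
  - by apply: wW; exact: ltW.
  - exact: erefl.
  - by have [_ _ _ h _] := Hflow (Num.truncn t).+1%:R; exact: h.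
  - exact: H tT.
move=> v [a1 [b1 [H1 [a [b' [lab [ea eb'] pos arg law]]]]]] x t t0.
have [ab1 pos1 _] := H1.
have [e1 e2] := itvoo_inj ab0 (etrans (esym pos0) pos1).
have [rep refl] := solution_reflected lab pos arg law.
have [] := reflected_solution_unique K0 G_lip beta_lip t0 (refl t)
  (flow_until_reflected (Hflow t)).
- by rewrite ew ea eb' e1 e2.
- by rewrite eb eb' e2.
move=> ew' eb''; have vE := rep t t0.
have -> : v x t = drop_profile (a t) (b' t) x by rewrite -vE.
by rewrite /u -eb'' -ew'; congr drop_profile; ring.
Qed.

End Dynamics.

End SlidingDrop.

Theorem theorem2p2 (R : realType) (V0 kappa alpha : R)
  (hV0 : 0 < V0) (hkappa : 0 < kappa) (halpha : 0 < alpha < pi / 2)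
  (beta : R -> R) (hbeta0 : forall x, 0 <= beta x) (hbeta : lipschitz beta)
  (u0 : R -> R) (hu0 : admissible V0 kappa alpha u0) :
  exists u : R -> R -> R,
    solution V0 kappa alpha beta u0 u /\
    forall w : R -> R -> R, solution V0 kappa alpha beta u0 w ->
      forall x t : R, 0 <= t -> w x t = u x t.
Proof.
have c0 := cos_coeff_gt0 hkappa halpha; have s0 := sin_coeff_gt0 hkappa halpha.
have [W [W0 eW GW Wmax Wstrict]] := max_width_exists c0 s0 hV0.
have [K K0 hK] := lipschitz_constant hbeta.
apply: (sliding_drop_wellposed hV0 hkappa halpha W0 eW Wmax Wstrict GW hbeta0 K0) hu0 => x y.
exact: hK.
Qed.
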